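(* For all real numbers $N,y$ with $1\le y\le\sqrt N$, $$\sum_{k\le N}(N-k)^2\,\widetilde{\mathfrak S}_y(k)^2=\mathcal T(y)\,\frac{N^3}{3}-\frac14N^2\Big(\log\frac{N}{y^2}\Big)^2+c\,N^2\log\frac{N}{y^2}+O(N^2)+O\!\left(\frac{N^2}{\sqrt y}\log(2N)\right),$$ where $\mathcal T(y)=\sum_{q>y}\frac{\mu(q)^2}{\phi(q)^3}$ and $$c=\frac34-\frac12\log 2\pi+\frac12\sum_p\frac{(p-2)\log p}{p(p-1)^2},$$ and the implied constants are absolute.
   Context: Sums over $k$ and $q$ run over positive integers; in particular $\sum_{k\le N}$ means $\sum_{1\le k\le N}$. The letter $p$ denotes a prime, so $\sum_p$ is a sum over all primes. $\mu$ is the Möbius function and $\phi$ is Euler's totient function. The Ramanujan sum is $c_q(n)=\sum_{1\le a\le q,\ (a,q)=1}e^{2\pi i an/q}$. For a positive integer $k$ and real $y\ge1$, the tail of the singular series is $$\widetilde{\mathfrak S}_y(k)=\sum_{q>y}\frac{\mu(q)^2}{\phi(q)^2}\,c_q(-k).$$ *)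

(* Defs.v *)
From HB Require Import structures.
From mathcomp Require Import all_boot all_order all_algebra.
From mathcomp Require Import complex.
From mathcomp Require Import all_classical all_reals all_analysis.
Set Implicit Arguments.
Unset Strict Implicit.
Unset Printing Implicit Defensive.
Import Order.TTheory GRing.Theory Num.Theory.
Import numFieldNormedType.Exports.
Local Open Scope ring_scope.
Local Open Scope complex_scope.

Definition moebius (n : nat) : int :=
  if (0 < n)%N && all (fun p => ~~ (p ^ 2 %| n)%N) (primes n)
  then (-1) ^+ size (primes n) else 0.

Definition expi (R : realType) (x : R) : R[i] := cos x +i* sin x.

Definition ramanujan_sum (R : realType) (q : nat) (n : int) : R[i] :=
  \sum_(1 <= a < q.+1 | coprime a q) expi (2 * pi * a%:R * n%:~R / q%:R).

Section RamanujanReal.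
Variable R : realType.
Implicit Types (x : R) (n : int).

Lemma expi_int n : expi (2 * pi * n%:~R : R) = 1.
Proof.
have c2 : cos (2 * pi : R) = 1 by rewrite mulr_natl cos2pi.
have s2 : sin (2 * pi : R) = 0 by rewrite mulr_natl sin2pi.
have H (m : nat) : cos (2 * pi * m%:R : R) = 1 /\ sin (2 * pi * m%:R : R) = 0.
  elim: m => [|m [IHc IHs]]; first by rewrite mulr0 cos0 sin0.
  rewrite -[m.+1%:R]natr1 mulrDr mulr1 cosD sinD.
  by rewrite IHc IHs c2 s2 !mulr1 !mulr0 subr0 addr0.
rewrite /expi; case: n => m.
  by have [-> ->] := H m.
rewrite NegzE mulrNz mulrN cosN sinN.
by have [-> ->] := H m.+1; rewrite oppr0.
Qed.

Lemma sin_reflect (q a : nat) n : (0 < a < q)%N ->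
  sin (2 * pi * (q - a)%:R * n%:~R / q%:R : R)
  = - sin (2 * pi * a%:R * n%:~R / q%:R).
Proof.
move=> /andP[a0 aq]; have q0 : q%:R != 0 :> R.
  by rewrite pnatr_eq0; case: q aq.
have -> : 2 * pi * (q - a)%:R * n%:~R / q%:R
    = 2 * pi * n%:~R - 2 * pi * a%:R * n%:~R / q%:R :> R.
  rewrite natrB ?(ltnW aq)// [2 * pi * (_ - _)]mulrBr !mulrBl; congr (_ - _).
  by rewrite [2 * pi * q%:R * _]mulrAC mulfK.
by have [c s] := expi_int n; rewrite sinB c s mul0r mul1r sub0r.
Qed.

Lemma ramanujan_sum_real q n : complex.Im (ramanujan_sum R q n) = 0.
Proof.
rewrite /ramanujan_sum raddf_sum big_mkcond /=.
case: q => [|[|q]]; first by rewrite big_geq.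
  rewrite big_nat1 /= mulr1 invr1 mulr1.
  by have [_ ->] := expi_int n.
rewrite big_nat_recr //= {2}/coprime gcdnn /= addr0.
set S := LHS; suff : S = - S.
  by move/eqP; rewrite -addr_eq0 -mulr2n mulrn_eq0 /= => /eqP.
rewrite {1}/S big_nat_rev /= /S -sumrN big_nat [RHS]big_nat.
apply: eq_bigr => a aq; have /andP[_ /ltnW leaq] := aq.
rewrite add1n subSS sin_reflect// /coprime.
have -> : gcdn (q.+2 - a) q.+2 = gcdn a q.+2.
  by rewrite -{2}(subnK leaq) gcdnDl gcdnC -{2}(subnK leaq) gcdnDr.
by case: ifP; rewrite ?oppr0.
Qed.

End RamanujanReal.

(* [ramanujan_sum] is real by [ramanujan_sum_real], so taking the real part
   loses nothing. *)
Definition singular_tail (R : realType) (y : R) (k : nat) : R :=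
  \big[+%R/0]_(1 <= q <oo | y < q%:R)
    ((moebius q ^+ 2)%:~R / (totient q)%:R ^+ 2
     * complex.Re (ramanujan_sum R q (- k%:Z))).

Definition T_tail (R : realType) (y : R) : R :=
  \big[+%R/0]_(1 <= q <oo | y < q%:R)
    ((moebius q ^+ 2)%:~R / (totient q)%:R ^+ 3 : R).

Definition c_const (R : realType) : R :=
  3 / 4 - ln (2 * pi) / 2
  + 1 / 2 * \big[+%R/0]_(0 <= p <oo | prime p)
      ((p%:R - 2) * ln p%:R / (p%:R * (p%:R - 1) ^+ 2) : R).

(* Main.v *)
(* Write [w(q) = mu(q)^2/phi(q)^2], let S(k) be the full singular series and S_y(k) its
   part [q <= y], so that the tail is S - S_y. Since [c_q(k) = \sum_(d | q, d | k) d mu(q/d)]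
   for squarefree q, both are divisor sums, and the three quadratic moments of S and S_y
   with weight (N - k)^2 reduce to the moments A_d of S along the multiples of d:
   if S(k) = \sum_(d | k) g(d) and S_y(k) = \sum_(d | k) b(d), then the moment of S^2 is
   \sum_d g(d) A_d, that of S S_y is \sum_d b(d) A_d, and that of S_y^2 is elementary
   since its error terms only add up to O(N y^2).

   The function k |-> S(d k) is again a divisor sum \sum_(e | k) g_d(e), where g_d has
   partial sums ln n + gamma + \sum_(p | d) ln p/(p-1) + O(n^(-1/2)) and
   \sum_e g_d(e)/e = d/phi(d). Partial summation against F(u) = \sum_(j <= u) (u - j)^2
   compares A_d with the case g_d(e) = 1/e, which is done by the hyperbola method and
   Stirling's formula: the source of the ln (2 pi) in the constant. The partial sums of g_d
   come from \sum_(m <= x, (m, D) = 1) mu(m)^2/phi(m), uniformly in D. The remaining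
   sums over d are logarithmic averages, and the prime sums in the constant arise from
   averaging \sum_(p | d) ln p/(p-1) over d.

   No Euler product is needed: identities between arithmetic functions of squarefree
   numbers are proved by induction, adjoining one prime at a time. *)
Require Import Defs.
From mathcomp Require Import all_boot all_order all_algebra.
From mathcomp Require Import all_classical all_reals all_analysis.
From mathcomp Require Import complex ring lra.
Set Implicit Arguments.
Unset Strict Implicit.
Unset Printing Implicit Defensive.
Import Order.TTheory GRing.Theory Num.Theory.
Import numFieldNormedType.Exports.
Local Open Scope ring_scope.

(** The size of the errors dictates the form of the estimates. An error x^(3/2) in A_d at x = N/d
    enters with weight d^2 |g(d)|, where g(d) is about 1/d; summed over d <= N it gives N^(3/2)
    times the sum of d^(-1/2), that is N^2. So an error O(n^(-1/2)) in the partial sums of g_d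
    suffices without an extra logarithm, provided that it is uniform in d up to factors such as
    d/phi(d). These are unbounded, but bounded on average: [theta] majorises them by a divisor sum.

    The second error term has a single source. The sum L of mu(q)^2/phi(q) over q <= y is ln y +
    [c1] + O(y^(-1/2)), and this error meets ln(N/y^2) when the three moments are combined. In the
    cubic terms the partial sum t of mu(q)^2/phi(q)^3 over q <= y occurs as - 2 t + t, which leaves
    the tail T(y). In the logarithmic terms Euler's constant cancels, and ln N and ln y fuse into
    ln(N/y^2) because the prime sums of the moments satisfy [phi1 = phi2 + Lam]; the coefficient
    that remains is c. *)

Definition sqf (n : nat) : bool :=
  (0 < n)%N && all (fun p => ~~ (p ^ 2 %| n)%N) (primes n).

Lemma sqf_gt0 n : sqf n -> (0 < n)%N.
Proof. by case/andP. Qed.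

Lemma sqf1 : sqf 1. Proof. by []. Qed.

Lemma sqfP n : reflect ((0 < n)%N /\ forall p, prime p -> ~~ (p ^ 2 %| n)%N) (sqf n).
Proof.
apply: (iffP idP) => [/andP[n0 /allP h]|[n0 h]].
  split=> // p pp; apply/negP => pn.
  have /h : p \in primes n.
    by rewrite mem_primes pp n0 (dvdn_trans _ pn)// expnS dvdn_mulr.
  by rewrite pn.
rewrite /sqf n0; apply/allP => p; rewrite mem_primes => /andP[pp _]; exact: h.
Qed.

Lemma sqf_dvd m n : (m %| n)%N -> sqf n -> sqf m.
Proof.
move=> mn /sqfP[n0 h]; apply/sqfP; split; first exact: dvdn_gt0 mn.
by move=> p pp; apply: contra (h p pp) => pm; exact: dvdn_trans mn.
Qed.

Lemma sqfM m n : sqf (m * n) = [&& sqf m, sqf n & coprime m n].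
Proof.
apply/idP/and3P => [h|[hm hn cmn]].
  have mn0 := sqf_gt0 h; split.
  - exact: (sqf_dvd (dvdn_mulr n (dvdnn m)) h).
  - exact: (sqf_dvd (dvdn_mull m (dvdnn n)) h).
  - apply/negPn/negP => /negP; rewrite /coprime => g1.
    have g0 : (0 < gcdn m n)%N by rewrite gcdn_gt0; move: mn0; rewrite muln_gt0 => /andP[->].
    have g2 : (1 < gcdn m n)%N by move: g0 g1; case: (gcdn m n) => [|[]].
    have pp := pdiv_prime g2.
    have /sqfP[_ /(_ _ pp)/negP[]] := h.
    rewrite expnS expn1; apply: dvdn_mul.
      exact: dvdn_trans (pdiv_dvd _) (dvdn_gcdl _ _).
    exact: dvdn_trans (pdiv_dvd _) (dvdn_gcdr _ _).
have /sqfP[m0 h1] := hm; have /sqfP[n0 h2] := hn.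
apply/sqfP; split=> [|p pp]; first by rewrite muln_gt0 m0.
case: (boolP (p %| m)%N) => pm.
  have cpn : coprime p n by apply: coprime_dvdl cmn.
  by rewrite Gauss_dvdl ?coprimeXl// h1.
have cpm : coprime p m by rewrite prime_coprime.
by rewrite Gauss_dvdr ?coprimeXl// h2.
Qed.

Lemma sqf_prime p : prime p -> sqf p.
Proof.
move=> pp; apply/sqfP; split=> [|r rr]; first exact: prime_gt0.
apply/negP => h; have rp : (r %| p)%N.
  by apply: dvdn_trans h; rewrite expnS dvdn_mulr.
have /eqP rpE : r == p by rewrite -dvdn_prime2.
move: h; rewrite rpE => /dvdn_leq -/(_ (prime_gt0 pp)).
by rewrite expnS expn1 leqNgt ltn_Pmull ?prime_gt1 ?prime_gt0.
Qed.

Lemma sqf_ind (P : nat -> Prop) : P 1%N ->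
  (forall p n, prime p -> ~~ (p %| n)%N -> sqf n -> P n -> P (p * n)%N) ->
  forall n, sqf n -> P n.
Proof.
move=> P1 IH n; elim/ltn_ind: n => n IHn sn.
have n0 := sqf_gt0 sn.
have [n1|n1] := leqP n 1.
  by have -> : n = 1%N by apply/eqP; rewrite eqn_leq n1.
have pp := pdiv_prime n1; have pn := pdiv_dvd n.
set p := pdiv n in pp pn *.
have nE : n = (p * (n %/ p))%N by rewrite mulnC divnK.
move: (sn); rewrite nE sqfM prime_coprime// => /and3P[_ sq cp].
apply: IH => //; apply: IHn => //.
by apply: ltn_Pdiv => //; exact: prime_gt1.
Qed.

Lemma perm_primesM m n : (0 < m)%N -> (0 < n)%N -> coprime m n ->
  perm_eq (primes (m * n)) (primes m ++ primes n).
Proof.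
move=> m0 n0 cmn; apply: uniq_perm; first exact: primes_uniq.
  rewrite cat_uniq !primes_uniq andbT /= -coprime_has_primes//.
by move=> p; rewrite mem_cat primesM.
Qed.

Lemma perm_primes_pM p n : prime p -> ~~ (p %| n)%N -> (0 < n)%N ->
  perm_eq (primes (p * n)) (p :: primes n).
Proof.
move=> pp pn n0; rewrite -cat1s -primes_prime//.
by apply: perm_primesM => //; [exact: prime_gt0|rewrite prime_coprime].
Qed.

Lemma perm_divisors_pM p n : prime p -> ~~ (p %| n)%N -> (0 < n)%N ->
  perm_eq (divisors (p * n)) (divisors n ++ map (muln p) (divisors n)).
Proof.
move=> pp pn n0; have p0 := prime_gt0 pp.
have pn0 : (0 < p * n)%N by rewrite muln_gt0 p0.
apply: uniq_perm; first exact: divisors_uniq.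
  rewrite cat_uniq divisors_uniq map_inj_uniq ?divisors_uniq ?andbT /=; last first.
    by move=> a b /eqP; rewrite eqn_pmul2l// => /eqP.
  apply/hasPn => _ /mapP[d _ ->]; apply/negP; rewrite /= -dvdn_divisors// => h.
  by move: pn; rewrite (dvdn_trans _ h)// dvdn_mulr.
move=> d; rewrite mem_cat -!dvdn_divisors//; apply/idP/orP => [dpn|[dn|]].
- case: (boolP (p %| d)%N) => pd.
    right; apply/mapP; exists (d %/ p)%N; last by rewrite mulnC divnK.
    by rewrite -dvdn_divisors// -(dvdn_pmul2l p0) mulnC divnK.
  by left; rewrite Gauss_dvdr in dpn => //; rewrite coprime_sym prime_coprime.
- by rewrite dvdn_mull.
- by move=> /mapP[e]; rewrite -dvdn_divisors// => en ->; rewrite dvdn_pmul2l.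
Qed.

(** * Squarefree numbers and divisor sums *)

Section Arith.
Variable R : realType.
Implicit Types (a b : nat -> R) (m n p : nat).

(* Functions of the set of primes dividing [n]; they are compared with ordinary
   multiplicative functions on squarefree numbers only. *)
Definition mf a n : R := \prod_(p <- primes n) a p.
Definition af a n : R := \sum_(p <- primes n) a p.

Lemma mf1 a : mf a 1 = 1. Proof. by rewrite /mf big_nil. Qed.
Lemma af1 a : af a 1 = 0. Proof. by rewrite /af big_nil. Qed.

Lemma mfpM a p n : prime p -> ~~ (p %| n)%N -> (0 < n)%N ->
  mf a (p * n) = a p * mf a n.
Proof. by move=> pp pn n0; rewrite /mf (perm_big _ (perm_primes_pM pp pn n0)) big_cons. Qed.

Lemma afpM a p n : prime p -> ~~ (p %| n)%N -> (0 < n)%N ->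
  af a (p * n) = a p + af a n.
Proof. by move=> pp pn n0; rewrite /af (perm_big _ (perm_primes_pM pp pn n0)) big_cons. Qed.

Lemma mfp a p : prime p -> mf a p = a p.
Proof. by move=> pp; rewrite /mf primes_prime// big_seq1. Qed.

Lemma afp a p : prime p -> af a p = a p.
Proof. by move=> pp; rewrite /af primes_prime// big_seq1. Qed.

Lemma mfM a m n : (0 < m)%N -> (0 < n)%N -> coprime m n ->
  mf a (m * n) = mf a m * mf a n.
Proof. by move=> *; rewrite /mf (perm_big _ (perm_primesM _ _ _))// big_cat. Qed.

Lemma afM a m n : (0 < m)%N -> (0 < n)%N -> coprime m n ->
  af a (m * n) = af a m + af a n.
Proof. by move=> *; rewrite /af (perm_big _ (perm_primesM _ _ _))// big_cat. Qed.

Lemma mf_mul a b n : mf (fun p => a p * b p) n = mf a n * mf b n.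
Proof. by rewrite /mf big_split. Qed.

Lemma eq_mf a b n : (forall p, prime p -> a p = b p) -> mf a n = mf b n.
Proof.
move=> ab; rewrite /mf !big_seq; apply: eq_bigr => p.
by rewrite mem_primes => /andP[/ab].
Qed.

Lemma eq_af a b n : (forall p, prime p -> a p = b p) -> af a n = af b n.
Proof.
move=> ab; rewrite /af !big_seq; apply: eq_bigr => p.
by rewrite mem_primes => /andP[/ab].
Qed.

Lemma mf_ge0 a n : (forall p, prime p -> 0 <= a p) -> 0 <= mf a n.
Proof.
move=> h; rewrite /mf big_seq; apply: prodr_ge0 => p.
by rewrite mem_primes => /andP[/h].
Qed.

Lemma mf_gt0 a n : (forall p, prime p -> 0 < a p) -> 0 < mf a n.
Proof.
move=> h; rewrite /mf big_seq; apply: prodr_gt0 => p.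
by rewrite mem_primes => /andP[/h].
Qed.

Lemma mf_ge1 a n : (forall p, prime p -> 1 <= a p) -> 1 <= mf a n.
Proof.
move=> h; rewrite /mf big_seq; elim/big_ind: _ => //.
  by move=> x y x1 y1; rewrite -[1]mulr1 ler_pM.
by move=> p; rewrite mem_primes => /andP[/h].
Qed.

Lemma ler_mf a b n : (forall p, prime p -> 0 <= a p <= b p) -> mf a n <= mf b n.
Proof.
move=> h; rewrite /mf !big_seq; apply: ler_prod => p.
by rewrite mem_primes => /andP[/h].
Qed.

Lemma mfV a n : mf (fun p => (a p)^-1) n = (mf a n)^-1.
Proof. by rewrite /mf prodfV. Qed.

Lemma dsum1 (F : nat -> R) : \sum_(d <- divisors 1) F d = F 1%N.
Proof. by rewrite /divisors /= big_seq1. Qed.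

Lemma dsumpM (F : nat -> R) p n : prime p -> ~~ (p %| n)%N -> (0 < n)%N ->
  \sum_(d <- divisors (p * n)) F d =
  \sum_(d <- divisors n) F d + \sum_(d <- divisors n) F (p * d)%N.
Proof.
move=> pp pn n0.
by rewrite (perm_big _ (perm_divisors_pM pp pn n0)) big_cat big_map.
Qed.

Lemma eq_dsum (F G : nat -> R) n : (0 < n)%N -> (forall d, (d %| n)%N -> F d = G d) ->
  \sum_(d <- divisors n) F d = \sum_(d <- divisors n) G d.
Proof.
move=> n0 FG; rewrite !big_seq; apply: eq_bigr => d.
by rewrite -dvdn_divisors// => /FG.
Qed.

Lemma big_nat_pred1 (F : nat -> R) k n (P : pred nat) : (0 < k < n)%N ->
  (forall m, P m = (m == k)) -> \sum_(1 <= m < n | P m) F m = F k.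
Proof.
move=> kn h; rewrite (eq_bigl _ _ h) -big_filter.
rewrite (perm_big [:: k]) ?big_seq1//; apply: uniq_perm => //.
  by rewrite filter_uniq// iota_uniq.
move=> m; rewrite mem_filter mem_index_iota inE.
by case: eqP => //= ->; rewrite kn.
Qed.

(** Both sides run over the pairs with [j * m <= n], grouped by the product on the left and by the
    first factor on the right. Partial sums of convolutions go through this rearrangement. *)
Lemma dsum_hyperbola (F : nat -> nat -> R) n :
  \sum_(1 <= e < n.+1) \sum_(j <- divisors e) F j (e %/ j)%N =
  \sum_(1 <= j < n.+1) \sum_(1 <= m < (n %/ j).+1) F j m.
Proof.
(* Each divisor sum is spread over the fixed box of pairs up to [n], so that the order of summation
   can be exchanged. *)
have L e : (0 < e)%N -> (e <= n)%N ->
    \sum_(j <- divisors e) F j (e %/ j)%N =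
    \sum_(1 <= j < n.+1) \sum_(1 <= m < n.+1 | (j * m == e)%N) F j m.
  move=> e0 en.
  transitivity (\sum_(1 <= j < n.+1 | (j %| e)%N) F j (e %/ j)%N).
    rewrite -[RHS]big_filter; apply: perm_big; apply: uniq_perm.
    - exact: divisors_uniq.
    - by rewrite filter_uniq// iota_uniq.
    - move=> j; rewrite -dvdn_divisors// mem_filter mem_index_iota ltnS.
      case: (boolP (j %| e)%N) => //= je; rewrite (dvdn_gt0 e0 je).
      by rewrite (leq_trans (dvdn_leq e0 je) en).
  rewrite big_mkcond; apply: eq_big_nat => j /andP[j0 _].
  case: ifPn => je.
    rewrite (@big_nat_pred1 _ (e %/ j)%N)//.
      by rewrite divn_gt0// (dvdn_leq e0 je) ltnS (leq_trans (leq_div _ _) en).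
    by move=> m; rewrite -{1}(divnK je) mulnC eqn_pmul2r.
  rewrite big_pred0// => m; apply/negP => /eqP h.
  by move: je; rewrite -h dvdn_mulr.
rewrite (eq_big_nat _ _ (F2 := fun e => \sum_(1 <= j < n.+1)
    \sum_(1 <= m < n.+1 | (j * m == e)%N) F j m)); last first.
  by move=> e /andP[e0 en]; apply: L.
rewrite exchange_big /=; apply: eq_big_nat => j /andP[j0 _].
under eq_bigr do rewrite big_mkcond.
rewrite exchange_big /=.
have nj : (n %/ j <= n)%N by apply: leq_div.
rewrite [RHS](big_nat_widen _ _ n.+1)//= [RHS]big_mkcond /=.
apply: eq_big_nat => m /andP[m0 _]; rewrite -big_mkcond /= ltnS leq_divRL// mulnC.
case: ifPn => mj.
  rewrite (@big_nat_pred1 _ (j * m)%N)//.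
    by rewrite muln_gt0 j0 m0 ltnS mulnC.
  by move=> e; rewrite eq_sym mulnC.
rewrite big_nat_cond big_pred0// => e; apply/negP => /andP[/andP[_ en] /eqP h].
by move: mj; rewrite h -ltnS en.
Qed.

Definition mu n : R := (moebius n)%:~R.

Lemma mu_nsqf n : ~~ sqf n -> mu n = 0.
Proof. by rewrite /mu /moebius -/(sqf n) => /negbTE ->. Qed.

Lemma muE n : sqf n -> mu n = mf (fun=> -1) n.
Proof.
rewrite /mu /moebius -/(sqf n) => ->.
by rewrite /mf big_const_seq count_predT iter_mulr_1 rmorphXn /= rmorphN1.
Qed.

Lemma moebius_sqr n : (moebius n ^+ 2)%:~R = (sqf n)%:R :> R.
Proof.
rewrite /moebius -/(sqf n); case: ifP => // _.
by rewrite -exprM mulnC exprM sqrrN !expr1n.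
Qed.

Lemma prime_gt1r p : prime p -> 1 < p%:R :> R.
Proof. by move=> pp; rewrite ltr1n prime_gt1. Qed.

Lemma prime_ge2r p : prime p -> 2 <= p%:R :> R.
Proof. by move=> pp; rewrite (ler_nat _ 2) prime_gt1. Qed.

Lemma totient_mf n : sqf n -> (totient n)%:R = mf (fun p => p%:R - 1) n.
Proof.
move: n; apply: sqf_ind => [|p n pp pn sn IH]; first by rewrite mf1.
rewrite totient_coprime ?prime_coprime// natrM IH mfpM ?sqf_gt0// totient_prime//.
by rewrite -subn1 natrB ?prime_gt0.
Qed.

Lemma natr_mf n : sqf n -> n%:R = mf (fun p => p%:R) n.
Proof.
move: n; apply: sqf_ind => [|p n pp pn sn IH]; first by rewrite mf1.
by rewrite natrM IH mfpM ?sqf_gt0.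
Qed.

Lemma ln_af n : sqf n -> ln n%:R = af (fun p => ln p%:R) n.
Proof.
move: n; apply: sqf_ind => [|p n pp pn sn IH]; first by rewrite af1 ln1.
have [p0 n0] := (prime_gt0 pp, sqf_gt0 sn).
by rewrite natrM lnM ?posrE ?ltr0n// IH afpM.
Qed.

Lemma divn_pM p d n : prime p -> (d %| n)%N -> (0 < n)%N ->
  ((p * n) %/ d = p * (n %/ d))%N /\ ((p * n) %/ (p * d) = n %/ d)%N.
Proof.
move=> pp dn n0; have d0 := dvdn_gt0 n0 dn.
by rewrite divnMl ?prime_gt0// muln_divA.
Qed.

Lemma ndvd_div p d n : (d %| n)%N -> ~~ (p %| n)%N -> ~~ (p %| n %/ d)%N.
Proof. by move=> dn; apply: contra => h; rewrite (dvdn_trans h)// dvdn_div. Qed.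

Lemma ndvd_dvd p d n : (d %| n)%N -> ~~ (p %| n)%N -> ~~ (p %| d)%N.
Proof. by move=> dn; apply: contra => h; rewrite (dvdn_trans h dn). Qed.

Lemma divn_pos d n : (d %| n)%N -> (0 < n)%N -> (0 < n %/ d)%N.
Proof. by move=> dn n0; rewrite divn_gt0 ?(dvdn_gt0 n0 dn)// dvdn_leq. Qed.

(** Each prime of [n] goes either to [d] or to [n %/ d], whence the local factor [a p + b p]. This
    stands in for multiplying Euler factors. *)
Lemma dsum_conv a b n : sqf n ->
  \sum_(d <- divisors n) mf a d * mf b (n %/ d) = mf (fun p => a p + b p) n.
Proof.
move: n; apply: sqf_ind => [|p n pp pn sn IH]; first by rewrite dsum1 !mf1 mulr1.
have n0 := sqf_gt0 sn.
rewrite dsumpM// mfpM// mulrDl -IH !mulr_sumr addrC; congr (_ + _).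
  apply: eq_dsum => // d dn; have [h1 h2] := divn_pM pp dn n0.
  by rewrite h2 mfpM ?mulrA ?(ndvd_dvd dn)// (dvdn_gt0 n0).
apply: eq_dsum => // d dn; have [h1 h2] := divn_pM pp dn n0.
by rewrite h1 mfpM ?(ndvd_div dn)// ?divn_pos// mulrCA.
Qed.

Lemma dsum_mf a n : sqf n -> \sum_(d <- divisors n) mf a d = mf (fun p => a p + 1) n.
Proof.
move=> sn; rewrite -dsum_conv//; apply: eq_bigr => d _.
by rewrite [X in _ * X]/mf [X in _ * X]big1 ?mulr1.
Qed.

(** The logarithmic derivative of [dsum_conv]: replace [a p] by a(p) exp(t c(p)) and differentiate
    at t = 0. Writing the derivative as a multiple of the product calls for [a p + b p] to be
    nonzero. *)
Lemma dsum_conv_af a b c n : (forall p, prime p -> a p + b p != 0) -> sqf n ->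
  \sum_(d <- divisors n) mf a d * mf b (n %/ d) * af c d =
  mf (fun p => a p + b p) n * af (fun p => c p * a p / (a p + b p)) n.
Proof.
move=> ab; move: n; apply: sqf_ind => [|p n pp pn sn IH].
  by rewrite dsum1 !af1 !mulr0.
have n0 := sqf_gt0 sn.
rewrite dsumpM// mfpM// afpM//.
rewrite (@eq_dsum _ (fun d => b p * (mf a d * mf b (n %/ d) * af c d)))//; last first.
  move=> d dn; have [h1 h2] := divn_pM pp dn n0.
  by rewrite h1 mfpM ?(ndvd_div dn)// ?divn_pos//; ring.
rewrite -mulr_sumr IH.
rewrite (@eq_dsum _ (fun d => a p * c p * (mf a d * mf b (n %/ d)) +
   a p * (mf a d * mf b (n %/ d) * af c d)))//; last first.
  move=> d dn; have [h1 h2] := divn_pM pp dn n0; have d0 := dvdn_gt0 n0 dn.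
  by rewrite h2 mfpM ?(ndvd_dvd dn)// afpM ?(ndvd_dvd dn)//; ring.
rewrite big_split /= -!mulr_sumr IH dsum_conv//.
by field; exact: ab.
Qed.

Lemma sqf_dvdm d n : sqf n -> (d %| n)%N -> sqf d /\ sqf (n %/ d).
Proof.
move=> sn dn; move: (sn); rewrite -{1}(divnK dn) sqfM => /and3P[-> -> _].
by [].
Qed.

Lemma dsum_mu n : sqf n -> \sum_(d <- divisors n) mu d = (n == 1%N)%:R.
Proof.
move=> sn; rewrite (@eq_dsum _ (mf (fun=> -1))) ?sqf_gt0//; last first.
  by move=> d /(sqf_dvdm sn)[sd _]; exact: muE.
rewrite dsum_mf//; move: n sn; apply: sqf_ind => [|p n pp pn sn _]; first by rewrite mf1.
rewrite mfpM ?sqf_gt0// addNr mul0r; case: eqP => // /eqP.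
by rewrite muln_eq1 => /andP[/eqP p1]; move: pp; rewrite p1.
Qed.

Lemma mu_pM p n : prime p -> ~~ (p %| n)%N -> (0 < n)%N -> mu (p * n) = - mu n.
Proof.
move=> pp pn n0; case: (boolP (sqf n)) => sn.
  have spn : sqf (p * n) by rewrite sqfM sn sqf_prime// prime_coprime.
  by rewrite !muE// mfpM// mulN1r.
by rewrite !mu_nsqf ?oppr0// sqfM (negbTE sn) andbF.
Qed.

(** The analogue of the formula that turns the sum of mu(d) ln d over d | n into - Lambda(n).
    Together with [dsum_mu] it is why only [q = 1] and prime [q] survive in [Tm_main] and
    [GX_main]. *)
Lemma dsum_mu_af a n : sqf n ->
  \sum_(d <- divisors n) mu d * af a d = if prime n then - a n else 0.
Proof.
move: n; apply: sqf_ind => [|p n pp pn sn IH]; first by rewrite dsum1 af1 mulr0.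
have n0 := sqf_gt0 sn.
rewrite dsumpM// -big_split /=.
rewrite (@eq_dsum _ (fun d => - a p * mu d))//; last first.
  move=> d dn; have d0 := dvdn_gt0 n0 dn.
  by rewrite mu_pM ?(ndvd_dvd dn)// afpM ?(ndvd_dvd dn)//; ring.
rewrite -mulr_sumr dsum_mu//; case: (n =P 1%N) => [->|n1].
  by rewrite muln1 pp mulr1.
rewrite mulr0; case: ifP => // /primeP[_ /(_ p)]; rewrite dvdn_mulr//.
move=> /(_ isT) /orP[/eqP p1|/eqP h]; first by move: pp; rewrite p1.
case: n1; apply/eqP; rewrite -(eqn_pmul2l (prime_gt0 pp)) muln1; exact/eqP.
Qed.

(** Only primes below [p0] can violate [a p <= b p]; there are at most [p0] of them, and each costs
    a factor [M]. *)
Lemma mf_comparison a b p0 M n : 1 <= M ->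
  (forall p, prime p -> 0 <= a p) -> (forall p, prime p -> 0 <= b p) ->
  (forall p, prime p -> a p <= M * b p) ->
  (forall p, prime p -> (p0 <= p)%N -> a p <= b p) ->
  mf a n <= M ^+ p0 * mf b n.
Proof.
move=> M1 a0 b0 aMb ab; have M0 : 0 <= M by apply: le_trans M1.
pose m p := if (p < p0)%N then M else 1.
have h : mf a n <= mf m n * mf b n.
  rewrite -mf_mul; apply: ler_mf => p pp; rewrite a0//= /m.
  by case: ltnP => [_|/ab]; [exact: aMb|rewrite mul1r; exact].
apply: le_trans h _; apply: ler_wpM2r; first exact: mf_ge0.
rewrite /mf -(big_mkcond (fun p => (p < p0)%N) (fun=> M)) -big_filter.
rewrite big_const_seq count_predT iter_mulr_1.
apply: ler_weXn2l => //.
rewrite -[X in (_ <= X)%N](size_iota 0 p0); apply: uniq_leq_size.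
  by rewrite filter_uniq// primes_uniq.
by move=> p; rewrite mem_filter mem_iota => /andP[].
Qed.

End Arith.

(** * Logarithms and convergent series *)

Section Analysis.
Variable R : realType.
Implicit Types (x y t : R) (m n : nat) (u v a : nat -> R).

Lemma eq_ler x y : x = y -> x <= y. Proof. by move->. Qed.

Lemma sqrt_ge1 x : 1 <= x -> 1 <= Num.sqrt x.
Proof. by move=> x1; rewrite -sqrtr1 ler_wsqrtr. Qed.

Lemma natr_divn m n : (0 < m)%N -> (m %| n)%N -> (n %/ m)%:R = n%:R / m%:R :> R.
Proof.
move=> m0 mn; have mr : m%:R != 0 :> R by rewrite pnatr_eq0 -lt0n.
by apply: (mulIf mr); rewrite -natrM divnK// divfK.
Qed.

Lemma le_of_derive (f df : R -> R) x y : x <= y ->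
  (forall t, x <= t <= y -> is_derive t 1 f (df t)) ->
  (forall t, x <= t <= y -> 0 <= df t) -> f x <= f y.
Proof.
move=> xy fd df0.
have [||c cI E] := @MVT_segment R f df x y xy.
- by move=> t; rewrite in_itv /= => /andP[h1 h2]; apply: fd; rewrite !ltW.
- apply: derivable_within_continuous => t; rewrite in_itv /= => h.
  by have := fd t h => -[].
- rewrite -subr_ge0 E mulr_ge0 ?subr_ge0//; apply: df0.
  by move: cI; rewrite in_itv.
Qed.

Lemma deriveD1 (f g : R -> R) x (a b c : R) : is_derive x 1 f a -> is_derive x 1 g b ->
  c = a + b -> is_derive x 1 (fun y => f y + g y) c.
Proof. by move=> hf hg ->; exact: is_deriveD. Qed.

Lemma deriveN1 (f : R -> R) x (a c : R) : is_derive x 1 f a ->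
  c = - a -> is_derive x 1 (fun y => - f y) c.
Proof. by move=> hf ->; exact: is_deriveN. Qed.

Lemma deriveM1 (f g : R -> R) x (a b c : R) : is_derive x 1 f a -> is_derive x 1 g b ->
  c = a * g x + f x * b -> is_derive x 1 (fun y => f y * g y) c.
Proof.
move=> hf hg ->; have := @is_deriveM R R f g x 1 a b hf hg.
by rewrite addrC [_ *: a]mulrC.
Qed.

Lemma deriveC1 (k : R) x : is_derive x 1 (fun=> k) 0.
Proof. exact: is_derive_cst. Qed.

Lemma deriveI1 x : is_derive x 1 (fun y : R => y) 1.
Proof. exact: is_derive_id. Qed.

Lemma deriveX1 (f : R -> R) n x (a c : R) : is_derive x 1 f a ->
  c = n%:R * f x ^+ n.-1 * a -> is_derive x 1 (fun y => f y ^+ n) c.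
Proof.
move=> hf; elim: n c => [|n IH] c ->.
  rewrite !mul0r; have -> : (fun y => f y ^+ 0) = (fun=> 1) by apply/funext => y.
  exact: deriveC1.
have -> : (fun y => f y ^+ n.+1) = (fun y => f y * f y ^+ n) by apply/funext => y; rewrite exprS.
apply: (deriveM1 hf (IH _ erefl)) => /=.
case: n {IH} => [|n] /=; first by rewrite !expr0; ring.
by rewrite exprS -[n.+2%:R]natr1; ring.
Qed.

Lemma deriveV1 x : x != 0 -> is_derive x 1 (fun y => y^-1) (- x ^- 2).
Proof.
move=> x0; apply: is_derive_eq; first exact: (is_deriveV x0 (deriveI1 x)).
by rewrite /GRing.scale /= mulr1.
Qed.

(** At [x = (n + 1) / n] this measures the trapezoidal rule for ln on [n, n + 1]. The middle term
    has derivative (t - 1)^2 / (2 t^2), which lies between 0 and (t - 1)^2 / 2 for t >= 1. *)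
Lemma ln_pade x : 1 <= x ->
  0 <= (x - x^-1) / 2 - ln x <= (x - 1) ^+ 3 / 6.
Proof.
move=> x1.
have D t : 1 <= t -> is_derive t 1 (fun t : R => ((t - t^-1) * 2^-1) - ln t)
    ((t - 1) ^+ 2 / (2 * t ^+ 2)).
  move=> t1; have t0 : t != 0 by rewrite gt_eqF//; lra.
  have t0' : 0 < t by lra.
  apply: (deriveD1 (deriveM1 (deriveD1 (deriveI1 t) (deriveN1 (deriveV1 t0) erefl) erefl)
    (deriveC1 _ t) erefl) (deriveN1 (is_derive1_ln t0') erefl)).
  by field.
have pos t : 0 <= (t - 1) ^+ 2 / (2 * t ^+ 2) :> R.
  by rewrite divr_ge0 ?sqr_ge0// mulr_ge0// sqr_ge0.
apply/andP; split.
  have := @le_of_derive _ _ 1 x x1 (fun t h => D t ltac:(by case/andP: h)) (fun t _ => pos t).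
  by rewrite ln1 invr1 subrr mul0r subr0.
have D2 t : 1 <= t -> is_derive t 1
   (fun t : R => (t - 1) ^+ 3 * 6^-1 - (((t - t^-1) * 2^-1) - ln t))
    ((t - 1) ^+ 2 / 2 - (t - 1) ^+ 2 / (2 * t ^+ 2)).
  move=> t1; apply: (deriveD1 (deriveM1 (deriveX1 (n := 3) (deriveD1 (deriveI1 t)
    (deriveC1 _ t) erefl) erefl) (deriveC1 _ t) erefl) (deriveN1 (D t t1) erefl)).
  by rewrite /=; field; rewrite gt_eqF//; lra.
have := @le_of_derive _ _ 1 x x1 (fun t h => D2 t ltac:(by case/andP: h)).
rewrite ln1 invr1 !subrr expr0n /= !mul0r subr0 subr0 => H.
rewrite -subr_ge0; apply: H => t /andP[t1 _].
rewrite subr_ge0 ler_wpM2l ?sqr_ge0//.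
have t2 : 1 <= t ^+ 2 by rewrite exprn_ege1.
by rewrite lef_pV2 ?posrE; lra.
Qed.

(** The intervals from [u n - v n] to [u n + v n] are nested, and [l] is the supremum of their left
    ends. A good choice of [v] yields a limit and its rate at once. *)
Lemma seq_lim u v :
  (forall n, (0 < n)%N -> `|u n.+1 - u n| <= v n - v n.+1) ->
  (forall n, (0 < n)%N -> 0 <= v n) ->
  exists l, forall n, (0 < n)%N -> `|u n - l| <= v n.
Proof.
move=> h vge0.
have Ndec m n : (0 < m)%N -> (m <= n)%N -> u m - v m <= u n - v n /\ u n + v n <= u m + v m.
  move=> m0 /subnK <-; elim: (n - m)%N => [|k [I1 I2]]; first by rewrite add0n.
  have := h (k + m)%N; rewrite addn_gt0 m0 orbT => /(_ isT).
  by rewrite ler_norml addSn => /andP[h1 h2]; split; lra.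
have A n m : (0 < n)%N -> (0 < m)%N -> u n - v n <= u m + v m.
  move=> n0 m0; have [nm|mn] := leqP n m.
    have [h1 _] := Ndec _ _ n0 nm; have := vge0 _ m0; lra.
  have [_ h1] := Ndec _ _ m0 (ltnW mn); have := vge0 _ n0; lra.
pose S := [set u n - v n | n in [set n | (0 < n)%N]]%classic.
have S0 : (S !=set0)%classic by exists (u 1%N - v 1%N); exists 1%N.
exists (sup S) => n n0; rewrite ler_norml; apply/andP; split.
  have : sup S <= u n + v n.
    by apply: ge_sup => // _ [m m0 <-]; exact: A.
  lra.
have : u n - v n <= sup S.
  apply: ub_le_sup; last by exists n.
  by exists (u n + v n) => _ [m m0 <-]; exact: A.
lra.
Qed.

(* [r4 x = x ^ (1/4)] and [z n = n ^ (-5/4)]: every series below is dominated by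
   a multiple of [z], so its tails are [O(n ^ (-1/4))]. *)
Definition r4 x : R := Num.sqrt (Num.sqrt x).
Definition z n : R := (n%:R * r4 n%:R)^-1.

Lemma r4_ge0 x : 0 <= r4 x. Proof. exact: sqrtr_ge0. Qed.
Lemma r4_gt0 x : 0 < x -> 0 < r4 x. Proof. by move=> x0; rewrite !sqrtr_gt0. Qed.
Lemma r4X x : 0 <= x -> r4 x ^+ 4 = x.
Proof. by move=> x0; rewrite (exprM _ 2 2) !sqr_sqrtr// sqrtr_ge0. Qed.
Lemma r4X2 x : r4 x ^+ 2 = Num.sqrt x.
Proof. by rewrite sqr_sqrtr// sqrtr_ge0. Qed.
Lemma r4M x y : 0 <= x -> r4 (x * y) = r4 x * r4 y.
Proof. by move=> x0; rewrite /r4 sqrtrM// sqrtrM// sqrtr_ge0. Qed.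
Lemma ler_r4 x y : x <= y -> r4 x <= r4 y.
Proof. by move=> xy; rewrite !ler_wsqrtr. Qed.
Lemma r41 : r4 1 = 1. Proof. by rewrite /r4 !sqrtr1. Qed.
Lemma r4_ge1 n : (0 < n)%N -> 1 <= r4 n%:R.
Proof. by move=> n0; have := @ler_r4 1 n%:R; rewrite r41 ler1n; exact. Qed.

Lemma r4_big e : 0 < e -> exists2 n, (0 < n)%N & forall m, (n <= m)%N -> (r4 m%:R)^-1 <= e.
Proof.
move=> e0; exists (Num.truncn (e^-1 ^+ 4)).+1 => // m nm.
have h : e^-1 ^+ 4 <= m%:R.
  by apply: le_trans (ltW (truncnS_gt _)) _; rewrite ler_nat.
have i0 : 0 < e^-1 by rewrite invr_gt0.
rewrite -[e]invrK lef_pV2 ?posrE//; last first.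
  by apply: r4_gt0; apply: lt_le_trans h; rewrite exprn_gt0.
apply: le_trans (ler_r4 h); rewrite /r4 (exprM _ 2 2) sqrtr_sqr ger0_norm ?sqr_ge0//.
by rewrite sqrtr_sqr ger0_norm// ltW.
Qed.

(** This is how an auxiliary cutoff [n] is sent to infinity: an estimate carrying an extra error
    n^(-1/4) is freed of it. *)
Lemma le_r4 x y (C : R) m : (forall n, (m <= n)%N -> x <= y + C / r4 n%:R) -> x <= y.
Proof.
move=> h; rewrite leNgt; apply/negP => yx.
have K0 : 0 < `|C| + 1 by rewrite ltr_wpDl.
have [n n0 hn] := @r4_big ((x - y) / 2 / (`|C| + 1)) ltac:(apply: divr_gt0 => //; lra).
have := h (maxn m n) (leq_maxl _ _); have := hn _ (leq_maxr m n).
set r := _^-1 => h1 h2.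
have r0 : 0 <= r by rewrite invr_ge0 r4_ge0.
have : C * r <= (`|C| + 1) * r by rewrite ler_wpM2r//; have := ler_norm C; lra.
have : (`|C| + 1) * r <= (x - y) / 2 by rewrite mulrC -ler_pdivlMr.
lra.
Qed.

Lemma z_ge0 n : 0 <= z n.
Proof. by rewrite invr_ge0 mulr_ge0 ?r4_ge0. Qed.

(** With [a], [b] the fourth roots of [n] and [n + 1], the identity [b ^+ 4 - a ^+ 4 = 1] forces
    [b - a] to be at least 1 / (4 b^3): the integral test for x^(-5/4). *)
Lemma z_telescope n : (0 < n)%N -> z n.+1 <= 4 / r4 n%:R - 4 / r4 n.+1%:R.
Proof.
move=> n0; rewrite /z.
set a := r4 n%:R; set b := r4 n.+1%:R.
have a1 : 1 <= a by exact: r4_ge1.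
have ab : a <= b by rewrite ler_r4// ler_nat.
have bE : b ^+ 4 = n.+1%:R by rewrite r4X.
have aE : a ^+ 4 = n%:R by rewrite r4X.
have E : b ^+ 4 - a ^+ 4 = 1 by rewrite bE aE -natr1; ring.
rewrite -bE.
have -> : 4 / a - 4 / b = 4 * (b - a) / (a * b).
  by field; rewrite !gt_eqF//; lra.
rewrite ler_pdivlMr ?mulr_gt0//; [|lra|lra].
have h1 : 1 <= (b - a) * (4 * b ^+ 3).
  rewrite [leLHS](_ : _ = (b - a) * ((b + a) * (b ^+ 2 + a ^+ 2))); last by rewrite -[LHS]E; ring.
  have aa : a ^+ 2 <= b ^+ 2 by rewrite lerXn2r// nnegrE; lra.
  rewrite ler_wpM2l ?subr_ge0// [leRHS](_ : _ = (b + b) * (b ^+ 2 + b ^+ 2)); last by ring.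
  by rewrite ler_pM// ?lerD//; [lra|rewrite addr_ge0// sqr_ge0].
rewrite mulrC ler_pdivrMr; last by rewrite mulr_gt0 ?exprn_gt0//; lra.
rewrite [leRHS](_ : _ = (b ^+ 2) * ((b - a) * (4 * b ^+ 3))); last by ring.
rewrite -[leLHS]mulr1 ler_pM//; first by rewrite mulr_ge0//; lra.
by rewrite expr2 ler_wpM2r//; lra.
Qed.

Definition psum a n : R := \sum_(1 <= i < n.+1) a i.
(** Kept in the form to which an infinite sum from 1 unfolds, so that the series of the statement
    become instances by [big_oo_tot]. *)
Definition tot a : R := limn (fun n => \sum_(1 <= i < n) a i).

Lemma psumS a n : psum a n.+1 = psum a n + a n.+1.
Proof. by rewrite /psum big_nat_recr. Qed.

Lemma psum0 a : psum a 0 = 0.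
Proof. by rewrite /psum big_geq. Qed.

Definition zdom a (C : R) := forall n, (0 < n)%N -> `|a n| <= C * z n.

Lemma tot_lim (a : nat -> R) l K m :
  (forall n, (m <= n)%N -> `|psum a n - l| <= K / r4 n%:R) -> tot a = l.
Proof.
move=> h; apply/cvg_lim => //; apply/cvgrPdist_le => e e0.
have K0 : 0 < `|K| + 1 by rewrite ltr_wpDl.
have [m' m'0 hm] := r4_big (divr_gt0 e0 K0).
(* The sum under the limit stops before its index, so at index [k.+1] it is [psum a k]. *)
exists (m + m').+1 => // -[//|k] /= mk0; have mk : (m + m' <= k)%N by [].
have k1 : (m <= k)%N by apply: leq_trans mk; rewrite leq_addr.
have k2 : (m' <= k)%N by apply: leq_trans mk; rewrite leq_addl.
rewrite distrC; apply: le_trans (h k k1) _.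
apply: (@le_trans _ _ ((`|K| + 1) * (r4 k%:R)^-1)).
  by rewrite ler_wpM2r ?invr_ge0 ?r4_ge0// (le_trans (ler_norm K))// lerDl.
by rewrite mulrC -ler_pdivlMr//; exact: hm.
Qed.

Lemma tot_tail a C n : zdom a C -> (0 < n)%N -> `|psum a n - tot a| <= 4 * C / r4 n%:R.
Proof.
move=> aC n0.
have C0 : 0 <= C.
  have := aC 1%N isT; rewrite /z mul1r r41 invr1 mulr1; exact: le_trans.
have [| |l hl] := @seq_lim (psum a) (fun n => 4 * C / r4 n%:R).
- move=> k k0; rewrite psumS addrC addKr.
  apply: le_trans (aC _ _) _ => //.
  rewrite [leRHS](_ : _ = C * (4 / r4 k%:R - 4 / r4 k.+1%:R)); last by ring.
  by rewrite ler_wpM2l// z_telescope.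
- by move=> k k0; rewrite mulr_ge0 ?invr_ge0 ?r4_ge0// mulr_ge0.
- suff -> : tot a = l by exact: hl.
  exact: (tot_lim hl).
Qed.

(** The first term costs [C] and the others telescope to at most [4 * C]. *)
Lemma zdom_psum a C n : zdom a C -> psum (fun i => `|a i|) n <= 5 * C.
Proof.
move=> aC; have C0 : 0 <= C.
  have := aC 1%N isT; rewrite /z mul1r r41 invr1 mulr1; exact: le_trans.
case: n => [|n]; first by rewrite psum0 mulr_ge0.
suff : psum (fun i => `|a i|) n.+1 <= 5 * C - 4 * C / r4 n.+1%:R.
  by move=> /le_trans; apply; rewrite gerBl divr_ge0 ?r4_ge0// mulr_ge0.
elim: n => [|n IH].
  rewrite psumS psum0 add0r; have := aC 1%N isT; rewrite /z r41 mulr1 invr1 mulr1; lra.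
rewrite psumS; have := aC n.+2 isT.
have := ler_wpM2l C0 (@z_telescope n.+1 isT).
rewrite mulrBr !(mulrCA C) -![4 * C / _]mulrA.
have -> : 4 * (C / r4 n.+1%:R) = 4 * C / r4 n.+1%:R by ring.
have -> : 4 * (C / r4 n.+2%:R) = 4 * C / r4 n.+2%:R by ring.
lra.
Qed.

Lemma zdom_tot a C : zdom a C -> `|tot a| <= 5 * C.
Proof.
move=> aC; apply: (@le_r4 _ _ (4 * C) 1) => n n0.
have h1 := tot_tail aC n0; have h2 := zdom_psum n aC.
have h3 : `|psum a n| <= psum (fun i => `|a i|) n by exact: ler_norm_sum.
rewrite -[tot a](subKr (psum a n)); apply: le_trans (ler_normB _ _) _; lra.
Qed.

End Analysis.

(** * Harmonic sums and Stirling's formula *)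

Section Constants.
Variable R : realType.
Implicit Types (x y t : R) (n : nat).

Lemma ln_sub x y : 0 < x -> 0 < y -> ln x - ln y <= (x - y) / y.
Proof.
move=> x0 y0; rewrite -lnV ?posrE// -lnM ?posrE ?invr_gt0//.
have -> : x * y^-1 = 1 + (x - y) / y by field; rewrite gt_eqF.
apply: le_ln1Dx; have := divr_gt0 x0 y0.
have -> : (x - y) / y = x / y - 1 by field; rewrite gt_eqF.
lra.
Qed.

Lemma ln_r4 x : 0 < x -> ln x = 4 * ln (r4 x).
Proof.
move=> x0; rewrite -{1}(r4X (ltW x0)) lnXn ?r4_gt0//.
by rewrite mulr_natl.
Qed.

Lemma ln_le_r4 x : 0 < x -> ln x <= 4 * r4 x.
Proof.
move=> x0; rewrite ln_r4//; have := @ln_sub (r4 x) 1 (r4_gt0 x0) ltac:(lra).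
rewrite ln1 divr1; lra.
Qed.

Lemma r4V x : 0 < x -> r4 x^-1 = (r4 x)^-1.
Proof.
move=> x0; apply: (mulfI (lt0r_neq0 (r4_gt0 x0))).
by rewrite -r4M ?ltW// !divff ?gt_eqF ?r4_gt0// r41.
Qed.

Lemma r4_le n : (0 < n)%N -> r4 n%:R <= n%:R :> R.
Proof.
move=> n0; have := r4_ge1 R n0 => r1; rewrite -[leRHS]r4X// exprS.
by rewrite ler_peMr ?r4_ge0// exprn_ege1.
Qed.

Definition harm n : R := psum (fun i => i%:R^-1) n.

Lemma ln_succ_sub n : (0 < n)%N ->
  0 <= (n%:R^-1 + n.+1%:R^-1) / 2 - (ln (n.+1%:R : R) - ln n%:R) <= (6 * n%:R ^+ 3)^-1.
Proof.
move=> n0; have nr : 0 < n%:R :> R by rewrite ltr0n.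
have nr1 : 0 < n.+1%:R :> R by rewrite ltr0n.
have := @ln_pade R (n.+1%:R / n%:R); rewrite ler_pdivlMr// mul1r ler_nat leqnSn.
rewrite lnM ?posrE ?invr_gt0// lnV ?posrE// => /(_ isT).
have -> : n.+1%:R / n%:R - (n.+1%:R / n%:R)^-1 = n%:R^-1 + n.+1%:R^-1 :> R.
  rewrite -[n.+1%:R]natr1; field; rewrite gt_eqF//= gt_eqF//; lra.
have -> : (n.+1%:R / n%:R - 1) ^+ 3 / 6 = (6 * n%:R ^+ 3)^-1 :> R.
  rewrite -[n.+1%:R]natr1; field; rewrite gt_eqF//.
by [].
Qed.

(** The term 1/(2n) is kept because [H_approx] multiplies the error by about x^2 J, with J close to
    sqrt x: only O(J^(-2)) leaves O(x^(3/2)). *)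
Lemma harm_lim : exists g, forall n, (0 < n)%N ->
  `|harm n - ln n%:R - (2 * n%:R)^-1 - g| <= (3 * n%:R ^+ 2)^-1.
Proof.
apply: seq_lim => n n0; last by rewrite invr_ge0 mulr_ge0// sqr_ge0.
have nr : 1 <= n%:R :> R by rewrite ler1n.
have /andP[h1 h2] := ln_succ_sub n0.
have -> : harm n.+1 - ln n.+1%:R - (2 * n.+1%:R)^-1 - (harm n - ln n%:R - (2 * n%:R)^-1) =
   (n%:R^-1 + n.+1%:R^-1) / 2 - (ln n.+1%:R - ln n%:R).
  rewrite /harm psumS -[n.+1%:R]natr1; field; rewrite !gt_eqF//; lra.
rewrite ger0_norm//; apply: le_trans h2 _.
rewrite -subr_ge0 -[n.+1%:R]natr1.
have -> : (3 * n%:R ^+ 2)^-1 - (3 * (n%:R + 1) ^+ 2)^-1 - (6 * n%:R ^+ 3)^-1 =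
  (3 * n%:R ^+ 2 - 1) / (6 * n%:R ^+ 3 * (n%:R + 1) ^+ 2) :> R.
  field; rewrite !gt_eqF//; lra.
apply: divr_ge0; first by rewrite subr_ge0; have := exprn_ege1 2 nr; lra.
by rewrite !mulr_ge0// exprn_ge0//; lra.
Qed.

Definition gam : R := projT1 (cid harm_lim).
Lemma gamP n : (0 < n)%N -> `|harm n - ln n%:R - (2 * n%:R)^-1 - gam| <= (3 * n%:R ^+ 2)^-1.
Proof. exact: (projT2 (cid harm_lim)). Qed.

(** The limit is zeta(2). In [H_approx] the error meets x^3, about J^6, hence the expansion up to
    O(n^(-3)). The constant itself cancels in [sing_moment_approx]. *)
Lemma zeta2_lim : exists g : R, forall n, (0 < n)%N ->
  `|psum (fun i => (i%:R ^+ 2)^-1) n + n%:R^-1 - (2 * n%:R ^+ 2)^-1 - g| <= (6 * n%:R ^+ 3)^-1.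
Proof.
apply: seq_lim => n n0; last by rewrite invr_ge0 mulr_ge0// exprn_ge0.
have nr : 1 <= n%:R :> R by rewrite ler1n.
rewrite psumS; set p := psum _ _.
have -> : p + (n.+1%:R ^+ 2)^-1 + n.+1%:R^-1 - (2 * n.+1%:R ^+ 2)^-1 - (p + n%:R^-1 - (2 * n%:R ^+ 2)^-1) =
   (2 * n%:R ^+ 2 * n.+1%:R ^+ 2)^-1.
  rewrite -[n.+1%:R]natr1; field; rewrite !gt_eqF//; lra.
rewrite ger0_norm; last by rewrite invr_ge0 !mulr_ge0// sqr_ge0.
rewrite -subr_ge0 -[n.+1%:R]natr1.
have -> : (6 * n%:R ^+ 3)^-1 - (6 * (n%:R + 1) ^+ 3)^-1 - (2 * n%:R ^+ 2 * (n%:R + 1) ^+ 2)^-1 =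
  (6 * n%:R ^+ 3 * (n%:R + 1) ^+ 3)^-1 :> R.
  field; rewrite !gt_eqF//; lra.
by rewrite invr_ge0 !mulr_ge0// exprn_ge0//; lra.
Qed.

Definition zeta2 : R := projT1 (cid zeta2_lim).
Lemma zeta2P n : (0 < n)%N ->
  `|psum (fun i => (i%:R ^+ 2)^-1) n + n%:R^-1 - (2 * n%:R ^+ 2)^-1 - zeta2| <= (6 * n%:R ^+ 3)^-1.
Proof. exact: (projT2 (cid zeta2_lim)). Qed.

Definition stir n : R := ln (n`!)%:R - (n%:R + 2^-1) * ln n%:R + n%:R.

Lemma stir_lim : exists g, forall n, (0 < n)%N -> `|stir n - g| <= n%:R^-1.
Proof.
apply: seq_lim => n n0; last by rewrite invr_ge0.
have nr : 1 <= n%:R :> R by rewrite ler1n.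
have [e E /andP[h1 h2]] : exists2 e : R, ln n.+1%:R = ln n%:R + (n%:R^-1 + n.+1%:R^-1) / 2 - e &
    0 <= e <= (6 * n%:R ^+ 3)^-1.
  by eexists; last exact: (ln_succ_sub n0); ring.
have -> : stir n.+1 - stir n = (n%:R + 2^-1) * e - (4 * n%:R * n.+1%:R)^-1.
  rewrite /stir factS natrM lnM ?posrE ?ltr0n ?fact_gt0// E -[n.+1%:R]natr1.
  by field; rewrite !gt_eqF//; lra.
have -> : n%:R^-1 - n.+1%:R^-1 = (n%:R * n.+1%:R)^-1 :> R.
  by rewrite -[n.+1%:R]natr1; field; rewrite !gt_eqF//; lra.
have h3 : (n%:R + 2^-1) * e <= (n%:R * n.+1%:R)^-1.
  apply: le_trans (ler_wpM2l _ h2) _; first lra.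
  rewrite -subr_ge0 -[n.+1%:R]natr1.
  have -> : (n%:R * (n%:R + 1))^-1 - (n%:R + 2^-1) / (6 * n%:R ^+ 3) =
     (10 * n%:R ^+ 2 - 3 * n%:R - 1) / (12 * n%:R ^+ 3 * (n%:R + 1)) :> R.
    by field; rewrite !gt_eqF//; lra.
  apply: divr_ge0; first by nra.
  by rewrite !mulr_ge0// ?exprn_ge0//; lra.
have h4 : 0 <= (n%:R + 2^-1) * e by apply: mulr_ge0 => //; lra.
have h5 : (4 * n%:R * n.+1%:R)^-1 = 4^-1 * (n%:R * n.+1%:R)^-1 :> R.
  by rewrite -[n.+1%:R]natr1; field; rewrite !gt_eqF//; lra.
have h6 : 0 <= (n%:R * n.+1%:R)^-1 :> R by rewrite invr_ge0 mulr_ge0.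
rewrite h5; move: ((n%:R + 2^-1) * e) ((n%:R * n.+1%:R)^-1) h3 h4 h6 => A B h3 h4 h6.
by rewrite ler_norml; apply/andP; split; lra.
Qed.

(** The antiderivative of cos^n vanishing at 0, given by the reduction formula. Hence [wallis n]
    below is the integral of cos^n over [0, pi/2]. *)
Fixpoint cosA n x : R := match n with
  | 0 => x
  | k.+1 => match k with
    | 0 => sin x
    | m.+1 => cos x ^+ k * sin x / n%:R + k%:R / n%:R * cosA m x
    end
  end.

Lemma cosA_derive n x : is_derive x 1 (cosA n) (cos x ^+ n).
Proof.
elim/ltn_ind: n => -[|[|n]] IH /=.
- by rewrite expr0; exact: deriveI1.
- by rewrite expr1; exact: is_derive_sin.
have Hc := is_derive_cos x; have Hs := is_derive_sin x.
apply: (deriveD1 (deriveM1 (deriveM1 (deriveX1 (n := n.+1) Hc erefl) Hs erefl) (deriveC1 _ x) erefl)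
  (deriveM1 (deriveC1 _ x) (IH n _) erefl)); first by rewrite ltnS leqnSn.
have n2 : n%:R + 1 + 1 != 0 :> R by rewrite !natr1.
have s2 : sin x ^+ 2 = 1 - cos x ^+ 2 by rewrite sin2cos2.
rewrite /= -[n.+2%:R]natr1 -[n.+1%:R]natr1.
transitivity (((n%:R + 1) * cos x ^+ n * (1 - sin x ^+ 2) + cos x ^+ n * cos x ^+ 2) / (n%:R + 1 + 1)).
  by rewrite s2 !exprS; field.
by rewrite !exprS; field.
Qed.

Definition wallis n : R := cosA n (pi / 2).

Lemma wallis0 : wallis 0 = pi / 2. Proof. by []. Qed.
Lemma wallis1 : wallis 1 = 1. Proof. by rewrite /wallis /= sin_pihalf. Qed.
Lemma wallisSS n : wallis n.+2 = n.+1%:R / n.+2%:R * wallis n.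
Proof. by rewrite /wallis /= cos_pihalf expr0n /= !mul0r add0r. Qed.

Lemma cosA0 n : cosA n 0 = 0.
Proof.
elim/ltn_ind: n => -[|[|n]] IH //=; first by rewrite sin0.
by rewrite sin0 mulr0 mul0r add0r IH ?mulr0// ltnS leqnSn.
Qed.

Lemma wallis_decr n : wallis n.+1 <= wallis n.
Proof.
have p0 := pi_gt0 R.
have D t := deriveD1 (cosA_derive n t) (deriveN1 (cosA_derive n.+1 t) erefl) erefl.
have := @le_of_derive R _ _ 0 (pi / 2) ltac:(lra) (fun t _ => D t).
rewrite !cosA0 subrr subr_ge0; apply => t /andP[t0 t1].
have c0 : 0 <= cos t by apply: cos_ge0_pihalf; apply/andP; split; lra.
by rewrite exprS subr_ge0 ler_piMl ?exprn_ge0// cos_le1.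
Qed.

Lemma wallis_gt0 n : 0 < wallis n.
Proof.
elim/ltn_ind: n => -[|[|n]] IH.
- by rewrite wallis0 divr_gt0// pi_gt0.
- by rewrite wallis1.
- by rewrite wallisSS mulr_gt0// IH// ltnS leqnSn.
Qed.

Lemma wallis_prod n : n.+1%:R * (wallis n * wallis n.+1) = pi / 2.
Proof.
elim: n => [|n IH]; first by rewrite mul1r wallis0 wallis1 mulr1.
by rewrite -IH wallisSS; field.
Qed.

Lemma wallis_even n : wallis n.*2 = pi / 2 * ((n.*2)`!%:R / (4 ^+ n * n`!%:R ^+ 2)).
Proof.
elim: n => [|n IH]; first by rewrite /= wallis0 expr0 expr1n mulr1 divr1 mulr1.
have f0 : (n`!)%:R != 0 :> R by rewrite pnatr_eq0 -lt0n fact_gt0.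
rewrite doubleS wallisSS IH !factS !natrM [4 ^+ n.+1]exprS.
have -> : n.*2.+2%:R = 2 * n.+1%:R :> R by rewrite -natrM mul2n doubleS.
have n1 : n.+1%:R != 0 :> R by [].
have p0 : (4 : R) ^+ n != 0 by rewrite expf_neq0.
move: (n.+1%:R : R) (n.*2.+1%:R : R) ((n.*2)`!%:R : R) (n`!%:R : R) ((4 : R) ^+ n) n1 f0 p0 => A B C D E A0 D0 E0.
by field; rewrite A0 D0 E0.
Qed.

(* The constant comes from Wallis' product. *)
Lemma stirlingP n : (0 < n)%N ->
  `|ln (n`!%:R : R) - (n%:R + 2^-1) * ln n%:R + n%:R - ln (2 * pi) / 2| <= n%:R^-1.
Proof.
have [d hd] := stir_lim; suff -> : ln (2 * pi) / 2 = d by exact: hd.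
have p0 := pi_gt0 R.
(* By [wallis_prod] and monotonicity, the square of [wallis m.*2] lies between (pi/2)/(2m + 1) and
   (pi/2)/(2m). By [wallis_even] it is a quotient of factorials, which [stir] evaluates at [m] and
   [m.*2]; comparing the two isolates [d]. *)
have key m : (0 < m)%N -> `|ln (2 * pi) - 2 * d| <= 6 / m%:R.
  move=> m0; have mr : 1 <= m%:R :> R by rewrite ler1n.
  have mr0 : 0 < m%:R :> R by rewrite ltr0n.
  have W0 := wallis_gt0 m.*2.
  have E : ln (wallis m.*2) = ln (pi / 2) + ln (m.*2)`!%:R - m%:R * ln 4 - 2 * ln m`!%:R.
    have f0 k : 0 < (k`!)%:R :> R by rewrite ltr0n fact_gt0.
    have : 0 < pi / 2 :> R by lra.
    rewrite wallis_even; move: (pi / 2) => P P0.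
    rewrite lnM ?posrE ?divr_gt0 ?mulr_gt0 ?exprn_gt0//.
    rewrite lnM ?posrE ?invr_gt0 ?mulr_gt0 ?exprn_gt0//.
    rewrite lnV ?posrE ?mulr_gt0 ?exprn_gt0//.
    by rewrite lnM ?posrE ?exprn_gt0// !lnXn// -[ln 4 *+ m]mulr_natl -[ln _ *+ 2]mulr_natl; ring.
  have m2 : m.*2%:R = 2 * m%:R :> R by rewrite -natrM mul2n.
  have l4 : ln 4 = 2 * ln 2 :> R.
    have -> : 4 = 2 ^+ 2 :> R by ring.
    by rewrite lnXn// mulr_natl.
  have lp : ln (2 * pi) = ln (pi / 2) + 2 * ln 2 :> R.
    rewrite -l4 -lnM ?posrE//; last lra.
    by congr ln; field.
  have := hd m m0; have := hd m.*2; rewrite double_gt0 => /(_ m0).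
  rewrite /stir m2 lnM ?posrE// => h2 h1.
  have U : 2 * ln (wallis m.*2) <= ln (pi / 2) - ln (2 * m%:R).
    have W1 := wallis_gt0 m.*2.-1; have k0 : (m.*2.-1.+1 = m.*2)%N by rewrite prednK// double_gt0.
    have := wallis_prod m.*2.-1; rewrite k0 m2 => P.
    have : wallis m.*2 ^+ 2 <= (pi / 2) / (2 * m%:R).
      rewrite ler_pdivlMr; last lra.
      rewrite -P [leLHS]mulrC; apply: ler_wpM2l; first lra.
      by have wd := wallis_decr m.*2.-1; rewrite k0 in wd; rewrite expr2; apply: ler_wpM2r => //; exact: ltW.
    rewrite -ler_ln ?posrE ?exprn_gt0 ?divr_gt0//; try lra.
    by rewrite lnXn// ln_div ?posrE ?divr_gt0//; try lra; rewrite -[ln _ *+ 2]mulr_natl.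
  have L : ln (pi / 2) - ln (2 * m%:R + 1) <= 2 * ln (wallis m.*2).
    have := wallis_prod m.*2; rewrite -natr1 m2 => P.
    have W1 := wallis_gt0 m.*2.+1.
    have : (pi / 2) / (2 * m%:R + 1) <= wallis m.*2 ^+ 2.
      rewrite ler_pdivrMr; last lra.
      rewrite -P [leRHS]mulrC; apply: ler_wpM2l; first lra.
      by rewrite expr2; apply: ler_wpM2l; [exact: ltW|exact: wallis_decr].
    rewrite -ler_ln ?posrE ?exprn_gt0 ?divr_gt0//; try lra.
    by rewrite lnXn// ln_div ?posrE ?divr_gt0//; try lra; rewrite -[ln _ *+ 2]mulr_natl.
  have Q := @ln_sub (2 * m%:R + 1) (2 * m%:R) ltac:(lra) ltac:(lra).
  have Q' : (2 * m%:R + 1 - 2 * m%:R) / (2 * m%:R) = m%:R^-1 / 2 :> R by field; rewrite gt_eqF.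
  have l2 : ln (2 * m%:R) = ln 2 + ln m%:R :> R by rewrite lnM ?posrE.
  have V : (2 * m%:R)^-1 = m%:R^-1 / 2 :> R by field; rewrite gt_eqF.
  have v0 : 0 <= m%:R^-1 :> R by rewrite invr_ge0.
  rewrite Q' in Q; rewrite V in h2; rewrite E l4 in U L; rewrite l2 in Q U; rewrite lp.
  move: h1 h2; rewrite !ler_norml => /andP[h1 h1'] /andP[h2 h2'].
  by apply/andP; split; lra.
have X0 : `|ln (2 * pi) - 2 * d| <= 0.
  apply: (@le_r4 _ _ _ 6 1) => m m0; rewrite add0r; apply: le_trans (key m m0) _.
  by rewrite ler_wpM2l// lef_pV2 ?posrE ?r4_le ?r4_gt0 ?ltr0n.
by move: X0; rewrite normr_le0 subr_eq0 => /eqP ->; field.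
Qed.

(** Two majorants serve two ranges of [sum_min_bound]. The bound [C / x] is used for large
    arguments. Below 1 the harmonic sum is empty and - ln x - gamma remains, for which the weaker
    singularity x^(-1/4) is the useful bound. *)
Lemma harm_err : exists C : R, forall x, 0 < x ->
  `|harm (Num.truncn x) - ln x - gam| <= C / x /\
  `|harm (Num.truncn x) - ln x - gam| <= C / r4 x.
Proof.
exists (4 + `|gam|) => x x0.
have g0 := normr_ge0 gam.
have [x1|x1] := leP 1 x; last first.
  have -> : Num.truncn x = 0%N by apply/truncn0Pn; rewrite -ltNge.
  rewrite /harm psum0 sub0r.
  have r1 : r4 x <= 1 by rewrite -r41 ler_r4// ltW.
  have r0 := r4_gt0 x0.
  have B : `|- ln x - gam| <= (4 + `|gam|) / r4 x.
    apply: le_trans (ler_normB _ _) _; rewrite mulrDl; apply: lerD.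
      rewrite normrN ler0_norm; last by rewrite ln_le0// ltW.
      rewrite -lnV ?posrE//; have := @ln_le_r4 x^-1; rewrite invr_gt0 => /(_ x0).
      by rewrite r4V.
    by rewrite ler_peMr// invf_ge1.
  split=> //; apply: le_trans B _; apply: ler_wpM2l; first lra.
  rewrite lef_pV2 ?posrE// -{1}(r4X (ltW x0)).
  by rewrite exprS ler_piMr ?r4_ge0// exprn_ile1// r4_ge0.
set n := Num.truncn x.
have /andP[nx xn] := truncn_itv (ltW x0); rewrite -/n -[n.+1%:R]natr1 in nx xn.
have n0 : (0 < n)%N by rewrite truncn_gt0.
have nr : 1 <= n%:R :> R by rewrite ler1n.
have A : `|harm n - ln x - gam| <= (4 + `|gam|) / x.
  have h := gamP n0.
  have h1 : (2 * n%:R)^-1 + (3 * n%:R ^+ 2)^-1 <= n%:R^-1 :> R.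
    rewrite -subr_ge0; have -> : n%:R^-1 - ((2 * n%:R)^-1 + (3 * n%:R ^+ 2)^-1) =
      (3 * n%:R - 2) / (6 * n%:R ^+ 2) :> R by field; rewrite gt_eqF//; lra.
    by rewrite divr_ge0 ?mulr_ge0 ?sqr_ge0//; lra.
  have h2 : 0 <= ln x - ln n%:R by rewrite subr_ge0 ler_ln ?posrE//; lra.
  have h3 : ln x - ln n%:R <= n%:R^-1.
    have n0' : 0 < n%:R :> R by lra.
    apply: le_trans (ln_sub x0 n0') _.
    by rewrite ler_pdivrMr// mulVf ?gt_eqF//; lra.
  have h4 : n%:R^-1 <= 2 / x.
    have n0' : 0 < n%:R :> R by lra.
    have hx : x <= 2 * n%:R by lra.
    by rewrite ler_pdivlMr// mulrC ler_pdivrMr.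
  have h5 : 0 <= (2 * n%:R)^-1 :> R by rewrite invr_ge0 mulr_ge0.
  have h6 : 0 <= (3 * n%:R ^+ 2)^-1 :> R by rewrite invr_ge0 mulr_ge0// sqr_ge0.
  have h7 : 0 <= `|gam| / x by rewrite divr_ge0// ltW.
  have -> : (4 + `|gam|) / x = 2 * (2 / x) + `|gam| / x by ring.
  move: (2 / x) (`|gam| / x) ((2 * n%:R)^-1) ((3 * n%:R ^+ 2)^-1) h h1 h4 h5 h6 h7 => A B D E h h1 h4 h5 h6 h7.
  by move: h; rewrite !ler_norml => /andP[h' h'']; apply/andP; split; lra.
split=> //; apply: le_trans A _; apply: ler_wpM2l; first lra.
rewrite lef_pV2 ?posrE ?r4_gt0// -{2}(r4X (ltW x0)).
have : 1 <= r4 x by rewrite -r41 ler_r4.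
by move=> r1; rewrite exprS ler_peMr ?r4_ge0// exprn_ege1.
Qed.

End Constants.

(** * The quadratic weight *)

Section Weight.
Variable R : realType.
Implicit Types (x y u v t c : R) (n m : nat) (a b : nat -> R).

Lemma eq_psum a b n : (forall i, (0 < i <= n)%N -> a i = b i) -> psum a n = psum b n.
Proof. by move=> h; apply: eq_big_nat => i; rewrite ltnS; exact: h. Qed.

Lemma psumD a b n : psum (fun i => a i + b i) n = psum a n + psum b n.
Proof. exact: big_split. Qed.

Lemma psumN a n : psum (fun i => - a i) n = - psum a n.
Proof. exact: sumrN. Qed.

Lemma psumB a b n : psum (fun i => a i - b i) n = psum a n - psum b n.
Proof. by rewrite psumD psumN. Qed.

Lemma psumZ c a n : psum (fun i => c * a i) n = c * psum a n.
Proof. by rewrite /psum mulr_sumr. Qed.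

Lemma psumZr c a n : psum (fun i => a i * c) n = psum a n * c.
Proof. by rewrite /psum mulr_suml. Qed.

Lemma ler_psum a b n : (forall i, (0 < i <= n)%N -> a i <= b i) -> psum a n <= psum b n.
Proof. by move=> h; apply: ler_sum_nat => i; rewrite ltnS; exact: h. Qed.

Lemma psum_ge0 a n : (forall i, (0 < i <= n)%N -> 0 <= a i) -> 0 <= psum a n.
Proof. by move=> h; apply: le_trans (ler_psum h); rewrite /psum big1. Qed.

Lemma ler_norm_psum a n : `|psum a n| <= psum (fun i => `|a i|) n.
Proof. exact: ler_norm_sum. Qed.

Lemma psum_widen a n m : (n <= m)%N ->
  psum a n = psum (fun i => if (i <= n)%N then a i else 0) m.
Proof. by move=> nm; rewrite /psum (big_nat_widen _ _ m.+1)// big_mkcond. Qed.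

Lemma exchange_psum (h : nat -> nat -> R) n m :
  psum (fun i => psum (h i) m) n = psum (fun j => psum (h^~ j) n) m.
Proof. exact: exchange_big. Qed.

Lemma psum_delta1 n : (0 < n)%N -> psum (fun i => (i == 1%N)%:R : R) n = 1.
Proof.
case: n => // n _; rewrite /psum big_nat_recl//= big1_seq ?addr0//.
by move=> i; rewrite mem_index_iota => /andP[_ /andP[i1 _]]; case: i i1.
Qed.

Lemma psum_const c n : psum (fun=> c) n = n%:R * c.
Proof.
elim: n => [|n IH]; first by rewrite psum0 mul0r.
by rewrite psumS IH -natr1; ring.
Qed.

Lemma psum_id n : psum (fun i => i%:R : R) n = n%:R * (n%:R + 1) / 2.
Proof.
elim: n => [|n IH]; first by rewrite psum0 !mul0r.
by rewrite psumS IH -[n.+1%:R]natr1; field.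
Qed.

Lemma psum_sq n : psum (fun i => i%:R ^+ 2 : R) n = n%:R * (n%:R + 1) * (2 * n%:R + 1) / 6.
Proof.
elim: n => [|n IH]; first by rewrite psum0 !mul0r.
by rewrite psumS IH -[n.+1%:R]natr1; field.
Qed.

Lemma psum_rsqrt n : psum (fun i => (Num.sqrt i%:R)^-1 : R) n <= 2 * Num.sqrt n%:R.
Proof.
elim: n => [|n IH]; first by rewrite psum0 sqrtr0 mulr0.
rewrite psumS; set a := Num.sqrt n%:R in IH; set b := Num.sqrt n.+1%:R.
have b0 : 0 < b by rewrite sqrtr_gt0 ltr0n.
have a0 : 0 <= a by exact: sqrtr_ge0.
have ab : a <= b by rewrite ler_wsqrtr// ler_nat.
have E : b ^+ 2 - a ^+ 2 = 1 by rewrite !sqr_sqrtr ?ler0n// -natr1; ring.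
have : b^-1 <= 2 * (b - a).
  rewrite -[leLHS]mul1r ler_pdivrMr// -[leLHS]E.
  have -> : b ^+ 2 - a ^+ 2 = (b - a) * (b + a) by ring.
  rewrite [leRHS](_ : _ = (b - a) * (b + b)); last by ring.
  by apply: ler_wpM2l; lra.
lra.
Qed.

Definition F u : R := psum (fun j => (u - j%:R) ^+ 2) (Num.truncn u).
(** The remainder of [F] after its first two Euler-Maclaurin terms. *)
Definition E u : R := F u - u ^+ 3 / 3 + u ^+ 2 / 2.

Lemma psum_sqB u n : psum (fun j => (u - j%:R) ^+ 2) n =
  n%:R * u ^+ 2 - u * (n%:R * (n%:R + 1)) + n%:R * (n%:R + 1) * (2 * n%:R + 1) / 6.
Proof.
elim: n => [|n IH]; first by rewrite psum0; ring.
by rewrite psumS IH -[n.+1%:R]natr1; field.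
Qed.

(** The cubic in the fractional part [t] is the Bernoulli polynomial B_3, which vanishes at both 0
    and 1: [E] has no jumps at the integers. *)
Lemma E_expl u n t : u = n%:R + t -> 0 <= t < 1 ->
  E u = u / 6 - t * (t - 1) * (t - 2^-1) / 3.
Proof.
move=> uE /andP[t0 t1]; rewrite /E /F.
have -> : Num.truncn u = n by apply: truncn_def; rewrite uE -natr1; apply/andP; split; lra.
by rewrite psum_sqB uE; field.
Qed.

Lemma floor_dec u : 0 <= u -> exists n t, [/\ u = n%:R + t, 0 <= t < 1 & n = Num.truncn u].
Proof.
move=> u0; exists (Num.truncn u), (u - (Num.truncn u)%:R); split=> //; first ring.
by have := truncn_itv u0; rewrite -natr1 => /andP[h1 h2]; apply/andP; split; lra.
Qed.

Lemma bern_bound t : 0 <= t <= 1 ->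
  `|t * (t - 1) * (t - 2^-1)| <= t / 2 /\ `|t * (t - 1) * (t - 2^-1)| <= (1 - t) / 2.
Proof.
move=> /andP[t0 t1]; rewrite !normrM (ger0_norm t0) (@ler0_norm _ (t - 1)); last lra.
have h : `|t - 2^-1| <= 2^-1 by rewrite ler_norml; apply/andP; split; lra.
have h0 := normr_ge0 (t - 2^-1).
have t2 : 0 <= t * - (t - 1) by apply: mulr_ge0 => //; lra.
have h3 := ler_wpM2l t2 h.
by split; nra.
Qed.

Lemma E_abs u : 0 <= u -> `|E u| <= u / 3.
Proof.
move=> u0; have [n [t [uE t01 _]]] := floor_dec u0; rewrite (E_expl uE t01).
have /andP[t0 t1] := t01; have [h _] := @bern_bound t ltac:(apply/andP; split; lra).
have n0 : 0 <= n%:R :> R by [].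
move: h; move: (_ * (_ - _)) => B; rewrite !ler_norml => /andP[h1 h2]; apply/andP; split; lra.
Qed.

(** A Lipschitz remainder is what partial summation against [F] requires, see [rho_lip] in
    [weighted_by_parts]. *)
Lemma E_lip u v : 0 <= u -> u <= v -> `|E v - E u| <= v - u.
Proof.
move=> u0 uv; have v0 := le_trans u0 uv.
have [n [t [uE t01 nE]]] := floor_dec u0; have [m [s [vE s01 mE]]] := floor_dec v0.
rewrite (E_expl uE t01) (E_expl vE s01).
have nm : (n <= m)%N by rewrite nE mE le_truncn.
have /andP[t0 t1] := t01; have /andP[s0 s1] := s01.
have [h1 h2] := @bern_bound t ltac:(apply/andP; split; lra).
have [h3 h4] := @bern_bound s ltac:(apply/andP; split; lra).
have [ltnm|] := ltnP n m; last first.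
  move=> mn; have nmE : n = m by apply/eqP; rewrite eqn_leq nm mn.
  have ts : t <= s by move: uv; rewrite uE vE nmE; lra.
  have -> : v / 6 - s * (s - 1) * (s - 2^-1) / 3 - (u / 6 - t * (t - 1) * (t - 2^-1) / 3) =
    (s - t) * (6^-1 - (s ^+ 2 + s * t + t ^+ 2 - 3 / 2 * (s + t) + 2^-1) / 3).
    by rewrite uE vE nmE; field.
  have -> : v - u = s - t by rewrite uE vE nmE; ring.
  rewrite normrM ger0_norm; last lra.
  rewrite -[leRHS]mulr1; apply: ler_wpM2l; first lra.
  rewrite ler_norml; apply/andP; split; nra.
(* With an integer between [u] and [v], the two values of B_3 are compared with its zeros there:
   they are at most half of [1 - t] and half of [s], and [(1 - t) + s <= v - u]. *)
have h : n%:R + 1 <= m%:R :> R by rewrite natr1 ler_nat.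
move: h2 h3; move: (t * (t - 1) * _) (s * (s - 1) * _) => A B.
by rewrite !ler_norml => /andP[? ?] /andP[? ?]; apply/andP; split; lra.
Qed.

Lemma F_approx u : 0 <= u -> `|F u - u ^+ 3 / 3 + u ^+ 2 / 2| <= u / 3.
Proof. exact: E_abs. Qed.

(* The model for the moment of the singular series: in [sing_moment_F] the
   coefficients [sing_coef d m] are replaced by [1 / m]. *)
Definition H x : R := psum (fun m => m%:R * F (x / m%:R)) (Num.truncn x).

Lemma truncn_div x m : 0 <= x -> (0 < m)%N -> Num.truncn (x / m%:R) = (Num.truncn x %/ m)%N.
Proof.
move=> x0 m0; have mr : 0 < m%:R :> R by rewrite ltr0n.
apply: truncn_def; rewrite ler_pdivlMr// ltr_pdivrMr// -!natrM.
rewrite -truncn_ge_nat// leq_divM//=.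
by rewrite -truncn_lt_nat// ltn_ceil.
Qed.

(** Pairs with both entries at most [J] are counted twice by the two legs; pairs with both entries
    above [J] have product above [X]. *)
Lemma hyperbola (h : nat -> nat -> R) X J : (J * J <= X)%N -> (X < J.+1 * J.+1)%N ->
  psum (fun m => psum (h m) (X %/ m)) X =
  psum (fun m => psum (h m) (X %/ m)) J + psum (fun j => psum (h^~ j) (X %/ j)) J
  - psum (fun m => psum (h m) J) J.
Proof.
move=> JX XJ.
have JX' : (J <= X)%N by case: (J) JX => // k; apply: leq_trans; rewrite leq_pmulr.
have sing_moment (g : nat -> nat -> R) m : (0 < m)%N -> psum (g m) (X %/ m) =
    psum (fun j => if (m * j <= X)%N then g m j else 0) X.
  move=> m0; rewrite (@psum_widen _ _ X) ?leq_div//; apply: eq_psum => j _.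
  by rewrite leq_divRL// mulnC.
have W1 (g : nat -> nat -> R) n : (n <= X)%N -> psum (fun m => psum (g m) (X %/ m)) n =
    psum (fun m => psum (fun j => if (m <= n)%N && (m * j <= X)%N then g m j else 0) X) X.
  move=> nX; rewrite (psum_widen _ nX); apply: eq_psum => m /andP[m0 mX].
  case: ifP => mn /=; first by rewrite sing_moment.
  by rewrite /psum big1.
have X2 : psum (fun j => psum (h^~ j) (X %/ j)) J =
    psum (fun m => psum (fun j => if (j <= J)%N && (j * m <= X)%N then h m j else 0) X) X.
  by rewrite (W1 (fun j m => h m j) J)// exchange_psum.
rewrite (W1 _ X)// (W1 h J)// X2.
rewrite [psum _ J](psum_widen _ JX').
rewrite -psumD -psumB; apply: eq_psum => m /andP[m0 mX].
have -> : (if (m <= J)%N then psum (h m) J else 0) =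
   psum (fun j => if (m <= J)%N && (j <= J)%N then h m j else 0) X.
  by case: ifP => mJ /=; [exact: psum_widen|rewrite /psum big1].
rewrite -psumD -psumB; apply: eq_psum => j /andP[j0 jX].
rewrite mX [(j * m)%N]mulnC /=.
case: (leqP m J) => mJ; case: (leqP j J) => jJ /=.
- have -> : (m * j <= X)%N by apply: leq_trans JX; exact: leq_mul.
  by ring.
- by rewrite addr0 subr0.
- by rewrite add0r subr0.
- have -> : (m * j <= X)%N = false.
    by apply/negbTE; rewrite -ltnNge; apply: leq_trans XJ _; exact: leq_mul.
  by ring.
Qed.

End Weight.

(** * Quadratically weighted harmonic sums *)

Section WeightedHarmonic.
Variable R : realType.
Implicit Types (x y u v t c : R) (n m : nat) (a b : nat -> R).

(** The inner sum on the second leg of the hyperbola method in [H_approx]: j^2 [Kf](x/j) is the sum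
    of (x - m j)^2 / m over m <= x/j. *)
Definition Kf u : R := psum (fun m => (u - m%:R) ^+ 2 / m%:R) (Num.truncn u).

Lemma Kf_expl u : Kf u = u ^+ 2 * harm R (Num.truncn u) - 2 * u * (Num.truncn u)%:R
  + (Num.truncn u)%:R * ((Num.truncn u)%:R + 1) / 2.
Proof.
rewrite /Kf /harm; elim: (Num.truncn u) => [|n IH]; first by rewrite !psum0; ring.
by rewrite !psumS IH -[n.+1%:R]natr1; field; rewrite gt_eqF// ltr_wpDl.
Qed.

(** A bounded error is aimed at: weighted by j^2 and summed over j <= J it leaves O(J^3), which is
    O(x^(3/2)). *)
Lemma Kf_approx u : 1 <= u ->
  `|Kf u - (u ^+ 2 * (ln u + gam R - 3 / 2) + u)| <= 10.
Proof.
move=> u1; have u0 : 0 <= u by lra.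
have [n [t [uE /andP[t0 t1] nE]]] := floor_dec u0.
have n0 : (0 < n)%N by rewrite nE truncn_gt0.
rewrite Kf_expl -nE.
have nr : 1 <= n%:R :> R by rewrite ler1n.
have h := gamP R n0; set e1 := (X in `|X|) in h.
have a1 := @ln_sub R u n%:R ltac:(lra) ltac:(lra).
have a2 := @ln_sub R n%:R u ltac:(lra) ltac:(lra).
(* The first-order term [t / n%:R] of ln(u/n) is split off; [ln_sub] applied in both directions
   shows that the rest [e2] is O(n^(-2)). *)
have [e2 E2] : exists e2, ln u = ln n%:R + t / n%:R + e2.
  by exists (ln u - ln n%:R - t / n%:R); ring.
have hE : harm R n = ln n%:R + (2 * n%:R)^-1 + gam R + e1 by rewrite /e1; ring.
have n2 : 1 <= n%:R ^+ 2 :> R by rewrite exprn_ege1.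
have b2 : - 1 <= e2 * n%:R ^+ 2 <= 0.
  have E : (n%:R - u) / u = t ^+ 2 / (n%:R * u) - t / n%:R.
    by rewrite uE; field; rewrite !gt_eqF//; lra.
  have E' : (u - n%:R) / n%:R = t / n%:R by rewrite uE; field; rewrite !gt_eqF//; lra.
  rewrite E in a2; rewrite E' in a1.
  have e2u : e2 <= 0 by lra.
  have e2l : - (t ^+ 2 / (n%:R * u)) <= e2 by lra.
  apply/andP; split; last by apply: mulr_le0_ge0 => //; lra.
  have : - (t ^+ 2 / (n%:R * u)) * n%:R ^+ 2 <= e2 * n%:R ^+ 2 by apply: ler_wpM2r => //; lra.
  apply: le_trans; rewrite mulNr lerN2 mulrAC ler_pdivrMr ?mul1r; last by nra.
  have t2 : t ^+ 2 <= 1 by nra.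
  have nu : n%:R ^+ 2 <= n%:R * u by rewrite expr2 ler_wpM2l//; lra.
  apply: le_trans nu; rewrite -[leRHS]mul1r; apply: ler_wpM2r => //; lra.
have b1 : `|e1 * n%:R ^+ 2| <= 3^-1.
  rewrite normrM (ger0_norm (_ : 0 <= n%:R ^+ 2))//; apply: le_trans (ler_wpM2r _ h) _ => //.
  by apply: eq_ler; field; rewrite gt_eqF//; lra.
have -> : u ^+ 2 * harm R n - 2 * u * n%:R + n%:R * (n%:R + 1) / 2 - (u ^+ 2 * (ln u + gam R - 3 / 2) + u)
  = (1 + t / n%:R) ^+ 2 * (e1 * n%:R ^+ 2 - e2 * n%:R ^+ 2) +
   ((2^-1 - t) * (2 * t + t * (t / n%:R)) + 3 / 2 * t ^+ 2 - t).
  by rewrite hE E2 uE; field; rewrite gt_eqF//; lra.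
have q0 : 0 <= t / n%:R by rewrite divr_ge0//; lra.
have q1 : t / n%:R <= 1 by rewrite ler_pdivrMr; lra.
move: (t / n%:R) q0 q1 => q q0 q1.
have p4 : 0 <= (1 + q) ^+ 2 <= 4 by apply/andP; split; nra.
move: (e1 * _) (e2 * _) b1 b2 => A B; rewrite ler_norml => /andP[A1 A2] /andP[B1 B2].
have h1 : `|(1 + q) ^+ 2 * (A - B)| <= 4 * (4 / 3).
  rewrite normrM; apply: ler_pM => //.
    by rewrite ger0_norm; case/andP: p4.
  by rewrite ler_norml; apply/andP; split; lra.
have h2 : `|(2^-1 - t) * (2 * t + t * q)| <= 3 / 2.
  rewrite normrM [leRHS](_ : _ = 2^-1 * 3); last by field.
  by apply: ler_pM => //; rewrite ler_norml; apply/andP; split; nra.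
have h3 : `|3 / 2 * t ^+ 2 - t| <= 3 / 2 by rewrite ler_norml; apply/andP; split; nra.
apply: le_trans (ler_normD _ _) _.
have := ler_normD ((2^-1 - t) * (2 * t + t * q)) (3 / 2 * t ^+ 2 - t); rewrite addrA => ?; lra.
Qed.

Lemma psum_ln n : psum (fun i => ln (i%:R : R)) n = ln n`!%:R.
Proof.
elim: n => [|n IH]; first by rewrite psum0 ln1.
by rewrite psumS IH factS natrM lnM ?posrE ?ltr0n ?fact_gt0// addrC.
Qed.

(** This is what the hyperbola method leaves once the constants of the harmonic, zeta(2) and
    factorial sums are set apart. With [s = t * J] all terms of order J^5 and J^4 cancel
    identically. *)
Lemma H_poly (J s x : R) : 1 <= J -> 0 <= s <= 3 * J -> x = J ^+ 2 + s ->
  `|x ^+ 3 / 3 * (- J^-1 + (2 * J ^+ 2)^-1) - x ^+ 2 / (4 * J) + x ^+ 2 * (J + 2^-1) * (s / J ^+ 2)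
   - x ^+ 2 * J / 2 + x * J * (J + 1) / 2 - x ^+ 2 / 2 + x * J ^+ 2 * (J + 1)
   - J ^+ 2 * (J + 1) ^+ 2 * (2 * J + 1) / 12 - 3 / 4 * x ^+ 2| <= 60 * J ^+ 3.
Proof.
move=> J1 /andP[s0 s3] xE; have J0 : J != 0 by rewrite gt_eqF//; lra.
have [t tE] : exists t, s = t * J by exists (s / J); field.
have t0 : 0 <= t by move: s0; rewrite tE pmulr_lge0//; lra.
have inv_phi3 : t <= 3 by move: s3; rewrite tE ler_pM2r//; lra.
rewrite [X in `|X|](_ : _ = J ^+ 3 * (t ^+ 2 / 2 - 12^-1) + J ^+ 2 * (2 / 3 * t ^+ 3 + t ^+ 2 / 4 - 12^-1)
   + J * (2 / 3 * t ^+ 3 - t ^+ 2 / 4)); last by rewrite xE tE; field.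
have t2 : 0 <= t ^+ 2 <= 9 by apply/andP; split; nra.
have tt3 : 0 <= t ^+ 3 <= 27.
  by rewrite exprS; case/andP: t2 => ? ?; apply/andP; split; nra.
have J12 : J <= J ^+ 2 by rewrite ler_eXnr.
have J23 : J ^+ 2 <= J ^+ 3 by rewrite ler_weXn2l.
case/andP: t2 => t2 t2'; case/andP: tt3 => t3' t3''.
have B1 : `|J ^+ 3 * (t ^+ 2 / 2 - 12^-1)| <= J ^+ 3 * 5.
  rewrite normrM ger0_norm; last lra.
  by apply: ler_wpM2l; [lra|rewrite ler_norml; apply/andP; split; lra].
have B2 : `|J ^+ 2 * (2 / 3 * t ^+ 3 + t ^+ 2 / 4 - 12^-1)| <= J ^+ 2 * 25.
  rewrite normrM ger0_norm; last lra.
  by apply: ler_wpM2l; [lra|rewrite ler_norml; apply/andP; split; lra].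
have B3 : `|J * (2 / 3 * t ^+ 3 - t ^+ 2 / 4)| <= J * 20.
  rewrite normrM ger0_norm; last lra.
  by apply: ler_wpM2l; [lra|rewrite ler_norml; apply/andP; split; lra].
apply: le_trans (ler_normD _ _) _; have := ler_normD (J ^+ 3 * (t ^+ 2 / 2 - 12^-1)) (J ^+ 2 * (2 / 3 * t ^+ 3 + t ^+ 2 / 4 - 12^-1)).
lra.
Qed.

End WeightedHarmonic.

(** * Asymptotics of the model moment *)

Section Model.
Variable R : realType.
Implicit Types (x y u v t c : R) (n m : nat) (a b : nat -> R).

Definition kap : R := ln (2 * pi) + gam R - 3 / 2.

Lemma H_approx x : 1 <= x ->
  `|H x - (zeta2 R * x ^+ 3 / 3 - x ^+ 2 / 2 * (ln x + kap))| <= 400 * (x * Num.sqrt x).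
Proof.
move=> x1; have x0 : 0 < x by lra.
have sx0 : 0 <= Num.sqrt x by exact: sqrtr_ge0.
set J := Num.truncn (Num.sqrt x); set X := Num.truncn x.
have /andP[Jx xJ] := truncn_itv sx0; rewrite -/J -[J.+1%:R]natr1 in Jx xJ.
have J0 : (0 < J)%N by rewrite truncn_gt0 -sqrtr1 ler_wsqrtr.
have Jr : 1 <= J%:R :> R by rewrite ler1n.
have sxx : Num.sqrt x ^+ 2 = x by rewrite sqr_sqrtr ?ltW.
have J2x : J%:R ^+ 2 <= x by rewrite -sxx lerXn2r ?nnegrE.
have xJ2 : x < (J%:R + 1) ^+ 2 by rewrite -sxx ltrXn2r ?nnegrE//; lra.
have [s sE] : exists s, x = J%:R ^+ 2 + s by exists (x - J%:R ^+ 2); ring.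
have s03 : 0 <= s <= 3 * J%:R by apply/andP; split; nra.
have hyp := @hyperbola R (fun m j => (x - m%:R * j%:R) ^+ 2 / m%:R) X J _ _.
have {hyp} HE : H x = psum (fun m => m%:R * F (x / m%:R)) J
   + psum (fun j => j%:R ^+ 2 * Kf (x / j%:R)) J
   - psum (fun m => psum (fun j => (x - m%:R * j%:R) ^+ 2 / m%:R) J) J.
  have L1 n : psum (fun m => m%:R * F (x / m%:R)) n =
      psum (fun m => psum (fun j => (x - m%:R * j%:R) ^+ 2 / m%:R) (X %/ m)) n.
    apply: eq_psum => m /andP[m0 _]; rewrite /F truncn_div ?ltW// -psumZ.
    apply: eq_psum => j _; have mr : m%:R != 0 :> R by rewrite pnatr_eq0 -lt0n.
    by field.
  have L2 : psum (fun j => j%:R ^+ 2 * Kf (x / j%:R)) J =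
      psum (fun j => psum (fun m => (x - m%:R * j%:R) ^+ 2 / m%:R) (X %/ j)) J.
    apply: eq_psum => j /andP[j0 _]; rewrite /Kf truncn_div ?ltW// -psumZ.
    apply: eq_psum => m /andP[m0 _]; have mr : m%:R != 0 :> R by rewrite pnatr_eq0 -lt0n.
    have jr : j%:R != 0 :> R by rewrite pnatr_eq0 -lt0n.
    by field; rewrite mr jr.
  rewrite /H -/X !L1 L2; apply: hyp.
    by rewrite /X (truncn_ge_nat _ (ltW x0)) natrM -expr2.
  by rewrite /X (truncn_lt_nat _ (ltW x0)) natrM -expr2 -[J.+1%:R]natr1.
set S1 := psum _ J in HE; set S2 := psum _ J in HE; set S3 := psum _ J in HE.
have B1 : `|S1 - (x ^+ 3 / 3 * psum (fun i => (i%:R ^+ 2)^-1) J - x ^+ 2 / 2 * harm R J)| <= x * J%:R.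
  rewrite /harm -!psumZ -psumB -psumB.
  apply: le_trans (ler_norm_psum _ _) _.
  rewrite [leRHS]mulrC -psum_const; apply: ler_psum => m /andP[m0 mJ].
  have mr : 0 < m%:R :> R by rewrite ltr0n.
  have -> : m%:R * F (x / m%:R) - (x ^+ 3 / 3 * (m%:R ^+ 2)^-1 - x ^+ 2 / 2 / m%:R) = m%:R * E (x / m%:R).
    by rewrite /E; field; rewrite gt_eqF.
  rewrite normrM ger0_norm; last exact: ltW.
  have := @E_abs R (x / m%:R) ltac:(rewrite divr_ge0//; lra).
  move=> /(ler_wpM2l (ltW mr)) /le_trans; apply.
  have -> : m%:R * (x / m%:R / 3) = x / 3 by field; rewrite gt_eqF.
  lra.
have B2 : `|S2 - (x ^+ 2 * (J%:R * (ln x + gam R - 3 / 2) - ln (J`!)%:R) + x * (J%:R * (J%:R + 1) / 2))| <= 10 * J%:R ^+ 3.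
  rewrite -psum_ln -psum_const -psum_id -psumB -!psumZ -psumD -psumB.
  apply: le_trans (ler_norm_psum _ _) _.
  apply: le_trans (_ : _ <= psum (fun=> 10 * J%:R ^+ 2) J) _; last by rewrite psum_const; lra.
  apply: ler_psum => j /andP[j0 jJ].
  have jr : 0 < j%:R :> R by rewrite ltr0n.
  have jJr : j%:R <= J%:R :> R by rewrite ler_nat.
  have J2J : J%:R <= J%:R ^+ 2 :> R by rewrite ler_eXnr.
  have -> : j%:R ^+ 2 * Kf (x / j%:R) - (x ^+ 2 * (ln x + gam R - 3 / 2 - ln j%:R) + x * j%:R) =
    j%:R ^+ 2 * (Kf (x / j%:R) - ((x / j%:R) ^+ 2 * (ln (x / j%:R) + gam R - 3 / 2) + x / j%:R)).
    by rewrite ln_div ?posrE//; field; rewrite gt_eqF.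
  rewrite normrM ger0_norm ?sqr_ge0// mulrC.
  apply: ler_pM => //; last by rewrite lerXn2r ?nnegrE// ltW.
  by apply: Kf_approx; rewrite ler_pdivlMr// mul1r; lra.
have E3 : S3 = x ^+ 2 * J%:R * harm R J - x * J%:R ^+ 2 * (J%:R + 1)
   + J%:R ^+ 2 * (J%:R + 1) ^+ 2 * (2 * J%:R + 1) / 12.
  have -> : S3 = psum (fun m => x ^+ 2 * J%:R * m%:R^-1 - x * (J%:R * (J%:R + 1))
      + m%:R * (J%:R * (J%:R + 1) * (2 * J%:R + 1) / 6)) J.
    apply: eq_psum => m /andP[m0 _]; have mr : m%:R != 0 :> R by rewrite pnatr_eq0 -lt0n.
    rewrite -psum_sq -[x * _](_ : 2 * x * (J%:R * (J%:R + 1) / 2) = _); last by field.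
    rewrite -psum_id -psumZ -psumZ.
    have -> : x ^+ 2 * J%:R / m%:R = psum (fun=> x ^+ 2 / m%:R) J by rewrite psum_const; field.
    rewrite -psumB -psumD; apply: eq_psum => j _; by field.
  by rewrite psumD psumB psumZ psum_const psumZr psum_id /harm; field.
have h1 := zeta2P R J0; have h2 := gamP R J0; have h3 := stirlingP R J0.
set e1 := (X in `|X|) in h1; set e2 := (X in `|X|) in h2; set e3 := (X in `|X|) in h3.
have Jp : 0 < J%:R :> R by lra.
have J2p : 0 < J%:R ^+ 2 :> R by rewrite exprn_gt0.
have a1 := @ln_sub R x (J%:R ^+ 2) x0 J2p.
have a2 := @ln_sub R (J%:R ^+ 2) x J2p x0.
rewrite lnXn // -[ln _ *+ 2]mulr_natl in a1 a2.
have [e4 E4] : exists e4, ln x = 2 * ln J%:R + s / J%:R ^+ 2 + e4.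
  by exists (ln x - 2 * ln J%:R - s / J%:R ^+ 2); ring.
have P := H_poly Jr s03 sE; set PP := (X in `|X|) in P.
pose r1 := S1 - (x ^+ 3 / 3 * psum (fun i => (i%:R ^+ 2)^-1) J - x ^+ 2 / 2 * harm R J).
pose r2 := S2 - (x ^+ 2 * (J%:R * (ln x + gam R - 3 / 2) - ln (J`!)%:R) + x * (J%:R * (J%:R + 1) / 2)).
(* Here [r1] and [r2] are the errors of the two legs, [e1] to [e4] those of zeta(2), the harmonic
   sum, Stirling's formula and ln x, and [PP] is the expression of [H_poly]. Each contributes
   O(J^3). *)
have -> : H x - (zeta2 R * x ^+ 3 / 3 - x ^+ 2 / 2 * (ln x + kap)) =
  r1 + r2 + x ^+ 3 / 3 * e1 - x ^+ 2 * (J%:R + 2^-1) * e2 + x ^+ 2 * (J%:R + 2^-1) * e4 - x ^+ 2 * e3 + PP.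
  have hz : psum (fun i => (i%:R ^+ 2)^-1) J = zeta2 R - J%:R^-1 + (2 * J%:R ^+ 2)^-1 + e1 by rewrite /e1; ring.
  have hh : harm R J = ln J%:R + (2 * J%:R)^-1 + gam R + e2 by rewrite /e2; ring.
  have hf : ln (J`!%:R) = (J%:R + 2^-1) * ln J%:R - J%:R + ln (2 * pi) / 2 + e3 by rewrite /e3; ring.
  rewrite HE E3 -[S1](subrK (x ^+ 3 / 3 * psum (fun i => (i%:R ^+ 2)^-1) J - x ^+ 2 / 2 * harm R J)) -/r1.
  rewrite -[S2](subrK (x ^+ 2 * (J%:R * (ln x + gam R - 3 / 2) - ln (J`!)%:R) + x * (J%:R * (J%:R + 1) / 2))) -/r2.
  rewrite hz hh hf E4 /PP /kap.
  clearbody e1 e2 e3 r1 r2.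
  move: (J%:R : R) Jp (ln J%:R) (ln (2 * pi)) (gam R) (zeta2 R) => *.
  by field; rewrite gt_eqF.
have x4 : x <= 4 * J%:R ^+ 2 by clear -Jr xJ2; nra.
have J3 : J%:R ^+ 3 <= x * Num.sqrt x.
  by rewrite exprSr ler_pM// sqr_ge0.
have x2 : x ^+ 2 <= 16 * J%:R ^+ 4.
  by rewrite [leRHS](_ : _ = (4 * J%:R ^+ 2) ^+ 2); [rewrite lerXn2r ?nnegrE//; clear -x0 x4 J2p; lra|ring].
have x3 : x ^+ 3 <= 64 * J%:R ^+ 6.
  by rewrite [leRHS](_ : _ = (4 * J%:R ^+ 2) ^+ 3); [rewrite lerXn2r ?nnegrE//; clear -x0 x4 J2p; lra|ring].
have x20 : 0 <= x ^+ 2 by exact: sqr_ge0.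
have J30 : 0 <= J%:R ^+ 3 :> R by rewrite exprn_ge0.
have C1 : `|x ^+ 3 / 3 * e1| <= 4 * J%:R ^+ 3.
  rewrite normrM ger0_norm; last by rewrite divr_ge0// exprn_ge0// ltW.
  apply: le_trans (_ : _ <= 64 * J%:R ^+ 6 / 3 * (6 * J%:R ^+ 3)^-1) _.
    by apply: ler_pM => //; [rewrite divr_ge0// exprn_ge0// ltW|clear -x3; lra].
  have -> : 64 * J%:R ^+ 6 / 3 * (6 * J%:R ^+ 3)^-1 = 64 / 18 * J%:R ^+ 3 :> R by field; rewrite gt_eqF.
  clear -J30; lra.
have D : x ^+ 2 * (J%:R + 2^-1) <= 24 * J%:R ^+ 5.
  rewrite [leRHS](_ : _ = 16 * J%:R ^+ 4 * (3 / 2 * J%:R)); last by field.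
  by apply: ler_pM => //; clear -Jr; lra.
have D0 : 0 <= x ^+ 2 * (J%:R + 2^-1) by apply: mulr_ge0 => //; lra.
have C2 : `|x ^+ 2 * (J%:R + 2^-1) * e2| <= 8 * J%:R ^+ 3.
  rewrite normrM ger0_norm//.
  apply: le_trans (_ : _ <= 24 * J%:R ^+ 5 * (3 * J%:R ^+ 2)^-1) _; first exact: ler_pM.
  by apply: eq_ler; field; rewrite gt_eqF.
have C4 : `|x ^+ 2 * (J%:R + 2^-1) * e4| <= 216 * J%:R ^+ 3.
  rewrite normrM ger0_norm//.
  apply: le_trans (_ : _ <= 24 * J%:R ^+ 5 * (9 * (J%:R ^+ 2)^-1)) _; last first.
    by apply: eq_ler; field; rewrite gt_eqF.
  apply: ler_pM => //.
  have E : (J%:R ^+ 2 - x) / x = s ^+ 2 / (J%:R ^+ 2 * x) - s / J%:R ^+ 2.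
    have : x != 0 by rewrite gt_eqF.
    by rewrite sE => ?; field; apply/andP; split => //; rewrite gt_eqF.
  have E' : (x - J%:R ^+ 2) / J%:R ^+ 2 = s / J%:R ^+ 2 by rewrite sE; field; rewrite gt_eqF.
  rewrite E in a2; rewrite E' in a1.
  have Q : s ^+ 2 / (J%:R ^+ 2 * x) <= 9 * (J%:R ^+ 2)^-1.
    case/andP: s03 => s0 s3.
    rewrite invfM mulrCA mulrC; apply: ler_wpM2r; first by rewrite invr_ge0 ltW.
    rewrite ler_pdivrMr//; clear -s0 s3 Jr J2x; nra.
  have Q0 : 0 <= s ^+ 2 / (J%:R ^+ 2 * x) by rewrite divr_ge0 ?sqr_ge0// mulr_ge0// ltW.
  move: (s ^+ 2 / _) (s / _) Q Q0 a1 a2 E4 => q r Q Q0 a1 a2 E4.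
  by clear -Q Q0 a1 a2 E4; rewrite ler_norml; apply/andP; split; lra.
have C3 : `|x ^+ 2 * e3| <= 16 * J%:R ^+ 3.
  rewrite normrM ger0_norm//.
  apply: le_trans (_ : _ <= 16 * J%:R ^+ 4 * J%:R^-1) _; first exact: ler_pM.
  by apply: eq_ler; field; rewrite gt_eqF.
have B1' : `|r1| <= 4 * J%:R ^+ 3.
  apply: le_trans B1 _; rewrite [leRHS](_ : _ = 4 * J%:R ^+ 2 * J%:R); last by ring.
  by apply: ler_wpM2r => //; lra.
move: C1 C2 C3 C4 B1' B2 P; rewrite -/r2.
move: (_ * e1) (_ * e2) (_ * e3) (_ * e4) r1 r2 PP => b1 b2 b3 b4 b5 b6 b7.
clear -J3 J30; rewrite !ler_norml => /andP[? ?] /andP[? ?] /andP[? ?] /andP[? ?] /andP[? ?] /andP[? ?] /andP[? ?].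
by apply/andP; split; lra.
Qed.

End Model.

(** * Partial summation *)

Section Abel.
Variable R : realType.
Implicit Types (x y u v t c : R) (n m : nat) (a b : nat -> R).

Lemma tail_by_parts (dl : nat -> R) (f eta K C : R) :
  (forall n, (0 < n)%N -> `|psum dl n - f| <= eta / Num.sqrt n%:R) ->
  (forall n, (0 < n)%N -> `|psum (fun e => dl e / e%:R) n - K| <= C / r4 n%:R) ->
  forall n, (0 < n)%N ->
  `|psum (fun e => dl e / e%:R) n - K| <= 2 * eta / (n%:R * Num.sqrt n%:R).
Proof.
move=> hD hK.
have eta0 : 0 <= eta.
  by have := hD 1%N isT; rewrite sqrtr1 divr1; apply: le_trans.
pose D n := psum dl n - f.
pose T n := psum (fun e => dl e / e%:R) n - D n / n.+1%:R.
have sq n : (0 < n)%N -> 0 < Num.sqrt n%:R :> R by move=> n0; rewrite sqrtr_gt0 ltr0n.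
have Tinc n : (0 < n)%N -> `|T n.+1 - T n| <=
    eta / (n%:R * Num.sqrt n%:R) - eta / (n.+1%:R * Num.sqrt n.+1%:R).
  move=> n0; have nr : 0 < n%:R :> R by rewrite ltr0n.
  have -> : T n.+1 - T n = D n.+1 * (n.+1%:R^-1 - n.+2%:R^-1).
    rewrite /T /D !psumS -[n.+2%:R]natr1 -[n.+1%:R]natr1; field.
    by rewrite !gt_eqF//; lra.
  have h := hD n.+1 isT; rewrite -/(D n.+1) in h.
  have E : n.+1%:R^-1 - n.+2%:R^-1 = (n.+1%:R * n.+2%:R)^-1 :> R.
    by rewrite -[n.+2%:R]natr1 -[n.+1%:R]natr1; field; rewrite !gt_eqF//; lra.
  rewrite E normrM (@ger0_norm _ (_^-1)); last by rewrite invr_ge0 mulr_ge0.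
  apply: le_trans (_ : _ <= eta / Num.sqrt n.+1%:R * (n%:R^-1 - n.+1%:R^-1)) _.
    apply: ler_pM => //.
    have -> : n%:R^-1 - n.+1%:R^-1 = (n%:R * n.+1%:R)^-1 :> R.
      by rewrite -[n.+1%:R]natr1; field; rewrite !gt_eqF//; lra.
    rewrite lef_pV2 ?posrE ?mulr_gt0// mulrC ler_pM// ler_nat.
    exact: ltnW.
  have a0 := sq n.+1 isT; have b0 := sq n n0.
  have -> : eta / (n%:R * Num.sqrt n%:R) - eta / (n.+1%:R * Num.sqrt n.+1%:R) =
    eta * ((Num.sqrt n%:R)^-1 / n%:R - (Num.sqrt n.+1%:R)^-1 / n.+1%:R).
    by rewrite -[n.+1%:R]natr1 in a0 *; field; rewrite !gt_eqF//; lra.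
  rewrite -mulrA; apply: ler_wpM2l => //; rewrite mulrBr lerD2r.
  apply: ler_wpM2r; first by rewrite invr_ge0 ltW.
  by rewrite lef_pV2 ?posrE// ler_wsqrtr// ler_nat.
have [|l hl] := seq_lim Tinc.
  by move=> n n0; rewrite divr_ge0// mulr_ge0// sqrtr_ge0.
have n1le n : (0 < n)%N -> (n%:R * Num.sqrt n%:R)^-1 <= (r4 n%:R)^-1 :> R.
  move=> n0; have r1 : 1 <= r4 n%:R :> R by exact: r4_ge1.
  have s1 : 1 <= Num.sqrt n%:R :> R by rewrite sqrt_ge1// ler1n.
  rewrite lef_pV2 ?posrE ?mulr_gt0 ?sq ?ltr0n//; last by lra.
  have := r4_le R n0; have nr : 0 <= n%:R :> R by []. nra.
have Dn n : (0 < n)%N -> `|D n / n.+1%:R| <= eta / (n%:R * Num.sqrt n%:R).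
  move=> n0; rewrite normrM (@ger0_norm _ (_^-1)) ?invr_ge0//.
  have -> : eta / (n%:R * Num.sqrt n%:R) = eta / Num.sqrt n%:R / n%:R.
    by rewrite invfM [_^-1 * _^-1]mulrC mulrA.
  apply: ler_pM => //; first exact: hD.
  by rewrite lef_pV2 ?posrE ?ltr0n// ler_nat.
have lK : l = K.
  apply/eqP; rewrite -subr_eq0 -normr_le0.
  apply: (@le_r4 _ _ _ (2 * eta + C) 1) => n n0; rewrite add0r.
  have h1 := hl n n0; have h2 := hK n n0; have h3 := Dn n n0.
  have h4 := ler_wpM2l eta0 (n1le n n0).
  have -> : l - K = (psum (fun e => dl e / e%:R) n - K) - (T n - l) - D n / n.+1%:R by rewrite /T; ring.
  apply: le_trans (ler_normB _ _) _; have h5 := ler_normB (psum (fun e => dl e / e%:R) n - K) (T n - l).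
  rewrite [leRHS](_ : _ = C / r4 n%:R + eta / r4 n%:R + eta / r4 n%:R); last by ring.
  lra.
move=> n n0; have h1 := hl n n0; have h3 := Dn n n0; rewrite lK in h1.
have -> : psum (fun e => dl e / e%:R) n - K = (T n - K) + D n / n.+1%:R by rewrite /T; ring.
apply: le_trans (ler_normD _ _) _.
have -> : 2 * eta / (n%:R * Num.sqrt n%:R) = eta / (n%:R * Num.sqrt n%:R) + eta / (n%:R * Num.sqrt n%:R) by ring.
lra.
Qed.

(** Write e^2 F(x/e) = x^3/(3e) - x^2/2 + rho(e). The first two terms meet the partial sums
    controlled by the hypotheses. As rho changes by at most 2x from one integer to the next,
    summation by parts bounds the third by x times the sum of e^(-1/2), of order x^(3/2). *)
Lemma weighted_by_parts (dl : nat -> R) (f eta K C : R) x :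
  (forall n, (0 < n)%N -> `|psum dl n - f| <= eta / Num.sqrt n%:R) ->
  (forall n, (0 < n)%N -> `|psum (fun e => dl e / e%:R) n - K| <= C / r4 n%:R) ->
  `|f| <= eta -> 1 <= x ->
  `|psum (fun e => dl e * e%:R ^+ 2 * F (x / e%:R)) (Num.truncn x)
     - (K * x ^+ 3 / 3 - f * x ^+ 2 / 2)| <= 20 * eta * (x * Num.sqrt x).
Proof.
move=> hD hK feta x1; have x0 : 0 < x by lra.
have eta0 : 0 <= eta by apply: le_trans feta.
have hT := tail_by_parts hD hK.
set X := Num.truncn x.
have X0 : (0 < X)%N by rewrite truncn_gt0.
have /andP[Xx xX] := truncn_itv (ltW x0); rewrite -/X -[X.+1%:R]natr1 in Xx xX.
have Xr : 1 <= X%:R :> R by rewrite ler1n.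
have sx : 0 < Num.sqrt x by rewrite sqrtr_gt0.
have sX : 0 < Num.sqrt X%:R :> R by rewrite sqrtr_gt0; lra.
have sXx : Num.sqrt X%:R <= Num.sqrt x by rewrite ler_wsqrtr.
have sxX : Num.sqrt x <= 2 * Num.sqrt X%:R.
  rewrite -(@ler_pXn2r _ 2)// ?nnegrE ?(ltW sx)// ?mulr_ge0 ?(ltW sX)//.
  by rewrite exprMn !sqr_sqrtr//; lra.
have ssx : Num.sqrt x ^+ 2 = x by rewrite sqr_sqrtr// ltW.
have ssX : Num.sqrt X%:R ^+ 2 = X%:R :> R by rewrite sqr_sqrtr.
pose D n := psum dl n - f.
pose rho (e : nat) : R := e%:R ^+ 2 * E (x / e%:R).
have rho_abs n : (0 < n)%N -> `|rho n| <= x * n%:R / 3.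
  move=> n0; have nr : 0 < n%:R :> R by rewrite ltr0n.
  rewrite /rho normrM ger0_norm ?sqr_ge0//.
  have := @E_abs R (x / n%:R) (divr_ge0 (ltW x0) (ltW nr)).
  move=> /(ler_wpM2l (sqr_ge0 n%:R)) /le_trans; apply.
  by apply: eq_ler; field; rewrite gt_eqF.
have rho_lip n : (0 < n)%N -> `|rho n - rho n.+1| <= 2 * x.
  move=> n0; have nr : 1 <= n%:R :> R by rewrite ler1n.
  set u := x / n%:R; set v := x / n.+1%:R.
  have v0 : 0 <= v by rewrite divr_ge0// ltW.
  have vu : v <= u by apply: (ler_wpM2l (ltW x0)); rewrite lef_pV2 ?posrE ?ltr0n// ler_nat.
  have -> : rho n - rho n.+1 = n%:R ^+ 2 * (E u - E v) - (2 * n%:R + 1) * E v.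
    by rewrite /rho -/u -/v -[n.+1%:R]natr1; ring.
  have h1 := E_lip v0 vu; have h2 := E_abs v0.
  apply: le_trans (ler_normB _ _) _; rewrite !normrM ger0_norm ?sqr_ge0//.
  rewrite (@ger0_norm _ (_ + 1)); last lra.
  have B1 : n%:R ^+ 2 * `|E u - E v| <= x.
    apply: le_trans (ler_wpM2l (sqr_ge0 _) h1) _.
    have -> : n%:R ^+ 2 * (u - v) = x * (n%:R / n.+1%:R).
      by rewrite /u /v -[n.+1%:R]natr1; field; rewrite !gt_eqF//; lra.
    rewrite -[leRHS]mulr1; apply: ler_wpM2l; first exact: ltW.
    by rewrite ler_pdivrMr ?mul1r ?ltr0n// ler_nat.
  have B2 : (2 * n%:R + 1) * `|E v| <= x.
    apply: le_trans (ler_wpM2l _ h2) _; first lra.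
    have -> : (2 * n%:R + 1) * (v / 3) = x * ((2 * n%:R + 1) / (3 * n%:R + 3)).
      by rewrite /v -[n.+1%:R]natr1; field; rewrite !gt_eqF//; lra.
    rewrite -[leRHS]mulr1; apply: ler_wpM2l; first exact: ltW.
    by rewrite ler_pdivrMr ?mul1r; lra.
  lra.
have S : psum (fun e => dl e * e%:R ^+ 2 * F (x / e%:R)) X =
    x ^+ 3 / 3 * psum (fun e => dl e / e%:R) X - x ^+ 2 / 2 * psum dl X
    + psum (fun e => dl e * rho e) X.
  rewrite -!psumZ -psumB -psumD; apply: eq_psum => e /andP[e0 _].
  have er : e%:R != 0 :> R by rewrite pnatr_eq0 -lt0n.
  by rewrite /rho /E; field.
have Rb n : `|psum (fun e => dl e * rho e) n.+1 - D n.+1 * rho n.+1| <=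
    eta * x + 2 * x * eta * psum (fun e => (Num.sqrt e%:R)^-1) n.
  elim: n => [|n IH].
    rewrite /D !psumS !psum0 !add0r mulr0 addr0.
    have -> : dl 1%N * rho 1%N - (dl 1%N - f) * rho 1%N = f * rho 1%N by ring.
    rewrite normrM; apply: ler_pM => //.
    apply: le_trans (rho_abs 1%N isT) _; lra.
  rewrite psumS.
  have -> : psum (fun e => dl e * rho e) n.+1 + dl n.+2 * rho n.+2 - D n.+2 * rho n.+2 =
    (psum (fun e => dl e * rho e) n.+1 - D n.+1 * rho n.+1) + D n.+1 * (rho n.+1 - rho n.+2).
    by rewrite /D [psum dl n.+2]psumS; ring.
  apply: le_trans (ler_normD _ _) _.
  rewrite [leRHS](_ : _ = eta * x + 2 * x * eta * psum (fun e => (Num.sqrt e%:R)^-1) n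
    + 2 * x * (eta / Num.sqrt n.+1%:R)); last by rewrite psumS; ring.
  apply: lerD => //.
  rewrite normrM [leLHS]mulrC.
  by apply: ler_pM => //; [exact: rho_lip|exact: hD].
have R1 : `|psum (fun e => dl e * rho e) X - D X * rho X| <= 5 * eta * (x * Num.sqrt x).
  have := Rb X.-1; rewrite prednK// => /le_trans; apply.
  have q := psum_rsqrt R X.-1.
  have q2 : Num.sqrt X.-1%:R <= Num.sqrt x.
    by apply: le_trans sXx; rewrite ler_wsqrtr// ler_nat leq_pred.
  have sx1 := sqrt_ge1 x1.
  rewrite [leRHS](_ : _ = eta * (x * Num.sqrt x) + 2 * x * eta * (2 * Num.sqrt x)); last by ring.
  apply: lerD.
    by apply: ler_wpM2l => //; rewrite ler_peMr// ltW.
  apply: ler_wpM2l; last lra.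
  by apply: mulr_ge0 => //; lra.
have R2 : `|D X * rho X| <= eta * (x * Num.sqrt x).
  rewrite normrM; apply: le_trans (_ : _ <= eta / Num.sqrt X%:R * (x * X%:R / 3)) _.
    by apply: ler_pM => //; [exact: hD|exact: rho_abs].
  have -> : eta / Num.sqrt X%:R * (x * X%:R / 3) = eta * (x * (Num.sqrt X%:R / 3)).
    transitivity (eta / Num.sqrt X%:R * (x * Num.sqrt X%:R ^+ 2 / 3)); first by rewrite ssX.
    by field; rewrite gt_eqF.
  apply: ler_wpM2l => //; apply: ler_wpM2l; first exact: ltW.
  lra.
have R3 : `|x ^+ 3 / 3 * (psum (fun e => dl e / e%:R) X - K)| <= 12 * eta * (x * Num.sqrt x).
  rewrite normrM ger0_norm; last by rewrite divr_ge0// exprn_ge0// ltW.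
  apply: le_trans (ler_wpM2l _ (hT X X0)) _; first by rewrite divr_ge0// exprn_ge0// ltW.
  rewrite [leLHS]mulrA ler_pdivrMr; last by rewrite mulr_gt0//; lra.
  have h : x * Num.sqrt x <= 4 * (X%:R * Num.sqrt X%:R).
    rewrite [leRHS](_ : _ = (2 * X%:R) * (2 * Num.sqrt X%:R)); last by ring.
    by apply: ler_pM => //; lra.
  have E : x ^+ 3 = (x * Num.sqrt x) * (x * Num.sqrt x) by transitivity (x ^+ 2 * Num.sqrt x ^+ 2); [rewrite ssx|]; ring.
  have xs0 : 0 <= x * Num.sqrt x by apply: mulr_ge0; exact: ltW.
  have := ler_wpM2l (mulr_ge0 eta0 xs0) h; rewrite E; nra.
have R4 : `|x ^+ 2 / 2 * D X| <= eta * (x * Num.sqrt x).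
  rewrite normrM ger0_norm; last by rewrite divr_ge0// sqr_ge0.
  apply: le_trans (ler_wpM2l _ (hD X X0)) _; first by rewrite divr_ge0// sqr_ge0.
  rewrite [leLHS]mulrA ler_pdivrMr//.
  have xe : 0 <= x * Num.sqrt x * eta by rewrite !mulr_ge0// ltW.
  have := ler_wpM2l xe sxX.
  have -> : x * Num.sqrt x * eta * Num.sqrt x = x ^+ 2 * eta by transitivity (x * eta * Num.sqrt x ^+ 2); [|rewrite ssx]; ring.
  lra.
rewrite S.
have -> : x ^+ 3 / 3 * psum (fun e => dl e / e%:R) X - x ^+ 2 / 2 * psum dl X +
   psum (fun e => dl e * rho e) X - (K * x ^+ 3 / 3 - f * x ^+ 2 / 2) =
   x ^+ 3 / 3 * (psum (fun e => dl e / e%:R) X - K) - x ^+ 2 / 2 * D X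
   + (psum (fun e => dl e * rho e) X - D X * rho X) + D X * rho X.
  by rewrite /D; field.
have e0 : 0 <= eta * (x * Num.sqrt x) by rewrite !mulr_ge0// ltW.
move: R1 R2 R3 R4; clear -e0; rewrite !ler_norml => /andP[? ?] /andP[? ?] /andP[? ?] /andP[? ?].
by apply/andP; split; lra.
Qed.

End Abel.

(** * Upper bounds for multiplicative functions of squarefree integers *)

Section Bounds.
Variable R : realType.
Implicit Types (x y u v t c : R) (n m q d : nat) (a b : nat -> R).

(* Euler's totient on squarefree [n] only, cf. [totient_mf]. *)
Definition phi n : R := mf (fun p => p%:R - 1) n.
(** On squarefree [n] this is the sum of d^(-1/2) over d | n ([dsum_inv_sqrt]): the cost of
    collecting square-root errors over divisors. *)
Definition Pf n : R := mf (fun p => 1 + (Num.sqrt p%:R)^-1) n.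

Lemma prime_m1_gt0 p : prime p -> 0 < p%:R - 1 :> R.
Proof. by move=> /(prime_gt1r R); lra. Qed.

Lemma phi_gt0 n : 0 < phi n.
Proof. exact: mf_gt0 prime_m1_gt0. Qed.

Lemma Pf_ge1 n : 1 <= Pf n.
Proof. by apply: mf_ge1 => p _; rewrite lerDl invr_ge0 sqrtr_ge0. Qed.

Lemma r4_mf n : sqf n -> r4 n%:R = mf (fun p => r4 (p%:R : R)) n.
Proof.
move: n; apply: sqf_ind => [|p n pp pn sn IH]; first by rewrite mf1 r41.
by rewrite natrM r4M// IH mfpM ?sqf_gt0.
Qed.

Lemma sqrt_mf n : sqf n -> Num.sqrt n%:R = mf (fun p => Num.sqrt (p%:R : R)) n.
Proof.
move: n; apply: sqf_ind => [|p n pp pn sn IH]; first by rewrite mf1 sqrtr1.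
by rewrite natrM sqrtrM// IH mfpM ?sqf_gt0.
Qed.

(** Once p^(1/4) exceeds the bound on [a p], the local factor is at most that of n^(1/4); the
    finitely many smaller primes go into [C]. *)
Lemma mf_le_r4 a M : (forall p, prime p -> 0 <= a p <= M) ->
  exists2 C : R, 0 <= C & forall n, sqf n -> mf a n <= C * r4 n%:R.
Proof.
move=> aM; pose M1 := `|M| + 1.
have M11 : 1 <= M1 by rewrite lerDr.
have [p0 p00 hp0] := @r4_big R M1^-1 ltac:(rewrite invr_gt0; lra).
exists (M1 ^+ p0) => [|n sn]; first by rewrite exprn_ge0//; lra.
have aM1 p : prime p -> a p <= M1.
  by move=> /aM/andP[_ h]; apply: le_trans h _; rewrite /M1; have := ler_norm M; lra.
rewrite r4_mf//; apply: mf_comparison => // [p /aM/andP[]//|p pp||].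
- exact: r4_ge0.
- move=> p pp; apply: le_trans (aM1 p pp) _.
  by rewrite ler_peMr ?r4_ge1 ?prime_gt0//; lra.
- move=> p pp pp0; apply: le_trans (aM1 p pp) _.
  rewrite -[M1]invrK -[leRHS]invrK lef_pV2 ?posrE ?invr_gt0 ?r4_gt0 ?ltr0n ?prime_gt0//; last by lra.
  exact: hp0.
Qed.

Lemma inv_m1_le p : prime p -> p%:R / (p%:R - 1) <= 2 :> R.
Proof.
move=> pp; have := prime_ge2r R pp => h.
by rewrite ler_pdivrMr ?prime_m1_gt0//; lra.
Qed.

Lemma inv_sqrt_le1 p : prime p -> 0 <= (Num.sqrt (p%:R : R))^-1 <= 1.
Proof.
move=> pp; rewrite invr_ge0 sqrtr_ge0/= invf_le1 ?sqrtr_gt0 ?ltr0n ?prime_gt0//.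
by rewrite sqrt_ge1// ler1n prime_gt0.
Qed.

Lemma phi_bound k l m : exists2 C : R, 0 <= C & forall n, sqf n ->
  (n%:R / phi n) ^+ k * Pf n ^+ l * mf (fun=> 2) n ^+ m <= C * r4 n%:R.
Proof.
have [|C C0 hC] := @mf_le_r4 (fun p => (p%:R / (p%:R - 1)) ^+ k * (1 + (Num.sqrt p%:R)^-1) ^+ l * 2 ^+ m)
  (2 ^+ k * 2 ^+ l * 2 ^+ m).
  move=> p pp; have h1 := inv_m1_le pp; have /andP[h2 h3] := inv_sqrt_le1 pp.
  have h0 : 0 <= p%:R / (p%:R - 1) :> R by rewrite divr_ge0// ltW// prime_m1_gt0.
  have h4 : 0 <= 1 + (Num.sqrt p%:R)^-1 :> R by lra.
  apply/andP; split; first by rewrite !mulr_ge0// exprn_ge0.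
  apply: ler_wpM2r; first by rewrite exprn_ge0.
  by apply: ler_pM; rewrite ?exprn_ge0// lerXn2r// ?nnegrE//; lra.
exists C => // n sn; apply: le_trans (hC n sn).
rewrite !mf_mul.
have mfX (a : nat -> R) i : mf (fun p => a p ^+ i) n = mf a n ^+ i by rewrite /mf prodrXl.
by rewrite !mfX mf_mul mfV -natr_mf.
Qed.

Lemma dsum_inv_sqrt n : sqf n -> \sum_(d <- divisors n) (Num.sqrt (d%:R : R))^-1 = Pf n.
Proof.
move=> sn; rewrite (@eq_dsum _ _ (mf (fun p => (Num.sqrt p%:R)^-1))) ?sqf_gt0//; last first.
  by move=> d /(sqf_dvdm sn)[sd _]; rewrite mfV sqrt_mf.
by rewrite dsum_mf//; apply: eq_mf => p _; rewrite addrC.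
Qed.

Lemma sqrt_z n : (0 < n)%N -> (n%:R * Num.sqrt n%:R)^-1 * r4 n%:R = z R n.
Proof.
move=> n0; have r0 : 0 < r4 n%:R :> R by apply: r4_gt0; rewrite ltr0n.
have nr : 0 < n%:R :> R by rewrite ltr0n.
by rewrite -r4X2 /z; field; rewrite !gt_eqF.
Qed.

Lemma sqrt_div_sq n : (0 < n)%N -> Num.sqrt n%:R / n%:R ^+ 2 <= z R n.
Proof.
move=> n0; have nr : 0 < n%:R :> R by rewrite ltr0n.
have sn : 0 < Num.sqrt n%:R :> R by rewrite sqrtr_gt0.
have -> : Num.sqrt n%:R / n%:R ^+ 2 = (n%:R * Num.sqrt n%:R)^-1 :> R.
  transitivity (Num.sqrt n%:R / (n%:R * Num.sqrt n%:R ^+ 2) : R); last by field; rewrite !gt_eqF.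
  by rewrite sqr_sqrtr ?(ltW nr)// expr2.
by rewrite -(sqrt_z n0) ler_peMr ?r4_ge1// invr_ge0 mulr_ge0// ltW.
Qed.

Lemma lnp_zdom (h : nat -> R) (C : R) : 0 <= C ->
  (forall p, prime p -> 0 <= h p <= C / p%:R ^+ 2) ->
  zdom (fun p => if prime p then ln p%:R * h p else 0) (4 * C).
Proof.
move=> C0 hh n n0; case: ifP => pn; last by rewrite normr0 !mulr_ge0// z_ge0.
have /andP[h0 h1] := hh n pn.
have nr : 0 < n%:R :> R by rewrite ltr0n.
have l0 : 0 <= ln n%:R :> R by rewrite ln_ge0// ler1n.
rewrite ger0_norm ?mulr_ge0//.
have r0 : 0 < r4 n%:R :> R by rewrite r4_gt0.
apply: le_trans (ler_pM l0 h0 (ln_le_r4 nr) h1) _.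
have -> : 4 * r4 n%:R * (C / n%:R ^+ 2) = 4 * C * (r4 n%:R / n%:R ^+ 2) by ring.
 apply: ler_wpM2l; first by rewrite mulr_ge0.
rewrite /z ler_pdivrMr ?exprn_gt0// mulrC ler_pdivlMr ?mulr_gt0//.
rewrite mulrCA -expr2 r4X2 expr2; apply: ler_wpM2l => //.
have s1 : 1 <= Num.sqrt n%:R :> R by rewrite sqrt_ge1// ler1n.
rewrite -[leRHS](@sqr_sqrtr R n%:R)// expr2; nra.
Qed.

(** With [B] = sqrt Y, terms with k < B are at most C/Y and there are about B of them; for k >= B
    they are at most C k^(-3/2) B^(-1/2). Both ranges fit the single majorant C B^(-1/2) (B +
    k)^(-3/2), up to a constant, which telescopes. *)
Lemma sum_min_bound (Y : R) n (e : R -> R) (C : R) : 0 < Y ->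
  (forall u, 0 < u -> e u <= C / u /\ e u <= C / r4 u) -> 0 <= C ->
  psum (fun k => (k%:R ^+ 2)^-1 * e (Y / k%:R ^+ 2)) n <= 6 * C / Num.sqrt Y.
Proof.
move=> Y0 he C0; set B := Num.sqrt Y.
have B0 : 0 < B by rewrite sqrtr_gt0.
have BY : B ^+ 2 = Y by rewrite sqr_sqrtr// ltW.
have rB : r4 Y = Num.sqrt B by [].
have sB : 0 < Num.sqrt B by rewrite sqrtr_gt0.
suff : psum (fun k => (k%:R ^+ 2)^-1 * e (Y / k%:R ^+ 2)) n <=
    6 * C / Num.sqrt B * ((Num.sqrt B)^-1 - (Num.sqrt (B + n%:R))^-1).
  move=> /le_trans; apply.
  have -> : 6 * C / B = 6 * C / Num.sqrt B * (Num.sqrt B)^-1.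
    transitivity (6 * C / Num.sqrt B ^+ 2); [by rewrite sqr_sqrtr// ltW|by field; rewrite gt_eqF].
  apply: ler_wpM2l; first by rewrite divr_ge0 ?(ltW sB)// mulr_ge0.
  by rewrite gerBl invr_ge0 sqrtr_ge0.
elim: n => [|n IH]; first by rewrite psum0 addr0 subrr mulr0.
rewrite psumS; set b : R := n.+1%:R.
have b0 : 0 < b by rewrite /b ltr0n.
have bE : B + n%:R = B + b - 1 by rewrite /b -[n.+1%:R]natr1; ring.
have n0 : 0 <= n%:R :> R by [].
have step : (b ^+ 2)^-1 * e (Y / b ^+ 2) <=
   6 * C / Num.sqrt B * ((Num.sqrt (B + n%:R))^-1 - (Num.sqrt (B + b))^-1).
  set v := Num.sqrt (B + b); set v1 := Num.sqrt (B + n%:R).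
  have v0 : 0 < v by rewrite sqrtr_gt0; lra.
  have v10 : 0 < v1 by rewrite sqrtr_gt0; lra.
  have vv : v ^+ 2 - v1 ^+ 2 = 1 by rewrite !sqr_sqrtr ?bE; lra.
  have v1v : v1 <= v by rewrite ler_wsqrtr// bE; lra.
  have D : (2 * v ^+ 3)^-1 <= v1^-1 - v^-1.
    have -> : v1^-1 - v^-1 = (v ^+ 2 - v1 ^+ 2) / (v * v1 * (v + v1)).
      by field; rewrite !gt_eqF//; lra.
    have v30 : 0 < 2 * v ^+ 3 by rewrite mulr_gt0 ?exprn_gt0.
    have vv0 : 0 < v * v1 * (v + v1) by rewrite !mulr_gt0//; lra.
    rewrite vv mul1r lef_pV2 ?posrE//.
    rewrite [leRHS](_ : _ = v * v * (v + v)); last by ring.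
    by apply: ler_pM; rewrite ?mulr_ge0//; nra.
  have [h1 h2] := he (Y / b ^+ 2) ltac:(by rewrite divr_gt0 ?exprn_gt0).
  have b20 : 0 <= (b ^+ 2)^-1 by rewrite invr_ge0 sqr_ge0.
  (* Applied with [w] the larger of [B] and [b], so that [B + b <= 2 * w]. *)
  have key (w : R) : 0 < w -> B + b <= 2 * w -> (b ^+ 2)^-1 * e (Y / b ^+ 2) <= C / Num.sqrt B * (w * Num.sqrt w)^-1 ->
     (b ^+ 2)^-1 * e (Y / b ^+ 2) <= 6 * C / Num.sqrt B * (v1^-1 - v^-1).
    move=> w0 Bw h; apply: le_trans h _.
    have sw : 0 < Num.sqrt w by rewrite sqrtr_gt0.
    rewrite [leRHS](_ : _ = C / Num.sqrt B * (6 * (v1^-1 - v^-1))); last by ring.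
    apply: ler_wpM2l; first by rewrite divr_ge0// ltW.
    apply: le_trans (_ : _ <= 6 * (2 * v ^+ 3)^-1) _; last by apply: ler_wpM2l.
    rewrite ler_pdivlMr ?mulr_gt0 ?exprn_gt0// mulrC ler_pdivrMr ?mulr_gt0//.
    have ve : v ^+ 2 = B + b by rewrite sqr_sqrtr//; lra.
    have vw : v <= 3 / 2 * Num.sqrt w.
      have sw32 : 0 <= 3 / 2 * Num.sqrt w by lra.
      rewrite -(@ler_pXn2r _ 2)// ?nnegrE ?(ltW v0)//.
      by rewrite ve exprMn (sqr_sqrtr (ltW w0)); lra.
    rewrite [v ^+ 3]exprSr ve.
    have := ler_pM (ltac:(lra) : 0 <= B + b) (ltW v0) Bw vw; lra.
  have [Bb|bB] := leP B b.
    apply: (key b) => //; first lra.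
    apply: le_trans (ler_wpM2l b20 h2) _.
    have sb : 0 < Num.sqrt b by rewrite sqrtr_gt0.
    have -> : r4 (Y / b ^+ 2) = Num.sqrt B / Num.sqrt b.
      rewrite r4M ?ltW// rB; congr (_ * _).
      by rewrite r4V ?exprn_gt0// /r4 sqrtr_sqr ger0_norm// ltW.
    have bb : b = Num.sqrt b ^+ 2 by rewrite sqr_sqrtr// ltW.
    apply: eq_ler; rewrite {1 3}bb.
    by field; rewrite !gt_eqF.
  apply: (key B) => //; first lra.
  apply: le_trans (ler_wpM2l b20 h1) _; rewrite -BY.
  apply: eq_ler.
  transitivity (C / (Num.sqrt B ^+ 2 * B)); last by field; rewrite !gt_eqF.
  by rewrite (sqr_sqrtr (ltW B0)); field; rewrite !gt_eqF.
rewrite [leRHS](_ : _ = 6 * C / Num.sqrt B * ((Num.sqrt B)^-1 - (Num.sqrt (B + n%:R))^-1) +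
  6 * C / Num.sqrt B * ((Num.sqrt (B + n%:R))^-1 - (Num.sqrt (B + b))^-1)); last by ring.
exact: lerD.
Qed.

End Bounds.

(** * Sums of the reciprocals of the totient *)

Section LSum.
Variable R : realType.
Implicit Types (x y u v t c : R) (n m q d D j : nat).

Lemma psum_multiples (f : nat -> R) d n : (0 < d)%N ->
  psum (fun m => if (d %| m)%N then f m else 0) n = psum (fun k => f (d * k)%N) (n %/ d).
Proof.
move=> d0; elim: n => [|n IH]; first by rewrite div0n !psum0.
rewrite psumS IH divnS//; case: (boolP (d %| n.+1)%N) => dn; last by rewrite add0n addr0.
rewrite add1n psumS; congr (_ + f _).
have := divnS n d0; rewrite dn add1n => <-.
by rewrite mulnC divnK.
Qed.

Lemma dsum_rev (f : nat -> R) n : (0 < n)%N ->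
  \sum_(d <- divisors n) f d = \sum_(d <- divisors n) f (n %/ d)%N.
Proof.
move=> n0; rewrite -(big_map (fun d => n %/ d)%N xpredT f); apply: perm_big.
have key d : d \in divisors n -> (n %/ (n %/ d) = d)%N.
  rewrite -dvdn_divisors// => dn; have d0 := dvdn_gt0 n0 dn.
  by rewrite -{1}(divnK dn) mulKn// divn_gt0// dvdn_leq.
apply: uniq_perm; first exact: divisors_uniq.
  rewrite map_inj_in_uniq ?divisors_uniq// => a b ha hb e.
  by rewrite -(key a ha) e key.
move=> d; apply/idP/mapP => [dn|[e en ->]].
  exists (n %/ d)%N; last by rewrite key.
  by rewrite -dvdn_divisors// dvdn_div// dvdn_divisors.
by rewrite -dvdn_divisors// dvdn_div// dvdn_divisors.
Qed.

Lemma mu1 : mu R 1 = 1. Proof. by rewrite muE// mf1. Qed.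

Lemma mu_norm n : `|mu R n| <= 1.
Proof.
case: (boolP (sqf n)) => [sn|/(mu_nsqf R) ->]; last by rewrite normr0.
rewrite muE// /mf normr_prod big1// => p _; by rewrite normrN normr1.
Qed.

(** For squarefree b, b^2 divides [m] exactly when b divides [r]; hence the sum is that of mu over
    the divisors of [r], and [r = 1] means that [m] is squarefree. *)
Lemma psum_mu_sq m Y : (0 < m <= Y)%N ->
  psum (fun b => if (b ^ 2 %| m)%N then mu R b else 0) Y = (sqf m)%:R.
Proof.
move=> /andP[m0 mY].
(* The largest squarefree integer whose square divides [m]. *)
pose r := (\prod_(p <- primes m | (p ^ 2 %| m)%N) p)%N.
have pr p : prime p -> (p %| r)%N = (p ^ 2 %| m)%N.
  move=> pp; rewrite /r; apply/idP/idP => [|pm].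
    rewrite big_seq_cond; elim/big_rec: _ => [|q s /andP[qm q2] IH].
      by rewrite dvdn1 => /eqP p1; move: pp; rewrite p1.
    rewrite Euclid_dvdM// => /orP[|//].
    by move: qm; rewrite mem_primes => /andP[qq _]; rewrite dvdn_prime2// => /eqP ->.
  have pmem : p \in primes m.
    by rewrite mem_primes pp m0 (dvdn_trans _ pm)// expnS dvdn_mulr.
  by rewrite big_mkcond (bigD1_seq p) ?primes_uniq//= pm dvdn_mulr.
have sr b : sqf b -> (b %| r)%N = (b ^ 2 %| m)%N.
  move: b; apply: sqf_ind => [|p b pp pb sb IH]; first by rewrite exp1n !dvd1n.
  have cpb : coprime p b by rewrite prime_coprime.
  by rewrite Gauss_dvd// pr// IH expnMn Gauss_dvd// coprimeXl// coprimeXr.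
have r0 : (0 < r)%N.
  rewrite /r big_seq_cond; apply: prodn_cond_gt0 => p /andP[].
  by rewrite mem_primes => /andP[/prime_gt0].
have sqr : sqf r.
  apply/sqfP; split=> // p pp; apply/negP => p2r.
  have pm : (p ^ 2 %| m)%N by rewrite -pr// (dvdn_trans _ p2r)// expnS dvdn_mulr.
  have pmem : p \in primes m.
    by rewrite mem_primes pp m0 (dvdn_trans _ pm)// expnS dvdn_mulr.
  move: p2r; rewrite /r big_mkcond (bigD1_seq p) ?primes_uniq//= pm expnS expn1.
  rewrite dvdn_pmul2l ?prime_gt0//.
  rewrite big_seq_cond; elim/big_rec: _ => [|q s /andP[qm qp] IH].
    by rewrite dvdn1 => /eqP p1; move: pp; rewrite p1.
  case: ifP => _; last by rewrite mul1n.
  rewrite Euclid_dvdM// => /orP[|//].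
  move: qm; rewrite mem_primes => /andP[qq _]; rewrite dvdn_prime2// => /eqP pq.
  by move: qp; rewrite pq eqxx.
have rm : (r <= m)%N.
  apply: dvdn_leq => //; have := sr r sqr; rewrite dvdnn => /esym h.
  by apply: dvdn_trans h; rewrite expnS dvdn_mulr.
have -> : sqf m = (r == 1%N).
  apply/idP/eqP => [/sqfP[_ h]|r1].
    rewrite /r big_seq_cond big_pred0// => p; apply/negP => /andP[].
    by rewrite mem_primes => /andP[/h/negP].
  by apply/sqfP; split=> // p pp; rewrite -pr// r1 dvdn1; apply/eqP => p1; move: pp; rewrite p1.
rewrite -dsum_mu//.
transitivity (psum (fun b => if (b %| r)%N then mu R b else 0) Y).
  apply: eq_psum => b _; case: (boolP (sqf b)) => sb; first by rewrite sr.
  by rewrite mu_nsqf// !if_same.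
rewrite /psum -big_mkcond -big_filter; apply: perm_big; apply: uniq_perm.
- by rewrite filter_uniq// iota_uniq.
- exact: divisors_uniq.
move=> d; rewrite mem_filter mem_index_iota -dvdn_divisors//.
case: (boolP (d %| r)%N) => //= dr.
by rewrite (dvdn_gt0 r0 dr) ltnS (leq_trans (dvdn_leq r0 dr))// (leq_trans rm).
Qed.

Definition chi D m : bool := sqf m && coprime m D.

Definition HD D n : R := psum (fun m => if coprime m D then m%:R^-1 else 0) n.

(** Inclusion and exclusion, one prime at a time: the multiples of [p] form a copy of the sum up to
    [n %/ p], scaled by 1/p. *)
Lemma HD_harm D : sqf D -> forall n,
  HD D n = \sum_(d <- divisors D) mu R d / d%:R * harm R (n %/ d).
Proof.
move: D; apply: sqf_ind => [|p D pp pD sD IH] n.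
  rewrite dsum1 mu1 divr1 mul1r divn1; apply: eq_psum => m _.
  by rewrite /coprime gcdn1.
have D0 := sqf_gt0 sD; have p0 := prime_gt0 pp.
have E : HD (p * D) n = HD D n - p%:R^-1 * HD D (n %/ p).
  have -> : p%:R^-1 * HD D (n %/ p) =
      psum (fun m => if (p %| m)%N then if coprime m D then m%:R^-1 else 0 else 0) n.
    rewrite psum_multiples// /HD -psumZ; apply: eq_psum => k _.
    have -> : coprime (p * k) D = coprime k D by rewrite coprimeMl prime_coprime// pD.
    by case: ifP => _; rewrite ?mulr0// natrM invfM.
  rewrite /HD -psumB; apply: eq_psum => m _.
  have -> : coprime m (p * D) = ~~ (p %| m)%N && coprime m D.
    by rewrite coprimeMr [coprime m p]coprime_sym prime_coprime.
  by case: (p %| m)%N; case: (coprime m D); rewrite /= ?subrr ?subr0.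
rewrite E !IH dsumpM// mulr_sumr -sumrN; congr (_ + _).
apply: eq_dsum => // d dn; have d0 := dvdn_gt0 D0 dn.
by rewrite mu_pM ?(ndvd_dvd dn)// divnMA natrM invfM; ring.
Qed.

Definition err u : R := harm R (Num.truncn u) - ln u - gam R.

Definition gp p : R := ln p%:R / (p%:R - 1).

(** The additive term arises from ln d in the harmonic sums up to u/d, by [dsum_conv_af] with local
    data -1/p and 1. *)
Lemma HD_approx D u : sqf D -> 0 < u -> HD D (Num.truncn u) =
  phi R D / D%:R * (ln u + gam R + af gp D)
  + \sum_(d <- divisors D) mu R d / d%:R * err (u / d%:R).
Proof.
move=> sD u0; have D0 := sqf_gt0 sD; rewrite HD_harm//.
pose a p : R := - p%:R^-1.
have muE' d : (d %| D)%N -> mu R d / d%:R = mf a d.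
  move=> /(sqf_dvdm sD)[sd _]; rewrite muE// natr_mf// -mfV -mf_mul.
  by apply: eq_mf => p _; rewrite mulN1r.
have -> : \sum_(d <- divisors D) mu R d / d%:R * harm R (Num.truncn u %/ d) =
   (ln u + gam R) * \sum_(d <- divisors D) mf a d
   - \sum_(d <- divisors D) mf a d * mf (fun=> 1) (D %/ d) * af (fun p => ln p%:R) d
   + \sum_(d <- divisors D) mu R d / d%:R * err (u / d%:R).
  rewrite mulr_sumr -sumrB -big_split /=; apply: eq_dsum => // d dD.
  have d0 := dvdn_gt0 D0 dD; have [sd _] := sqf_dvdm sD dD.
  rewrite -truncn_div ?ltW// muE'// /err ln_div ?posrE ?ltr0n//.
  rewrite -ln_af// [mf (fun=> 1) _]/mf [X in _ * X * _]big1 ?mulr1//; ring.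
congr (_ + _); rewrite dsum_mf// dsum_conv_af//; last first.
  by move=> p pp; rewrite /a addrC subr_eq0 eq_sym invr_eq1 -[1]/(1%:R) eqr_nat; case: p pp => [|[]].
have phD : mf (fun p => a p + 1) D = phi R D / D%:R.
  rewrite natr_mf// -mfV -mf_mul; apply: eq_mf => p pp; rewrite /a.
  by field; rewrite pnatr_eq0 -lt0n prime_gt0.
rewrite phD.
have -> : af (fun p => ln p%:R * a p / (a p + 1)) D = - af gp D.
  rewrite /af -sumrN -/(af _ D) -/(af (fun p => - gp p) D); apply: eq_af => p pp.
  have h1 := prime_m1_gt0 R pp; have h2 : 0 < p%:R :> R by lra.
  have -> : a p + 1 = (p%:R - 1) / p%:R by rewrite /a; field; rewrite gt_eqF.
  by rewrite /a /gp; field; rewrite !gt_eqF.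
ring.
Qed.

Definition Qs D n : R := psum (fun m => if chi D m then m%:R^-1 else 0) n.

(** The range [Y] may exceed [n] because the inner sum is empty once b^2 > n. [Ls_expand] uses this
    freedom to reach a cutoff that can tend to infinity. *)
Lemma Qs_HD D n Y : (n <= Y)%N -> Qs D n =
  psum (fun b => if coprime b D then mu R b / b%:R ^+ 2 * HD D (n %/ b ^ 2) else 0) Y.
Proof.
move=> nY; pose f m : R := if coprime m D then m%:R^-1 else 0.
transitivity (psum (fun b => mu R b * psum (fun m => if (b ^ 2 %| m)%N then f m else 0) n) Y).
  under eq_fun do rewrite -psumZ.
  rewrite exchange_psum; apply: eq_psum => m /andP[m0 mn].
  transitivity (f m * (sqf m)%:R).
    by rewrite /f /chi; case: (sqf m) => /=; [rewrite mulr1|rewrite mulr0].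
  rewrite -(@psum_mu_sq m Y) ?m0 ?(leq_trans mn)// -psumZ; apply: eq_psum => b _.
  by case: ifP => _; rewrite ?mulr0// mulrC.
apply: eq_psum => b /andP[b0 _].
rewrite psum_multiples ?expn_gt0 ?b0//.
case: ifP => cb.
  rewrite -mulrA; congr (_ * _); rewrite /HD -psumZ; apply: eq_psum => k _.
  have -> : f (b ^ 2 * k)%N = if coprime k D then (b ^ 2 * k)%:R^-1 else 0.
    by rewrite /f coprimeMl coprimeXl.
  by case: ifP => _; rewrite ?mulr0// natrM natrX invfM.
rewrite [psum _ _]big1 ?mulr0// => k _; rewrite /f coprimeMl coprime_pexpl//.
by rewrite cb.
Qed.

(* [Ls] is the sum of [mu(m)^2 / phi(m)] over [m <= n] coprime to [D]; it is obtained
   from the same sum of [mu(m)^2 / m], and that from the harmonic sum [HD]. *)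
Definition Ls D n : R := psum (fun m => if chi D m then (phi R m)^-1 else 0) n.

Lemma chiM D j b : sqf (j * b) -> chi D (j * b) = chi D j && chi (j * D) b.
Proof.
rewrite sqfM => /and3P[sj sb cjb]; rewrite /chi sqfM sj sb cjb coprimeMl coprimeMr.
by rewrite [coprime b j]coprime_sym cjb.
Qed.

(** Locally, 1/(p - 1) = 1/p + 1/(p (p - 1)). *)
Lemma Ls_Qs D n : Ls D n =
  psum (fun j => if chi D j then (j%:R * phi R j)^-1 * Qs (j * D) (n %/ j) else 0) n.
Proof.
pose G j m : R := if chi D j && chi (j * D) m then (j%:R * phi R j)^-1 * m%:R^-1 else 0.
transitivity (psum (fun j => psum (G j) (n %/ j)) n); last first.
  apply: eq_psum => j _; rewrite /G; case: (chi D j) => /=; last by rewrite /psum big1.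
  by rewrite /Qs -psumZ; apply: eq_psum => m _; case: ifP => _; rewrite ?mulr0.
rewrite -[RHS]/(\sum_(1 <= j < n.+1) \sum_(1 <= m < (n %/ j).+1) G j m).
rewrite -dsum_hyperbola; apply: eq_psum => e /andP[e0 _].
case: (boolP (sqf e)) => se; last first.
  rewrite /chi (negbTE se) /= big_seq big1// => j; rewrite -dvdn_divisors// => je.
  rewrite /G /chi; case: ifP => // /andP[/andP[sj _] /andP[sm cm]].
  case/negP: se; rewrite -(divnK je) sqfM sj sm /=.
  by move: cm; rewrite coprimeMr => /andP[].
transitivity (\sum_(j <- divisors e) if chi D e then (j%:R * phi R j)^-1 * (e %/ j)%:R^-1 else 0).
  case: ifP => _; last by rewrite big1.
  rewrite (@eq_dsum _ _ (fun j => mf (fun p => (p%:R * (p%:R - 1))^-1) j * mf (fun p => p%:R^-1) (e %/ j)))//.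
    rewrite dsum_conv// -mfV; apply: eq_mf => p pp.
    have h1 := prime_m1_gt0 R pp; have h2 : 0 < p%:R :> R by lra.
    by field; rewrite !gt_eqF.
  move=> j je; have [sj sm] := sqf_dvdm se je.
  by rewrite (natr_mf _ sj) (natr_mf _ sm) -mf_mul !mfV.
apply: eq_dsum => // j je.
by rewrite /G -{1}(divnK je) mulnC chiM// mulnC divnK.
Qed.

End LSum.

(** * The totient sum, uniformly in the modulus *)

Section LAsymp.
Variable R : realType.
Implicit Types (x y u v t c : R) (n m q d D j X Y : nat).

(** Here [m] is the variable of the squares in [Qs_HD]. The pairs are grouped by q = j m, although
    the harmonic sum depends on j m^2. *)
Definition Tm D n j m : R := if chi D j && coprime m (j * D)
  then (j%:R * phi R j)^-1 * (mu R m / m%:R ^+ 2 * HD R (j * D) (n %/ (j * m ^ 2))) else 0.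

Lemma Ls_expand D n X : (n <= X)%N ->
  Ls R D n = psum (fun q => \sum_(j <- divisors q) Tm D n j (q %/ j)) X.
Proof.
move=> nX; rewrite /psum dsum_hyperbola Ls_Qs (psum_widen _ nX); apply: eq_psum => j /andP[j0 jX].
transitivity (if chi D j then (j%:R * phi R j)^-1 * Qs R (j * D) (n %/ j) else 0).
  case: ifP => // /negbT; rewrite -ltnNge => nj.
  by rewrite divn_small// /Qs psum0 mulr0 if_same.
rewrite /Tm; case: (chi D j) => /=; last by rewrite big1.
rewrite (@Qs_HD _ _ _ (X %/ j)) ?leq_div2r// -psumZ; apply: eq_psum => m _.
by case: ifP => _; rewrite ?mulr0// divnMA.
Qed.

Lemma Tm_nchi D n q : (0 < q)%N -> ~~ chi D q -> \sum_(j <- divisors q) Tm D n j (q %/ j) = 0.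
Proof.
move=> q0 nq; rewrite big_seq big1// => j; rewrite -dvdn_divisors// => jq.
rewrite /Tm; case: ifP => // /andP[cj cb].
case: (boolP (sqf (q %/ j))) => sb; last by rewrite mu_nsqf// !mul0r mulr0.
have sq : sqf q.
  rewrite -(divnK jq) sqfM sb; case/andP: cj => -> _ /=.
  by move: cb; rewrite coprimeMr => /andP[].
by case/negP: nq; rewrite -(divnK jq) mulnC chiM ?cj /chi ?sb ?cb// mulnC divnK.
Qed.

Definition hp p : R := ln p%:R + gp R p.

Definition Er x D j m : R := (j%:R * phi R j)^-1 *
  \sum_(d <- divisors (j * D)) d%:R^-1 * ((m%:R ^+ 2)^-1 * `|err (x / (j * d)%:R / m%:R ^+ 2)|).

(** For fixed [q] the main terms of [HD_approx] are (A - h(m)) mu(m) with m = q/j, where A depends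
    on [q] alone and h is additive. Summing over m | q, [dsum_mu] keeps A only at q = 1 and
    [dsum_mu_af] keeps h only at primes. *)
Lemma Tm_main D x q : sqf D -> 0 < x -> chi D q ->
  `| \sum_(j <- divisors q) Tm D (Num.truncn x) j (q %/ j)
   - phi R D / D%:R / q%:R ^+ 2 *
     ((q == 1%N)%:R * (ln x + gam R + af (gp R) D) + if prime q then hp q else 0) | <=
  \sum_(j <- divisors q) Er x D j (q %/ j).
Proof.
move=> sD x0 cq; have /andP[sq cqD] := cq; have q0 := sqf_gt0 sq; have D0 := sqf_gt0 sD.
pose A := ln x + gam R + af (gp R) D + af (gp R) q - ln q%:R.
have E1 : phi R D / D%:R / q%:R ^+ 2 *
     ((q == 1%N)%:R * (ln x + gam R + af (gp R) D) + if prime q then hp q else 0) =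
   \sum_(j <- divisors q) phi R D / D%:R / q%:R ^+ 2 * (mu R (q %/ j) * (A - af hp (q %/ j))).
  rewrite -mulr_sumr; congr (_ * _).
  rewrite -(dsum_rev (fun m => mu R m * (A - af hp m)))//.
  under eq_bigr do rewrite mulrBr; rewrite sumrB -mulr_suml dsum_mu// dsum_mu_af//.
  rewrite /A; congr (_ + _); last by case: ifP; rewrite ?opprK ?oppr0.
  by case: eqP => [->|_]; rewrite ?mul0r// af1 ln1 addr0 subr0.
rewrite E1 -sumrB; apply: le_trans (ler_norm_sum _ _ _) _.
rewrite big_seq [leRHS]big_seq; apply: ler_sum => j; rewrite -dvdn_divisors// => jq.
set m := (q %/ j)%N.
have qE : q = (j * m)%N by rewrite /m mulnC divnK.
have := cq; rewrite {1}qE chiM -?qE// => /andP[cj cm].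
have /andP[sj cjD] := cj; have /andP[sm cmjD] := cm.
have j0 := sqf_gt0 sj; have m0 := sqf_gt0 sm.
have cjm : coprime m j by move: cmjD; rewrite coprimeMr => /andP[].
have sjD : sqf (j * D) by rewrite sqfM sj sD cjD.
rewrite /Tm cj cmjD /=.
have jm0 : (0 < j * m ^ 2)%N by rewrite muln_gt0 j0 expn_gt0 m0.
rewrite -(truncn_div (ltW x0) jm0) HD_approx//; last by rewrite divr_gt0 ?ltr0n.
have jr : 0 < j%:R :> R by rewrite ltr0n.
have mr : 0 < m%:R :> R by rewrite ltr0n.
have Dr : 0 < D%:R :> R by rewrite ltr0n.
have pj := phi_gt0 R j.
have -> : phi R (j * D) = phi R j * phi R D by rewrite /phi mfM.
have -> : ln (x / (j * m ^ 2)%:R) + gam R + af (gp R) (j * D) = A - af hp m.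
  rewrite ln_div ?posrE ?ltr0n// natrM natrX lnM ?posrE ?exprn_gt0// lnXn//.
  rewrite /A /hp qE natrM lnM ?posrE// !afM//; last by rewrite coprime_sym.
  have -> : af (fun p => ln p%:R + gp R p) m = ln m%:R + af (gp R) m.
    by rewrite ln_af// /af -big_split.
  rewrite mulr2n; ring.
rewrite mulrDr mulrDr.
have -> : (j%:R * phi R j)^-1 * (mu R m / m%:R ^+ 2 * (phi R j * phi R D / (j * D)%:R * (A - af hp m))) =
   phi R D / D%:R / q%:R ^+ 2 * (mu R m * (A - af hp m)).
  by rewrite qE !natrM; field; rewrite !gt_eqF.
rewrite addrAC subrr add0r /Er normrM.
have j1 : 0 <= (j%:R * phi R j)^-1 by rewrite invr_ge0 mulr_ge0// ltW.
rewrite ger0_norm//; apply: ler_wpM2l => //.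
rewrite normrM normrM [`|_^-1|]ger0_norm ?invr_ge0 ?sqr_ge0//.
apply: le_trans (_ : _ <= (m%:R ^+ 2)^-1 * \sum_(d <- divisors (j * D)) d%:R^-1 *
   `|err (x / (j * d)%:R / m%:R ^+ 2)|) _; last first.
  rewrite mulr_sumr; apply: ler_sum => d _; by rewrite mulrCA.
apply: ler_pM => //.
  by rewrite ler_piMl ?invr_ge0 ?sqr_ge0// mu_norm.
apply: le_trans (ler_norm_sum _ _ _) _.
rewrite big_seq [leRHS]big_seq; apply: ler_sum => d; rewrite -dvdn_divisors ?muln_gt0 ?j0// => dD.
have d0 : (0 < d)%N by rewrite (dvdn_gt0 _ dD)// muln_gt0 j0.
rewrite !normrM [`|_^-1|]ger0_norm ?invr_ge0//.
have -> : x / (j * m ^ 2)%:R / d%:R = x / (j * d)%:R / m%:R ^+ 2.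
  have dr : 0 < d%:R :> R by rewrite ltr0n.
  by rewrite natrM natrX natrM; field; rewrite !gt_eqF.
by apply: ler_wpM2r => //; rewrite ler_piMl ?invr_ge0// mu_norm.
Qed.

Lemma Er_ge0 x D j m : 0 <= Er x D j m.
Proof.
rewrite /Er mulr_ge0 ?invr_ge0 ?mulr_ge0 ?(ltW (phi_gt0 R j))//.
by apply: sumr_ge0 => d _; rewrite !mulr_ge0// ?invr_ge0// sqr_ge0.
Qed.

Lemma psum_z X : psum (z R) X <= 5.
Proof.
have z1 : zdom (z R) 1 by move=> i _; rewrite ger0_norm ?z_ge0// mul1r.
have := zdom_psum X z1; rewrite mulr1; apply: le_trans.
by apply: ler_psum => i _; exact: ler_norm.
Qed.

(** For fixed j and d, [sum_min_bound] at x/(j d) bounds the sum over m by a multiple of (j d /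
    x)^(1/2). The sum over d | j D then produces [Pf], and the sum over j converges by
    [phi_bound]. *)
Lemma Er_sum : exists2 C : R, 0 <= C & forall D x X, sqf D -> 0 < x ->
  psum (fun q => if chi D q then \sum_(j <- divisors q) Er x D j (q %/ j) else 0) X
  <= C * Pf R D / Num.sqrt x.
Proof.
have [C1 hC1] := harm_err R.
have C10 : 0 <= C1.
  by have [h _] := hC1 1 ltr01; rewrite divr1 in h; exact: le_trans h.
have [C2 C20 hC2] := phi_bound R 1 1 0.
exists (30 * C1 * C2) => [|D x X sD x0]; first by rewrite !mulr_ge0.
have sx : 0 < Num.sqrt x by rewrite sqrtr_gt0.
pose G j m : R := if chi D j then Er x D j m else 0.
apply: le_trans (_ : _ <= psum (fun q => \sum_(j <- divisors q) G j (q %/ j)%N) X) _.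
  apply: ler_psum => q /andP[q0 _]; case: ifP => cq; last first.
    by apply: sumr_ge0 => j _; rewrite /G; case: ifP => // _; exact: Er_ge0.
  rewrite big_seq [leRHS]big_seq; apply: ler_sum => j; rewrite -dvdn_divisors// => jq.
  rewrite /G; suff -> : chi D j by [].
  have /andP[sq cqD] := cq; rewrite /chi (sqf_dvd jq sq) /=.
  exact: coprime_dvdl jq cqD.
rewrite /psum dsum_hyperbola -/(psum _ X).
apply: le_trans (_ : _ <= psum (fun j => 6 * C1 * Pf R D / Num.sqrt x * (C2 * z R j)) X) _; last first.
  rewrite psumZ psumZ.
  have hz := psum_z X.
  rewrite [leRHS](_ : _ = 6 * C1 * Pf R D / Num.sqrt x * (C2 * 5)); last by ring.
  apply: ler_wpM2l; last exact: ler_wpM2l.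
  by rewrite divr_ge0 ?(ltW sx)// !mulr_ge0// (le_trans ler01)// Pf_ge1.
apply: ler_psum => j /andP[j0 _].
have rhs0 : 0 <= 6 * C1 * Pf R D / Num.sqrt x * (C2 * z R j).
  by rewrite !mulr_ge0 ?z_ge0 ?invr_ge0 ?(ltW sx)// (le_trans ler01)// Pf_ge1.
rewrite -/(psum (G j) (X %/ j)) /G; case: (boolP (chi D j)) => cj; last by rewrite /psum big1.
have /andP[sj cjD] := cj; have D0 := sqf_gt0 sD.
have sjD : sqf (j * D) by rewrite sqfM sj sD cjD.
have jr : 0 < j%:R :> R by rewrite ltr0n.
have pj := phi_gt0 R j.
have jD0 : (0 < j * D)%N by rewrite muln_gt0 j0.
rewrite /Er psumZ /psum exchange_big /=.
apply: le_trans (_ : _ <= (j%:R * phi R j)^-1 * \sum_(d <- divisors (j * D))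
   (6 * C1 / Num.sqrt x * Num.sqrt j%:R) * (Num.sqrt d%:R)^-1) _.
  apply: ler_wpM2l; first by rewrite invr_ge0 mulr_ge0// ltW.
  rewrite big_seq [leRHS]big_seq; apply: ler_sum => d; rewrite -dvdn_divisors// => dD.
  have d0 := dvdn_gt0 jD0 dD; have dr : 0 < d%:R :> R by rewrite ltr0n.
  have Y0 : 0 < x / (j * d)%:R by rewrite divr_gt0// ltr0n muln_gt0 j0.
  rewrite -mulr_sumr.
  have := @sum_min_bound R (x / (j * d)%:R) (X %/ j) (fun u => `|err u|) C1 Y0 hC1 C10.
  move=> /(ler_wpM2l (_ : 0 <= d%:R^-1)) /le_trans; apply; first by rewrite invr_ge0.
  have sd : 0 < Num.sqrt d%:R :> R by rewrite sqrtr_gt0.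
  have sjr : 0 < Num.sqrt j%:R :> R by rewrite sqrtr_gt0.
  rewrite natrM sqrtrM ?(ltW x0)// sqrtrV ?mulr_ge0// sqrtrM//.
  apply: eq_ler.
  transitivity ((Num.sqrt d%:R ^+ 2)^-1 * (6 * C1 / (Num.sqrt x / (Num.sqrt j%:R * Num.sqrt d%:R)))).
    by rewrite sqr_sqrtr.
  by field; rewrite !gt_eqF.
rewrite -mulr_sumr dsum_inv_sqrt// /Pf mfM// -/(Pf R j) -/(Pf R D).
have := hC2 j sj; rewrite !expr1 expr0 mulr1 => h.
rewrite -(sqrt_z R j0) [leRHS](_ : _ = 6 * C1 * Pf R D / Num.sqrt x * ((j%:R * Num.sqrt j%:R)^-1 * (C2 * r4 j%:R))); last by ring.
have sjr : 0 < Num.sqrt j%:R :> R by rewrite sqrtr_gt0.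
rewrite [leLHS](_ : _ = 6 * C1 * Pf R D / Num.sqrt x * ((j%:R * Num.sqrt j%:R)^-1 * (j%:R / phi R j * Pf R j))).
  apply: ler_wpM2l; first by rewrite !mulr_ge0 ?invr_ge0 ?(ltW sx)// (le_trans ler01)// Pf_ge1.
  by apply: ler_wpM2l => //; rewrite invr_ge0 mulr_ge0// ltW.
have jj : j%:R = Num.sqrt j%:R ^+ 2 :> R by rewrite sqr_sqrtr.
transitivity (6 * C1 * Pf R D / Num.sqrt x * (Pf R j / phi R j * (Num.sqrt j%:R / j%:R))).
  by field; rewrite !gt_eqF.
transitivity (6 * C1 * Pf R D / Num.sqrt x * (Pf R j / phi R j * (Num.sqrt j%:R)^-1)); last first.
  by field; rewrite !gt_eqF.
have -> // : Num.sqrt j%:R / j%:R = (Num.sqrt j%:R)^-1 :> R.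
by transitivity (Num.sqrt j%:R / Num.sqrt j%:R ^+ 2 : R); [rewrite sqr_sqrtr|field; rewrite gt_eqF].
Qed.

Definition lam p : R := ln p%:R * (p%:R * (p%:R - 1))^-1.
Definition lamS p : R := if prime p then lam p else 0.

Lemma Ls_approx0 : exists2 C : R, 0 <= C & forall D x X, sqf D -> 0 < x ->
  (Num.truncn x <= X)%N -> (0 < X)%N ->
  `|Ls R D (Num.truncn x) - phi R D / D%:R * (ln x + gam R + af (gp R) D
    + psum (fun p => if prime p && coprime p D then lam p else 0) X)|
  <= C * Pf R D / Num.sqrt x.
Proof.
have [C C0 hC] := Er_sum; exists C => // D x X sD x0 nX X0.
apply: le_trans (hC D x X sD x0).
rewrite (Ls_expand _ nX).
pose B := phi R D / D%:R; pose A := ln x + gam R + af (gp R) D.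
have -> : phi R D / D%:R * (ln x + gam R + af (gp R) D
    + psum (fun p => if prime p && coprime p D then lam p else 0) X) =
  psum (fun q => if chi D q then B / q%:R ^+ 2 * ((q == 1%N)%:R * A + if prime q then hp q else 0) else 0) X.
  rewrite mulrDr -/B -/A -psumZ.
  have -> : B * A = psum (fun q => (q == 1%N)%:R * (B * A)) X.
    by rewrite psumZr psum_delta1// mul1r.
  rewrite -psumD; apply: eq_psum => q /andP[q0 _].
  case: (eqVneq q 1%N) => [->|q1].
    by rewrite /chi /coprime gcd1n sqf1 /= expr1n divr1 mulr0 !addr0 !mul1r.
  have -> : false%:R = 0 :> R by [].
  rewrite !mul0r !add0r; case: (boolP (prime q)) => pq /=; last by rewrite !mulr0 if_same.
  rewrite /chi sqf_prime//=; case: ifP => _; last by rewrite mulr0.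
  have h1 := prime_m1_gt0 R pq; have h2 : 0 < q%:R :> R by lra.
  by rewrite /lam /hp /gp; field; rewrite !gt_eqF.
rewrite -psumB; apply: le_trans (ler_norm_psum _ _) _; apply: ler_psum => q /andP[q0 _].
case: ifP => cq; last by rewrite Tm_nchi ?cq// subrr normr0.
exact: Tm_main.
Qed.

Lemma lam_bound p : prime p -> 0 <= (p%:R * (p%:R - 1) : R)^-1 <= 2 / p%:R ^+ 2.
Proof.
move=> pp; have h1 := prime_m1_gt0 R pp; have h2 : 0 < p%:R :> R by lra.
rewrite invr_ge0 mulr_ge0 ?(ltW h1) ?(ltW h2)//=.
have := inv_m1_le R pp; rewrite ler_pdivrMr// => h.
rewrite ler_pdivlMr ?exprn_gt0// mulrC ler_pdivrMr ?mulr_gt0// expr2; nra.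
Qed.

Lemma lamS_zdom : zdom lamS 8.
Proof.
have := @lnp_zdom R (fun p => (p%:R * (p%:R - 1))^-1) 2 (ler0n _ 2) (fun p pp => lam_bound pp).
by have -> : 4 * 2 = 8 :> R by ring.
Qed.

Definition Lam : R := tot lamS.
(** The constant term of the sum of mu(m)^2/phi(m) over m <= x. *)
Definition c1 : R := gam R + Lam.
Definition lq p : R := ln p%:R / p%:R.

Lemma psum_primes_dvd (f : nat -> R) D X : (0 < D)%N -> (D <= X)%N ->
  psum (fun p => if prime p && (p %| D)%N then f p else 0) X = af f D.
Proof.
move=> D0 DX; rewrite /psum -big_mkcond -big_filter; apply: perm_big; apply: uniq_perm.
- by rewrite filter_uniq// iota_uniq.
- exact: primes_uniq.
move=> p; rewrite mem_filter mem_index_iota mem_primes D0 /=.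
case: (boolP (prime p)) => //= pp; case: (boolP (p %| D)%N) => //= pD.
by rewrite prime_gt0// ltnS (leq_trans (dvdn_leq D0 pD)).
Qed.

Lemma phi_le n : sqf n -> phi R n / n%:R <= 1.
Proof.
move=> sn; rewrite natr_mf// ler_pdivrMr ?mul1r.
  by apply: ler_mf => p pp; rewrite ltW ?prime_m1_gt0//= gerBl.
by apply: mf_gt0 => p pp; rewrite ltr0n prime_gt0.
Qed.

(** The cutoff [X] of [Ls_approx0] goes to infinity: the prime sum becomes [Lam] less its part at
    the primes of [D], and subtracting that part turns [gp] into [lq]. *)
Lemma Ls_approx : exists2 C : R, 0 <= C & forall D x, sqf D -> 0 < x ->
  `|Ls R D (Num.truncn x) - phi R D / D%:R * (ln x + c1 + af lq D)|
  <= C * Pf R D / Num.sqrt x.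
Proof.
have [C C0 hC] := Ls_approx0; exists C => // D x sD x0.
have D0 := sqf_gt0 sD.
have B0 : 0 <= phi R D / D%:R by rewrite divr_ge0// ltW// phi_gt0.
have B1 := phi_le sD.
apply: (@le_r4 _ _ _ 32 (maxn (maxn (Num.truncn x) D) 1)) => X.
rewrite !geq_max => /andP[/andP[nX DX] X0].
have h := hC D x X sD x0 nX X0.
have E : psum (fun p => if prime p && coprime p D then lam p else 0) X = psum lamS X - af lam D.
  rewrite -(psum_primes_dvd lam D0 DX) -psumB; apply: eq_psum => p _; rewrite /lamS.
  case: (boolP (prime p)) => //= pp; last by rewrite subr0.
  by rewrite prime_coprime//; case: (p %| D)%N; rewrite /= ?subrr ?subr0.
have t := tot_tail lamS_zdom X0; rewrite -/Lam in t.
have E2 : af (gp R) D - af lam D = af lq D.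
  rewrite /af -sumrB -/(af lq D) -/(af (fun p => gp R p - lam p) D); apply: eq_af => p pp.
  have h1 := prime_m1_gt0 R pp; have h2 : 0 < p%:R :> R by lra.
  by rewrite /gp /lam /lq; field; rewrite !gt_eqF.
rewrite E in h.
set L := Ls R D _ in h *; set B := phi R D / D%:R in B0 B1 h *.
have -> : L - B * (ln x + c1 + af lq D) =
   (L - B * (ln x + gam R + af (gp R) D + (psum lamS X - af lam D))) + B * (psum lamS X - Lam).
  by rewrite -E2 /c1; ring.
apply: le_trans (ler_normD _ _) _; apply: lerD => //.
rewrite normrM ger0_norm//; apply: le_trans (_ : _ <= 1 * `|psum lamS X - Lam|) _.
  exact: ler_wpM2r.
by rewrite mul1r; apply: le_trans t _; rewrite (_ : 4 * 8 = 32 :> R)//; ring.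
Qed.

End LAsymp.

(** * The singular series as a divisor sum *)

Section SingularSeries.
Variable R : realType.
Implicit Types (x y u v t c : R) (n m q d D e j X Y f : nat).

(* On squarefree [n], [w n] is the weight [mu(n)^2 / phi(n)^2] of the singular series,
   and [Mf e] is the sum of [mu f * w f] over [f] coprime to [e]. *)
Definition w n : R := (phi R n ^+ 2)^-1.
Definition wmu e f : R := if chi e f then mu R f * w f else 0.
Definition Mf e : R := tot (wmu e).

Lemma w_gt0 n : 0 < w n. Proof. by rewrite invr_gt0 exprn_gt0// phi_gt0. Qed.

Lemma wM m n : (0 < m)%N -> (0 < n)%N -> coprime m n -> w (m * n) = w m * w n.
Proof. by move=> *; rewrite /w /phi mfM// exprMn invfM. Qed.

Lemma w_bound : exists2 C : R, 0 <= C & forall n, sqf n -> w n <= C * r4 n%:R / n%:R ^+ 2.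
Proof.
have [C C0 hC] := phi_bound R 2 0 0; exists C => // n sn.
have nr : 0 < n%:R :> R by rewrite ltr0n sqf_gt0.
have := hC n sn; rewrite !expr0 !mulr1 => h.
rewrite ler_pdivlMr ?exprn_gt0//; apply: le_trans h.
by apply: eq_ler; rewrite /w exprMn exprVn mulrC.
Qed.

Lemma r4_sq_le n : (0 < n)%N -> r4 n%:R / n%:R ^+ 2 <= z R n.
Proof.
move=> n0; have nr : 0 < n%:R :> R by rewrite ltr0n.
have r0 : 0 < r4 n%:R :> R by apply: r4_gt0.
rewrite /z ler_pdivrMr ?exprn_gt0// mulrC ler_pdivlMr ?mulr_gt0//.
rewrite mulrCA -expr2 r4X2 expr2; apply: ler_wpM2l => //.
have s1 : 1 <= Num.sqrt n%:R :> R by rewrite sqrt_ge1// ler1n.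
rewrite -[leRHS](@sqr_sqrtr R n%:R)// expr2; nra.
Qed.

Lemma w_zdom : exists2 C : R, 0 <= C & forall e, zdom (wmu e) C.
Proof.
have [C C0 hC] := w_bound; exists C => // e n n0; rewrite /wmu.
case: ifP => [/andP[sn _]|_]; last by rewrite normr0 mulr_ge0 ?z_ge0.
rewrite normrM (ger0_norm (ltW (w_gt0 n))).
apply: le_trans (_ : _ <= 1 * w n) _.
  by apply: ler_wpM2r; [exact: ltW (w_gt0 n)|exact: mu_norm].
rewrite mul1r; apply: le_trans (hC n sn) _; rewrite -mulrA; apply: ler_wpM2l => //.
exact: r4_sq_le.
Qed.

Lemma r4_divn X d : (0 < d)%N -> (d <= X)%N ->
  (r4 (X %/ d)%:R)^-1 <= r4 (2 * d)%:R / r4 X%:R :> R.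
Proof.
move=> d0 dX; have Xd0 : (0 < X %/ d)%N by rewrite divn_gt0.
have X0 : (0 < X)%N by apply: leq_trans dX.
rewrite ler_pdivlMr ?r4_gt0 ?ltr0n// mulrC ler_pdivrMr; last by rewrite r4_gt0// ltr0n.
rewrite -r4M// -natrM; apply: ler_r4; rewrite ler_nat.
rewrite -mulnA {1}(divn_eq X d) mul2n -addnn mulnC leq_add2l.
by apply: leq_trans (ltnW (ltn_pmod X d0)) _; rewrite leq_pmulr.
Qed.

Lemma tot_tail_div (a : nat -> R) (C : R) d X : zdom a C -> (0 < d)%N -> (d <= X)%N ->
  `|psum a (X %/ d) - tot a| <= 4 * C * r4 (2 * d)%:R / r4 X%:R.
Proof.
move=> aC d0 dX; have Xd0 : (0 < X %/ d)%N by rewrite divn_gt0.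
apply: le_trans (tot_tail aC Xd0) _.
rewrite [leRHS](_ : _ = 4 * C * (r4 (2 * d)%:R / r4 X%:R)); last by ring.
apply: ler_wpM2l; last exact: r4_divn.
rewrite mulr_ge0//; have := aC 1%N isT; rewrite /z mul1r r41 invr1 mulr1; exact: le_trans.
Qed.

(** The integers f coprime to [e] split by divisibility by [p]; those of the form p f' contribute -
    w(p) times the sum over f' coprime to [p * e]. *)
Lemma Mf_prime e p : prime p -> ~~ (p %| e)%N -> Mf e = (1 - w p) * Mf (p * e).
Proof.
move=> pp pe; have p0 := prime_gt0 pp.
have [C C0 hC] := w_zdom.
have wp0 := w_gt0 p.
apply: (@tot_lim R _ _ (4 * C + w p * (4 * C * r4 (2 * p)%:R)) p.+1).
move=> X pX; have X0 : (0 < X)%N by apply: leq_trans pX.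
have -> : psum (wmu e) X = psum (wmu (p * e)) X - w p * psum (wmu (p * e)) (X %/ p).
  have -> : w p * psum (wmu (p * e)) (X %/ p) =
      psum (fun f => if (p %| f)%N then - wmu e f else 0) X.
    rewrite psum_multiples// -psumZ; apply: eq_psum => f /andP[f0 _].
    rewrite /wmu /chi sqfM (sqf_prime pp) andTb coprimeMl coprimeMr [coprime p e](@prime_coprime p _ pp) pe andTb.
    rewrite [coprime f p]coprime_sym.
    case: (boolP (sqf f)) => sf /=; last by rewrite mulr0 oppr0.
    case: (boolP (coprime p f)) => cpf /=; last by rewrite mulr0 oppr0.
    case: ifP => _; last by rewrite mulr0 oppr0.
    have npf : ~~ (p %| f)%N by rewrite -(@prime_coprime p _ pp).
    by rewrite mu_pM// wM//; ring.
  rewrite -psumB; apply: eq_psum => f _; rewrite /wmu /chi coprimeMr.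
  rewrite [coprime f p]coprime_sym (@prime_coprime p _ pp).
  case: (boolP (p %| f)%N) => pf /=; last by rewrite subr0.
  by rewrite andbF sub0r opprK.
have t1 := tot_tail (hC (p * e)%N) X0; rewrite -/(Mf (p * e)) in t1.
have t2 := tot_tail_div (hC (p * e)%N) p0 (ltnW pX); rewrite -/(Mf (p * e)) in t2.
have -> : psum (wmu (p * e)) X - w p * psum (wmu (p * e)) (X %/ p) - (1 - w p) * Mf (p * e) =
  (psum (wmu (p * e)) X - Mf (p * e)) - w p * (psum (wmu (p * e)) (X %/ p) - Mf (p * e)) by ring.
apply: le_trans (ler_normB _ _) _; rewrite mulrDl; apply: lerD => //.
rewrite normrM (ger0_norm (ltW wp0)) -[leRHS]mulrA; apply: ler_wpM2l => //; exact: ltW.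
Qed.

(* [sing k] is the full singular series (see [sing_le_lim] and [psum_cq]), written as
   a divisor sum; [sing_coef d] are the divisor coefficients of [k |-> sing (d * k)]. *)
Definition sing_coef d e : R := if chi d e then d%:R / phi R d * (e%:R * w e * Mf (d * e)) else 0.
Definition sing k : R := \sum_(e <- divisors k) sing_coef 1 e.

Lemma dsum_psum (F : nat -> R) n X : (0 < n)%N -> (n <= X)%N ->
  \sum_(e <- divisors n) F e = psum (fun e => if (e %| n)%N then F e else 0) X.
Proof.
move=> n0 nX; rewrite /psum -big_mkcond -[RHS]big_filter; apply: perm_big; apply: uniq_perm.
- exact: divisors_uniq.
- by rewrite filter_uniq// iota_uniq.
move=> d; rewrite mem_filter mem_index_iota -dvdn_divisors//.
case: (boolP (d %| n)%N) => //= dn.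
by rewrite (dvdn_gt0 n0 dn) ltnS (leq_trans (dvdn_leq n0 dn)).
Qed.

(** A squarefree divisor of [p * k] is [e] or [p * e] with [p] not dividing [e], and in both cases
    [e] divides [k], whether or not [p] does. *)
Lemma dsum_sqf_pM (F : nat -> R) p k : prime p -> (0 < k)%N ->
  (forall e, ~~ sqf e -> F e = 0) ->
  \sum_(e <- divisors (p * k)) F e =
  \sum_(e <- divisors k) (if (p %| e)%N then 0 else F e + F (p * e)%N).
Proof.
move=> pp k0 F0; have p0 := prime_gt0 pp; have pk0 : (0 < p * k)%N by rewrite muln_gt0 p0.
have kX : (k <= p * k)%N by rewrite leq_pmull.
rewrite (dsum_psum _ pk0 (leqnn _)) (dsum_psum _ k0 kX).
have -> : psum (fun e => if (e %| p * k)%N then F e else 0) (p * k) =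
   psum (fun e => if (p %| e)%N then (if (e %| p * k)%N then F e else 0) else 0) (p * k) +
   psum (fun e => if (p %| e)%N then 0 else (if (e %| p * k)%N then F e else 0)) (p * k).
  by rewrite -psumD; apply: eq_psum => e _; case: (p %| e)%N; rewrite ?addr0 ?add0r.
rewrite psum_multiples// mulKn// (psum_widen _ kX) -psumD; apply: eq_psum => e /andP[e0 eX].
case: (boolP (p %| e)%N) => pe.
  rewrite addr0 if_same; case: ifP => // _; case: ifP => // _; apply: F0.
  rewrite sqfM prime_coprime// pe /= !andbF//.
have -> : (e %| p * k)%N = (e %| k)%N by rewrite Gauss_dvdr// coprime_sym prime_coprime.
rewrite dvdn_pmul2l//; case: (boolP (e %| k)%N) => ek; last by rewrite if_same add0r.
by rewrite dvdn_leq// addrC.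
Qed.

(** When a prime is adjoined to [d], the coefficients at [e] and [p * e] merge. By [Mf_prime] this
    is the local identity (1 - w(p)) + p w(p) = p/(p - 1). *)
Lemma sing_mul d : sqf d -> forall k, (0 < k)%N -> sing (d * k) = \sum_(e <- divisors k) sing_coef d e.
Proof.
move: d; apply: sqf_ind => [|p d pp pd sd IH] k k0; first by rewrite mul1n.
have p0 := prime_gt0 pp; have d0 := sqf_gt0 sd.
rewrite [(p * d)%N]mulnC -mulnA IH ?muln_gt0 ?p0// dsum_sqf_pM//; last first.
  by move=> e se; rewrite /sing_coef /chi (negbTE se).
apply: eq_dsum => // e ek; have e0 := dvdn_gt0 k0 ek.
rewrite /sing_coef /chi sqfM (sqf_prime pp) andTb [coprime p e](@prime_coprime p _ pp) coprimeMl coprimeMr [coprime p d](@prime_coprime p _ pp) pd andTb.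
rewrite [coprime e p]coprime_sym (@prime_coprime p _ pp).
case: (boolP (p %| e)%N) => pe /=; first by rewrite !andbF.
case: (boolP (sqf e)) => se /=; last by rewrite addr0.
rewrite andbT; case: (boolP (coprime e d)) => ced; last by rewrite addr0.
have cpe : coprime p e by rewrite prime_coprime.
have pde : ~~ (p %| d * e)%N by rewrite Euclid_dvdM// negb_or pd.
rewrite (Mf_prime pp pde) wM// natrM.
have -> : (d * (p * e) = p * (d * e))%N by rewrite mulnCA.
have -> : (d * p * e = p * (d * e))%N by rewrite [(d * p)%N]mulnC mulnA.
have -> : phi R (d * p) = (p%:R - 1) * phi R d by rewrite mulnC /phi mfpM.
rewrite natrM.
have -> : w p = ((p%:R - 1) ^+ 2)^-1 by rewrite /w /phi mfp.
have h1 := prime_m1_gt0 R pp; have h2 := phi_gt0 R d.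
by field; rewrite !gt_eqF.
Qed.

(* The mean value of [k |-> sing (d * k)] is [d / phi d]. *)
Lemma sing_coef_mean : exists2 C : R, 0 <= C & forall d X, sqf d -> (0 < X)%N ->
  `|psum (fun e => sing_coef d e / e%:R) X - d%:R / phi R d| <= d%:R / phi R d * C / r4 X%:R.
Proof.
have [C1 C10 hC1] := w_zdom; have [C2 C20 hC2] := w_bound.
exists (40 * C1 * C2) => [|d X sd X0]; first by rewrite !mulr_ge0.
have d0 := sqf_gt0 sd.
have B0 : 0 <= d%:R / phi R d by rewrite divr_ge0// ltW// phi_gt0.
have E1 : psum (fun e => sing_coef d e / e%:R) X =
    d%:R / phi R d * psum (fun e => if chi d e then w e * Mf (d * e) else 0) X.
  rewrite -psumZ; apply: eq_psum => e /andP[e0 _]; rewrite /sing_coef.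
  case: ifP => _; last by rewrite mul0r mulr0.
  by have h := phi_gt0 R d; field; rewrite gt_eqF//= pnatr_eq0 -lt0n.
(* With [Mf] replaced by its partial sums the mean is exactly 1: grouping by q = e f gives w(q)
   times the sum of mu over the divisors of q. Only the tails of [Mf] remain to be bounded. *)
have E2 : 1 = psum (fun e => if chi d e then w e * psum (wmu (d * e)) (X %/ e) else 0) X.
  rewrite -(psum_delta1 R X0).
  pose G j f : R := if chi d j then w j * wmu (d * j) f else 0.
  transitivity (psum (fun e => psum (G e) (X %/ e)) X); last first.
    apply: eq_psum => e _; rewrite /G; case: ifP => _; [exact: psumZ|by rewrite /psum big1].
  rewrite -[RHS]/(\sum_(1 <= j < X.+1) \sum_(1 <= m < (X %/ j).+1) G j m) -dsum_hyperbola.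
  apply: eq_psum => q /andP[q0 _].
  transitivity (\sum_(j <- divisors q) (if chi d q then w q * mu R (q %/ j) else 0)).
    case: (boolP (chi d q)) => cq.
      rewrite -mulr_sumr -(dsum_rev (fun m => mu R m))//; case/andP: cq => sq _.
      rewrite dsum_mu//; case: eqP => [->|]; rewrite ?mulr0//.
      by rewrite /w /phi mf1 expr1n invr1 mulr1.
    rewrite big1//; case: eqP cq => // ->.
    by rewrite /chi /coprime gcd1n.
  apply: eq_dsum => // j jq; rewrite /G /wmu.
  set m := (q %/ j)%N; have qE : q = (j * m)%N by rewrite /m mulnC divnK.
  case: (boolP (sqf q)) => sq.
    have := sq; rewrite {1}qE sqfM => /and3P[sj sm cjm].
    have -> : chi d q = chi d j && chi (d * j) m by rewrite {1}qE chiM -?qE// [(d * j)%N]mulnC.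
    case: (chi d j) => //=; case: ifP => _; last by rewrite mulr0.
    by rewrite {1}qE wM ?sqf_gt0//; ring.
  rewrite /chi (negbTE sq) /=; case: ifP => // /andP[sj cj].
  case: ifP => [/andP[sm cm]|_]; last by rewrite mulr0.
  case/negP: sq; rewrite qE sqfM sj sm /= coprime_sym.
  by move: cm; rewrite coprimeMr => /andP[].
rewrite E1; set B := d%:R / phi R d in B0 *; set P := psum _ X.
have -> : B * P - B = B * (P - 1) by ring.
rewrite [X in _ * (_ - X)]E2 normrM (ger0_norm B0) -[leRHS]mulrA /P.
apply: ler_wpM2l => //; rewrite -psumB.
apply: le_trans (ler_norm_psum _ _) _.
apply: le_trans (_ : _ <= psum (fun e => 8 * C1 * C2 / r4 X%:R * z R e) X) _; last first.
  rewrite psumZ; have := psum_z R X => hz.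
  rewrite [leRHS](_ : _ = 8 * C1 * C2 / r4 X%:R * 5); last by ring.
  by apply: ler_wpM2l => //; rewrite !mulr_ge0// invr_ge0 r4_ge0.
apply: ler_psum => e /andP[e0 eX].
case: ifP => ce; last first.
  rewrite subr0 normr0; apply: mulr_ge0; last exact: z_ge0.
  by apply: divr_ge0; [do !apply: mulr_ge0|exact: r4_ge0].
have /andP[se _] := ce.
rewrite -mulrBr normrM (ger0_norm (ltW (w_gt0 e))) distrC.
have t := tot_tail_div (hC1 (d * e)%N) e0 eX.
have er : 0 < e%:R :> R by rewrite ltr0n.
apply: le_trans (ler_pM (ltW (w_gt0 e)) (normr_ge0 _) (hC2 e se) t) _.
have r0 : 0 < r4 e%:R :> R by apply: r4_gt0.
have r2 : r4 2 <= 2 :> R.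
  have : r4 2 <= r4 (2 ^+ 4) :> R by apply: ler_r4; rewrite -natrX ler_nat.
  rewrite /r4 (exprM _ 2 2) sqrtr_sqr ger0_norm ?sqr_ge0// sqrtr_sqr ger0_norm//.
rewrite natrM r4M//.
have -> : C2 * r4 e%:R / e%:R ^+ 2 * (4 * C1 * (r4 2 * r4 e%:R) / r4 X%:R) =
   (4 * C1 * C2 / r4 X%:R) * (r4 2 * (r4 e%:R ^+ 2 / e%:R ^+ 2)) by ring.
have -> : 8 * C1 * C2 / r4 X%:R * z R e = (4 * C1 * C2 / r4 X%:R) * (2 * z R e) by ring.
apply: ler_wpM2l; first by rewrite !mulr_ge0// invr_ge0 r4_ge0.
apply: ler_pM => //; rewrite ?r4_ge0 ?divr_ge0 ?sqr_ge0//.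
rewrite /z ler_pdivrMr ?exprn_gt0// mulrC ler_pdivlMr ?mulr_gt0//.
have r1 := r4_ge1 R e0.
rewrite [leLHS](_ : _ = e%:R * r4 e%:R ^+ 3); last by ring.
rewrite [leRHS]expr2; apply: ler_wpM2l; first exact: ltW.
by rewrite -[leRHS](r4X (ltW er)); apply: ler_weXn2l.
Qed.

End SingularSeries.

(** * Partial sums of the divisor coefficients *)

Section PartialSums.
Variable R : realType.
Implicit Types (x y u v t c : R) (n m q d D e j X Y f i : nat).

(* Inserting [e * w e = \sum_(j | e) w j / phi (e / j)] in the partial sums of [sing_coef d]
   and collecting the terms with [j * f = q] turns them into averages of the sums [Ls];
   [GX] is the truncation to [q <= X], which tends to [GI]. *)
Definition GX d n X : R := psum (fun q => if chi d q then
  w R q * \sum_(j <- divisors q) mu R (q %/ j) * Ls R (q * d) (n %/ j) else 0) X.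
Definition GI d n (M : nat -> nat -> R) : R := psum (fun j => if chi d j then
  w R j * psum (fun i => if chi (j * d) i then (phi R i)^-1 * M (i * (j * d))%N j else 0) (n %/ j)
  else 0) n.

(** Pairwise coprimality is symmetric, so that in [GX_GI] the sum over f can be carried out before
    the sum over i. *)
Lemma chi_swap q i f : sqf q -> chi q f && chi (q * f) i = chi q i && chi (i * q) f.
Proof.
move=> sq; rewrite /chi !coprimeMr [coprime f i]coprime_sym.
by case: (sqf f); case: (sqf i); case: (coprime f q); case: (coprime i q); case: (coprime i f).
Qed.

Lemma GX_GI d n X : sqf d -> (n <= X)%N ->
  GX d n X = GI d n (fun D j => psum (wmu R D) (X %/ j)).
Proof.
move=> sd nX.
pose T j f : R := if chi d j then w R j * (wmu R (j * d) f * Ls R (j * d * f) (n %/ j)) else 0.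
transitivity (psum (fun q => \sum_(j <- divisors q) T j (q %/ j)%N) X).
  apply: eq_psum => q /andP[q0 _]; case: (boolP (chi d q)) => cq.
    rewrite mulr_sumr; apply: eq_dsum => // j jq; rewrite /T /wmu.
    set m := (q %/ j)%N; have qE : q = (j * m)%N by rewrite /m mulnC divnK.
    have /andP[sq _] := cq.
    have := sq; rewrite {1}qE sqfM => /and3P[sj sm cjm].
    move: (cq); rewrite {1}qE chiM -?qE// => /andP[-> ->].
    by rewrite qE wM ?sqf_gt0// mulnAC; ring.
  rewrite big_seq big1// => j; rewrite -dvdn_divisors// => jq; rewrite /T /wmu.
  case: ifP => // cj; case: ifP => cm; last by rewrite mul0r mulr0.
  case/negP: cq; have /andP[sj _] := cj; have /andP[sm cm'] := cm.
  rewrite -(divnK jq) mulnC chiM ?cj ?cm//.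
  rewrite sqfM sj sm coprime_sym; by move: cm'; rewrite coprimeMr => /andP[].
rewrite /psum dsum_hyperbola [in RHS]/GI (psum_widen _ nX); apply: eq_psum => j /andP[j0 jX].
rewrite -/(psum _ _); case: leqP => jn; last first.
  by rewrite /T (divn_small jn); apply: big1 => f _; rewrite /Ls psum0 !mulr0 if_same.
rewrite /T; case: ifP => [/andP[sj cj]|_]; last by apply: big1.
rewrite -/(psum _ _) psumZ; congr (_ * _).
transitivity (psum (fun f => psum (fun i => if chi (j * d) f && chi (j * d * f) i then
   mu R f * w R f * (phi R i)^-1 else 0) (n %/ j)) (X %/ j)).
  apply: eq_psum => f _; rewrite /wmu /Ls; case: (chi (j * d) f) => /=; last by rewrite mul0r /psum big1.
  by rewrite -psumZ; apply: eq_psum => i _; case: ifP => _; rewrite ?mulr0.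
rewrite exchange_psum; apply: eq_psum => i _.
have sjd : sqf (j * d) by rewrite sqfM sj sd.
transitivity (psum (fun f => if chi (j * d) i then (phi R i)^-1 * wmu R (i * (j * d)) f else 0) (X %/ j)).
  apply: eq_psum => f _; rewrite chi_swap// /wmu; case: (chi _ _) => //=.
  by case: ifP => _; rewrite ?mulr0// mulrC.
by case: ifP => _; rewrite ?psumZ// /psum big1.
Qed.

(** Locally, 1/(p - 1)^2 + 1/(p - 1) = p/(p - 1)^2. *)
Lemma dsum_w_phi e : sqf e -> \sum_(j <- divisors e) w R j * (phi R (e %/ j))^-1 = e%:R * w R e.
Proof.
move=> se.
transitivity (\sum_(j <- divisors e) mf (fun p => ((p%:R - 1 : R) ^+ 2)^-1) j * mf (fun p => (p%:R - 1 : R)^-1) (e %/ j)).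
  apply: eq_bigr => j _; rewrite !mfV; congr (_ ^-1 * _).
  by rewrite /phi expr2 -mf_mul.
rewrite dsum_conv// natr_mf// /w /phi expr2 -mf_mul -mfV -mf_mul; apply: eq_mf => p pp.
by have h := prime_m1_gt0 R pp; field; rewrite gt_eqF.
Qed.

Lemma sing_coef_GI d n : sqf d -> psum (sing_coef R d) n = d%:R / phi R d * GI d n (fun D _ => Mf R D).
Proof.
move=> sd.
pose T j i : R := if chi d j && chi (j * d) i then w R j * ((phi R i)^-1 * Mf R (i * (j * d))) else 0.
have -> : GI d n (fun D _ => Mf R D) = psum (fun e => \sum_(j <- divisors e) T j (e %/ j)%N) n.
  rewrite [RHS]/psum dsum_hyperbola; apply: eq_psum => j _; rewrite -/(psum _ _) /T.
  case: (chi d j) => /=; last by rewrite /psum big1.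
  by rewrite -psumZ; apply: eq_psum => i _; case: ifP => _; rewrite ?mulr0.
rewrite -psumZ; apply: eq_psum => e /andP[e0 _]; rewrite /sing_coef.
case: (boolP (chi d e)) => ce.
  have /andP[se _] := ce; rewrite -dsum_w_phi// mulr_suml; congr (_ * _); apply: eq_dsum => // j je.
  have eE : e = (j * (e %/ j))%N by rewrite mulnC divnK.
  rewrite /T -chiM -?eE// ce mulrA; congr (_ * Mf R _).
  by rewrite mulnA [X in (X * d)%N]mulnC -eE mulnC.
rewrite big_seq big1 ?mulr0// => j; rewrite -dvdn_divisors// => je; rewrite /T.
case: ifP => // /andP[cj cm]; case/negP: ce; have /andP[sj _] := cj; have /andP[sm cm'] := cm.
rewrite -(divnK je) mulnC chiM ?cj ?cm//.
rewrite sqfM sj sm coprime_sym; by move: cm'; rewrite coprimeMr => /andP[].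
Qed.

(** Here [n] is fixed and [K] may depend on it: the lemma only identifies the limit, while the rate
    in [n] comes from [GX_main]. *)
Lemma GX_lim d n : sqf d -> (0 < n)%N -> exists K : R, forall X, (n <= X)%N ->
  `|GX d n X - phi R d / d%:R * psum (sing_coef R d) n| <= K / r4 X%:R.
Proof.
move=> sd n0; have [C C0 hC] := w_zdom R.
exists (psum (fun j => w R j * psum (fun i => (phi R i)^-1 * (4 * C * r4 (2 * j)%:R)) (n %/ j)) n).
move=> X nX; have dr : 0 < d%:R :> R by rewrite ltr0n sqf_gt0.
have pd := phi_gt0 R d.
have -> : phi R d / d%:R * psum (sing_coef R d) n = GI d n (fun D _ => Mf R D).
  by rewrite sing_coef_GI//; field; rewrite !gt_eqF.
rewrite (GX_GI sd nX) /GI -psumB; apply: le_trans (ler_norm_psum _ _) _; rewrite -psumZr.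
apply: ler_psum => j /andP[j0 jn]; have w0 := w_gt0 R j.
have B0 : 0 <= psum (fun i => (phi R i)^-1 * (4 * C * r4 (2 * j)%:R)) (n %/ j).
  by apply: psum_ge0 => i _; rewrite !mulr_ge0 ?invr_ge0 ?r4_ge0 ?(ltW (phi_gt0 R i)).
case: ifP => _; last first.
  by rewrite subr0 normr0; apply: divr_ge0; [apply: mulr_ge0 => //; exact: ltW|exact: r4_ge0].
rewrite -mulrBr normrM (ger0_norm (ltW w0)) -mulrA; apply: ler_wpM2l; first exact: ltW.
rewrite -psumB; apply: le_trans (ler_norm_psum _ _) _; rewrite -psumZr.
apply: ler_psum => i _; have ip := phi_gt0 R i.
case: ifP => _; last by rewrite subr0 normr0 !mulr_ge0 ?invr_ge0 ?r4_ge0 ?(ltW ip).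
rewrite -mulrBr normrM ger0_norm ?invr_ge0 ?(ltW ip)// -[leRHS]mulrA.
apply: ler_wpM2l; first by rewrite invr_ge0 ltW.
by apply: tot_tail_div => //; apply: leq_trans nX.
Qed.

(** As in [Tm_main], the Moebius sums leave only q = 1 and prime q, the latter giving - [lam]. In
    [psum_sing_coef_approx] this cancels the [Lam] inside [c1] and leaves Euler's constant. *)
Lemma GX_main : exists2 C : R, 0 <= C & forall d n X, sqf d -> (0 < n)%N -> (0 < X)%N ->
  `|GX d n X - phi R d / d%:R * (ln n%:R + c1 R + af (lq R) d
     - psum (fun p => if prime p && coprime p d then lam R p else 0) X)| <= C * Pf R d / Num.sqrt n%:R.
Proof.
have [C1 C10 hC1] := Ls_approx R; have [C2 C20 hC2] := phi_bound R 2 2 0.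
exists (5 * C1 * C2) => [|d n X sd n0 X0]; first by rewrite !mulr_ge0.
have dr : 0 < d%:R :> R by rewrite ltr0n sqf_gt0.
have nr : 0 < n%:R :> R by rewrite ltr0n.
have sn0 : 0 < Num.sqrt n%:R :> R by rewrite sqrtr_gt0.
have pd := phi_gt0 R d; set B := phi R d / d%:R; set A := ln n%:R + _ + _.
have main : B * (A - psum (fun p => if prime p && coprime p d then lam R p else 0) X) =
  psum (fun q => if chi d q then w R q * (\sum_(j <- divisors q) mu R (q %/ j) *
     (phi R (q * d) / (q * d)%:R * (ln (n%:R / j%:R) + c1 R + af (lq R) (q * d)))) else 0) X.
  have -> : B * (A - psum (fun p => if prime p && coprime p d then lam R p else 0) X) =
     psum (fun q => B * ((q == 1%N)%:R * A - (if prime q && coprime q d then lam R q else 0))) X.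
    by rewrite psumZ psumB psumZr psum_delta1// mul1r.
  apply: eq_psum => q /andP[q0 _]; case: (boolP (chi d q)) => cq; last first.
    have -> : (q == 1%N) = false by apply/eqP => q1; case/negP: cq; rewrite q1 /chi /coprime gcd1n.
    case: ifP => [/andP[pq cqd]|_]; last by rewrite mul0r subr0 mulr0.
    by case/negP: cq; rewrite /chi (sqf_prime pq).
  have /andP[sq cqd] := cq; have qr : 0 < q%:R :> R by rewrite ltr0n.
  rewrite (dsum_rev (fun j => mu R (q %/ j) * _))//.
  have -> : \sum_(f <- divisors q) mu R (q %/ (q %/ f)) *
     (phi R (q * d) / (q * d)%:R * (ln (n%:R / (q %/ f)%:R) + c1 R + af (lq R) (q * d))) =
     phi R (q * d) / (q * d)%:R * (\sum_(f <- divisors q) mu R f * (ln n%:R - ln q%:R + c1 R + af (lq R) (q * d))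
       + \sum_(f <- divisors q) mu R f * af (fun p => ln p%:R : R) f).
    rewrite -big_split /= mulr_sumr; apply: eq_dsum => // f fq.
    have f0 : (0 < f)%N := dvdn_gt0 q0 fq; have fr : 0 < f%:R :> R by rewrite ltr0n.
    have [sf _] := sqf_dvdm sq fq.
    have -> : (q %/ (q %/ f) = f)%N by rewrite divnA// mulKn.
    have -> : ln (n%:R / (q %/ f)%:R) = ln n%:R - ln q%:R + ln f%:R :> R.
      by rewrite natr_divn// lnM ?posrE ?invr_gt0 ?divr_gt0// lnV ?posrE ?divr_gt0// lnM ?posrE ?invr_gt0// lnV ?posrE//; ring.
    by rewrite (ln_af _ sf); ring.
  rewrite -mulr_suml dsum_mu// dsum_mu_af//.
  have -> : phi R (q * d) = phi R q * phi R d by rewrite /phi mfM ?sqf_gt0.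
  rewrite natrM /w /B; have pq := phi_gt0 R q.
  case: (boolP (prime q)) => prq /=.
    have -> : (q == 1%N) = false by apply/eqP => q1; move: prq; rewrite q1.
    rewrite cqd /lam /= !mul0r add0r sub0r.
    have -> : phi R q = q%:R - 1 by rewrite /phi mfp.
    by have h := prime_m1_gt0 R prq; field; rewrite !gt_eqF.
  rewrite subr0 addr0; case: eqP => [->|_]; last by rewrite /= !mul0r !mulr0.
  by rewrite /phi mf1 ln1 mul1n /A /=; field; rewrite gt_eqF.
rewrite main /GX -psumB; apply: le_trans (ler_norm_psum _ _) _.
apply: le_trans (_ : _ <= psum (fun q => C1 * C2 * Pf R d / Num.sqrt n%:R * z R q) X) _; last first.
  rewrite psumZ [leRHS](_ : _ = C1 * C2 * Pf R d / Num.sqrt n%:R * 5); last by ring.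
  apply: ler_wpM2l; last exact: psum_z.
  by apply: divr_ge0; [rewrite !mulr_ge0// (le_trans _ (Pf_ge1 R d))|exact: ltW].
apply: ler_psum => q /andP[q0 _].
have K0 : 0 <= C1 * C2 * Pf R d / Num.sqrt n%:R.
  by apply: divr_ge0; [rewrite !mulr_ge0// (le_trans _ (Pf_ge1 R d))|exact: ltW].
case: ifP => cq; last by rewrite subr0 normr0 mulr_ge0// z_ge0.
have /andP[sq cqd] := cq; have qr : 0 < q%:R :> R by rewrite ltr0n.
have sqd : sqf (q * d) by rewrite sqfM sq sd.
have w0 := w_gt0 R q; have pq := phi_gt0 R q.
rewrite -mulrBr normrM (ger0_norm (ltW w0)) -sumrB.
apply: le_trans (_ : _ <= w R q * (\sum_(j <- divisors q) C1 * Pf R (q * d) / Num.sqrt n%:R * Num.sqrt j%:R)) _.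
  apply: ler_wpM2l; first exact: ltW.
  apply: le_trans (ler_norm_sum _ _ _) _; rewrite !big_seq; apply: ler_sum => j.
  rewrite -dvdn_divisors// => jq; have j0 := dvdn_gt0 q0 jq; have jr : 0 < j%:R :> R by rewrite ltr0n.
  rewrite -mulrBr normrM.
  have := hC1 (q * d)%N (n%:R / j%:R) sqd (divr_gt0 nr jr).
  rewrite truncn_div ?ler0n// natrK => h.
  have -> : C1 * Pf R (q * d) / Num.sqrt n%:R * Num.sqrt j%:R = 1 * (C1 * Pf R (q * d) / Num.sqrt (n%:R / j%:R)).
    rewrite sqrtrM ?ler0n// sqrtrV ?ler0n// mul1r; have := @sqrtr_gt0 R j%:R; rewrite jr => sj.
    by field; rewrite !gt_eqF.
  by apply: ler_pM => //; exact: mu_norm.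
rewrite -mulr_sumr.
have -> : \sum_(j <- divisors q) Num.sqrt (j%:R : R) = Num.sqrt q%:R * Pf R q.
  rewrite -dsum_inv_sqrt// dsum_rev// mulr_sumr; apply: eq_dsum => // j jq.
  have j0 := dvdn_gt0 q0 jq; have jr : 0 < j%:R :> R by rewrite ltr0n.
  by rewrite natr_divn// sqrtrM ?ler0n// sqrtrV ?ler0n.
have -> : Pf R (q * d) = Pf R q * Pf R d by rewrite /Pf mfM ?sqf_gt0.
have -> : w R q * (C1 * (Pf R q * Pf R d) / Num.sqrt n%:R * (Num.sqrt q%:R * Pf R q)) =
  C1 * Pf R d / Num.sqrt n%:R * (((q%:R / phi R q) ^+ 2 * Pf R q ^+ 2) * (Num.sqrt q%:R / q%:R ^+ 2)).
  by rewrite /w; field; rewrite !gt_eqF.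
have -> : C1 * C2 * Pf R d / Num.sqrt n%:R * z R q = C1 * Pf R d / Num.sqrt n%:R * (C2 * z R q) by ring.
apply: ler_wpM2l.
  by apply: divr_ge0; [rewrite !mulr_ge0// (le_trans _ (Pf_ge1 R d))|exact: ltW].
have := hC2 q sq; rewrite expr0 mulr1 => h.
have sq0 : 0 < Num.sqrt q%:R :> R by rewrite sqrtr_gt0.
rewrite -(sqrt_z R q0) [leRHS](_ : _ = C2 * r4 q%:R * (q%:R * Num.sqrt q%:R)^-1); last by ring.
have -> : (q%:R * Num.sqrt q%:R)^-1 = Num.sqrt q%:R / q%:R ^+ 2 :> R.
  rewrite -[X in _ = _ / (X ^+ 2)](@sqr_sqrtr R q%:R)// -[X in (X * _)^-1](@sqr_sqrtr R q%:R)//.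
  by field; rewrite gt_eqF.
by apply: ler_wpM2r => //; rewrite divr_ge0 ?sqr_ge0 ?(ltW sq0).
Qed.

Lemma psum_sing_coef_approx : exists2 C : R, 0 <= C & forall d n, sqf d -> (0 < n)%N ->
  `|psum (sing_coef R d) n - (ln n%:R + gam R + af (gp R) d)| <= C * (d%:R / phi R d * Pf R d) / Num.sqrt n%:R.
Proof.
have [C C0 hC] := GX_main; exists C => // d n sd n0.
have [K hK] := GX_lim sd n0.
have d0 := sqf_gt0 sd; have dr : 0 < d%:R :> R by rewrite ltr0n.
have pd := phi_gt0 R d; set B := d%:R / phi R d.
have B0 : 0 < B by rewrite divr_gt0.
apply: (@le_r4 _ _ _ (B * K + 4 * 8) (n + d)%N) => X nX.
have nX' : (n <= X)%N by apply: leq_trans nX; rewrite leq_addr.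
have dX' : (d <= X)%N by apply: leq_trans nX; rewrite leq_addl.
have X0 : (0 < X)%N by apply: leq_trans nX'.
have h1 := hC d n X sd n0 X0; have h2 := hK X nX'.
have h3 := tot_tail (@lamS_zdom R) X0; rewrite -/(Lam R) in h3.
move: h1; have -> : psum (fun p => if prime p && coprime p d then lam R p else 0) X =
   psum (lamS R) X - af (lam R) d.
  rewrite -(psum_primes_dvd _ d0 dX') -psumB; apply: eq_psum => p _; rewrite /lamS.
  case: (boolP (prime p)) => pp /=; last by rewrite subr0.
  by rewrite prime_coprime//; case: (p %| d)%N; rewrite ?subrr ?subr0.
have -> : af (gp R) d = af (lq R) d + af (lam R) d.
  rewrite /af -big_split /= !big_seq; apply: eq_bigr => p; rewrite mem_primes => /andP[pp _].
  rewrite /gp /lq /lam; have h := prime_m1_gt0 R pp; have p0 : 0 < p%:R :> R by rewrite ltr0n prime_gt0.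
  by field; rewrite !gt_eqF.
have -> : phi R d / d%:R = B^-1 by rewrite invf_div.
move: h2; have -> : phi R d / d%:R = B^-1 by rewrite invf_div.
rewrite /c1; set g := psum (sing_coef R d) n; set L := psum (lamS R) X in h3 *.
set a := af _ d; set b := af _ d => h2 h1.
have -> : g - (ln n%:R + gam R + (a + b)) =
  B * ((GX d n X - B^-1 * (ln n%:R + (gam R + Lam R) + a - (L - b))) - (GX d n X - B^-1 * g)) - (L - Lam R).
  by field; rewrite gt_eqF.
apply: le_trans (ler_normB _ _) _.
rewrite normrM (ger0_norm (ltW B0)).
have h4 := le_trans (ler_normB (GX d n X - B^-1 * (ln n%:R + (gam R + Lam R) + a - (L - b))) (GX d n X - B^-1 * g)) (lerD h1 h2).
have := ler_wpM2l (ltW B0) h4 => h5.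
apply: le_trans (lerD h5 h3) _.
by apply: eq_ler; ring.
Qed.

End PartialSums.

(** * Moments of the singular series along multiples *)

Section Weighted.
Variable R : realType.
Implicit Types (x y u v t c : R) (n m q d D e j X Y f i k : nat).

Lemma gp_le p : prime p -> 0 <= gp R p <= 8 * (Num.sqrt (p%:R : R))^-1.
Proof.
move=> pp; have h := prime_m1_gt0 R pp; have h2 := prime_ge2r R pp.
have p0 : 0 < p%:R :> R by lra.
have s0 : 0 < Num.sqrt p%:R :> R by rewrite sqrtr_gt0.
rewrite /gp divr_ge0 ?ln_ge0 ?(ltW h)//=; last lra.
rewrite ler_pdivrMr//; apply: le_trans (ln_le_r4 p0) _.
have r0 : 1 <= r4 p%:R :> R by rewrite r4_ge1// prime_gt0.
rewrite [leRHS]mulrAC ler_pdivlMr// -r4X2.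
have := r4X (ltW p0); set r := r4 p%:R in r0 *; move: (p%:R : R) h h2 p0 {s0} => P h h2 p0 e.
rewrite -mulrA -exprS; have : r ^+ 3 <= r ^+ 4 by apply: ler_weXn2l.
rewrite e; lra.
Qed.

Lemma af_gp_le d : sqf d -> 0 <= af (gp R) d <= 8 * Pf R d.
Proof.
(* The stronger bound carries the induction: [Pf - 1] grows by p^(-1/2) [Pf], which is at least
   p^(-1/2). *)
move=> sd; suff : 0 <= af (gp R) d <= 8 * (Pf R d - 1) by move=> /andP[h1 h2]; apply/andP; split; lra.
move: d sd; apply: sqf_ind => [|p n pp pn sn /andP[IH0 IH]].
  by rewrite af1 /Pf mf1 subrr mulr0 lexx.
rewrite afpM ?sqf_gt0// /Pf mfpM ?sqf_gt0// -/(Pf R n).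
have /andP[g0 g1] := gp_le pp.
have /andP[s0 s1] := @inv_sqrt_le1 R p pp.
move: s0 s1 g0 g1 IH (Pf_ge1 R n); move: (gp R p) (_^-1) (Pf R n) => g s P s0 s1 g0 g1 IH P1.
have sP : s <= s * P by rewrite ler_peMr.
by apply/andP; split; lra.
Qed.

Lemma dphi_ge1 d : sqf d -> 1 <= d%:R / phi R d.
Proof.
move=> sd; have dr : 0 < d%:R :> R by rewrite ltr0n sqf_gt0.
by have := phi_le R sd; rewrite ler_pdivrMr// mul1r ler_pdivlMr ?phi_gt0// mul1r.
Qed.

Definition sing_moment d x : R := psum (fun k => (x - k%:R) ^+ 2 * sing R (d * k)) (Num.truncn x).

Lemma sing_moment_F d x : sqf d -> 0 <= x ->
  sing_moment d x = psum (fun e => sing_coef R d e * e%:R ^+ 2 * F (x / e%:R)) (Num.truncn x).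
Proof.
move=> sd x0; pose T j m : R := sing_coef R d j * (x - (j * m)%:R) ^+ 2.
transitivity (psum (fun e => \sum_(j <- divisors e) T j (e %/ j)%N) (Num.truncn x)).
  apply: eq_psum => k /andP[k0 _]; rewrite sing_mul// mulr_sumr; apply: eq_dsum => // j jk.
  by rewrite /T mulrC [(j * _)%N]mulnC divnK.
rewrite /psum dsum_hyperbola; apply: eq_psum => j /andP[j0 _]; rewrite -/(psum _ _).
have jr : 0 < j%:R :> R by rewrite ltr0n.
rewrite /T psumZ -mulrA; congr (_ * _); rewrite /F truncn_div// -psumZ; apply: eq_psum => m _.
by rewrite natrM; field; rewrite gt_eqF.
Qed.

(** Partial summation is applied to the difference between [sing_coef d e] and 1/e, whose partial
    sums converge because the logarithms and Euler's constants cancel. The model [H] is then added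
    back, and zeta(2) disappears. *)
Lemma sing_moment_approx : exists2 C : R, 0 <= C & forall d x, sqf d -> 1 <= x ->
  `|sing_moment d x - (d%:R / phi R d * x ^+ 3 / 3 - x ^+ 2 / 2 * (ln x + kap R + af (gp R) d))|
  <= C * (d%:R / phi R d * Pf R d) * (x * Num.sqrt x).
Proof.
have [C1 C10 hC1] := psum_sing_coef_approx R; have [C2 C20 hC2] := sing_coef_mean R; have [C3 hC3] := harm_err R.
have C30 : 0 <= C3 by have [+ _] := hC3 1 ltr01; rewrite divr1; apply: le_trans.
exists (20 * (C1 + C3 + 8) + 400) => [|d x sd x1]; first lra.
have B1 := dphi_ge1 sd; have P1 := Pf_ge1 R d; have /andP[g0 g1] := af_gp_le sd.
have d0 := sqf_gt0 sd; have pd := phi_gt0 R d; have dr : 0 < d%:R :> R by rewrite ltr0n.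
have x0 : 0 < x by lra.
set B := d%:R / phi R d in B1 *; set P := Pf R d in P1 g1 *; set f := af (gp R) d in g0 g1 *.
have BP1 : 1 <= B * P by rewrite -[1]mulr1 ler_pM.
have PBP : P <= B * P by rewrite ler_peMl//; lra.
(* In the bound eta, [C1] and [C3] come from the two partial sums, and 8 is the constant of
   [af_gp_le], which ensures [|f| <= eta]. *)
have h := @weighted_by_parts R (fun e => sing_coef R d e - e%:R^-1) f ((C1 + C3 + 8) * (B * P)) (B - zeta2 R) (B * C2 + 4) x.
have {h} : `|psum (fun e => (sing_coef R d e - e%:R^-1) * e%:R ^+ 2 * F (x / e%:R)) (Num.truncn x) -
     ((B - zeta2 R) * x ^+ 3 / 3 - f * x ^+ 2 / 2)| <=
     20 * ((C1 + C3 + 8) * (B * P)) * (x * Num.sqrt x).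
  apply: h => // [n n0|n n0|].
  - have nr : 0 < n%:R :> R by rewrite ltr0n.
    have n1 : 1 <= n%:R :> R by rewrite ler1n.
    have sn : 0 < Num.sqrt n%:R :> R by rewrite sqrtr_gt0.
    have h1 := hC1 d n sd n0; have [h2 _] := hC3 n%:R nr.
    rewrite natrK in h2.
    rewrite psumB -/(harm R n).
    have -> : psum (sing_coef R d) n - harm R n - f = (psum (sing_coef R d) n - (ln n%:R + gam R + f)) - (harm R n - ln n%:R - gam R) by ring.
    apply: le_trans (ler_normB _ _) _; apply: le_trans (lerD h1 h2) _.
    rewrite -/B -/P.
    have : C3 / n%:R <= (C3 + 8) * (B * P) / Num.sqrt n%:R.
      rewrite ler_pdivrMr// mulrAC ler_pdivlMr//.
      have -> : (C3 + 8) * (B * P) * n%:R = (C3 + 8) * (B * P * n%:R) by ring.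
      apply: ler_pM; [exact: C30|exact: ltW|lra|].
      apply: le_trans (_ : _ <= 1 * n%:R) _; last by apply: ler_wpM2r => //; exact: ltW.
      rewrite mul1r -[leRHS](@sqr_sqrtr R n%:R) ?(ltW nr)// expr2 ler_peMl ?(ltW sn)//.
      exact: sqrt_ge1.
    have -> : (C1 + C3 + 8) * (B * P) / Num.sqrt n%:R = C1 * (B * P) / Num.sqrt n%:R + (C3 + 8) * (B * P) / Num.sqrt n%:R by ring.
    lra.
  - have nr : 0 < n%:R :> R by rewrite ltr0n.
    have -> : psum (fun e => (sing_coef R d e - e%:R^-1) / e%:R) n = psum (fun e => sing_coef R d e / e%:R) n - psum (fun e => (e%:R ^+ 2)^-1) n.
      by rewrite -psumB; apply: eq_psum => e _; rewrite mulrBl -invfM -expr2.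
    have h1 := hC2 d n sd n0; rewrite -/B in h1.
    have n1 : 1 <= n%:R :> R by rewrite ler1n.
    have h2 : `|psum (fun e => (e%:R ^+ 2)^-1) n - zeta2 R| <= 4 / r4 n%:R.
      apply: le_trans (_ : _ <= 2 / n%:R) _; last first.
        apply: ler_pM => //; rewrite ?invr_ge0 ?(ltW nr) ?ler_nat//.
        by rewrite lef_pV2 ?posrE ?r4_gt0// r4_le.
      have := zeta2P R n0.
      have -> : (2 * n%:R ^+ 2)^-1 = n%:R^-1 ^+ 2 / 2 :> R by field; rewrite gt_eqF.
      have -> : (6 * n%:R ^+ 3)^-1 = n%:R^-1 ^+ 3 / 6 :> R by field; rewrite gt_eqF.
      have : 0 < (n%:R : R)^-1 <= 1 by rewrite invr_gt0 nr invf_le1.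
      move: ((n%:R : R)^-1) (psum _ _) => t u /andP[t0 t1]; rewrite !ler_norml => /andP[a b].
      have h3 : 0 <= t ^+ 2 <= t by rewrite sqr_ge0 expr2 ler_piMl// ltW.
      have h4 : 0 <= t ^+ 3 <= t.
        have /andP[e0 e1] := h3; rewrite exprS mulr_ge0//= ?(ltW t0)//.
        by rewrite ler_piMr ?(ltW t0)// (le_trans e1).
      by apply/andP; split; lra.
    rewrite [leRHS]mulrDl; move: h1 h2; set p1 := psum _ _; set p2 := psum _ _ => h1 h2.
    have -> : p1 - p2 - (B - zeta2 R) = (p1 - B) - (p2 - zeta2 R) by ring.
    by apply: le_trans (ler_normB _ _) _; exact: lerD.
  - rewrite ger0_norm//; nra.
have := H_approx x1; rewrite sing_moment_F ?(ltW x0)//.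
have -> : psum (fun e => (sing_coef R d e - e%:R^-1) * e%:R ^+ 2 * F (x / e%:R)) (Num.truncn x) =
   psum (fun e => sing_coef R d e * e%:R ^+ 2 * F (x / e%:R)) (Num.truncn x) - H x.
  rewrite /H -psumB; apply: eq_psum => e /andP[e0 _]; have er : 0 < e%:R :> R by rewrite ltr0n.
  by field; rewrite gt_eqF.
set S := psum _ _ => h1 h2.
have -> : S - (B * x ^+ 3 / 3 - x ^+ 2 / 2 * (ln x + kap R + f)) =
  (S - H x - ((B - zeta2 R) * x ^+ 3 / 3 - f * x ^+ 2 / 2)) + (H x - (zeta2 R * x ^+ 3 / 3 - x ^+ 2 / 2 * (ln x + kap R))) by field.
apply: le_trans (ler_normD _ _) _; apply: le_trans (lerD h2 h1) _.
have -> : (20 * (C1 + C3 + 8) + 400) * (B * P) * (x * Num.sqrt x) =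
  20 * ((C1 + C3 + 8) * (B * P)) * (x * Num.sqrt x) + 400 * (B * P * (x * Num.sqrt x)) by ring.
rewrite lerD2l; apply: ler_wpM2l; first by rewrite ler0n.
by rewrite ler_peMl// mulr_ge0 ?sqrtr_ge0// ltW.
Qed.

Lemma sum_multiples_moment (N : R) d : (0 < d)%N -> 0 <= N ->
  psum (fun k => if (d %| k)%N then (N - k%:R) ^+ 2 * sing R k else 0) (Num.truncn N) = d%:R ^+ 2 * sing_moment d (N / d%:R).
Proof.
move=> d0 N0; have dr : 0 < d%:R :> R by rewrite ltr0n.
rewrite psum_multiples// /sing_moment truncn_div// -psumZ; apply: eq_psum => k _.
by rewrite natrM; field; rewrite gt_eqF.
Qed.

End Weighted.

(** * A divisor-sum majorant bounded on average *)

Section Theta.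
Variable R : realType.
Implicit Types (x y u v t c : R) (n m q d D e j X Y f i k : nat).

(** Averaging a divisor sum with coefficients j^(-1/4) costs a factor 1/j for each j, hence the
    convergent sum of [z]. This trades pointwise bounds on d/phi(d) and [Pf] for bounds on
    average. *)
Definition theta e : R := \sum_(j <- divisors e) (r4 j%:R)^-1.

Lemma psum_theta (k : nat -> R) D :
  psum (fun e => theta e * k e) D = psum (fun j => (r4 j%:R)^-1 * psum (fun m => k (j * m)%N) (D %/ j)) D.
Proof.
pose T j m : R := (r4 j%:R)^-1 * k (j * m)%N.
transitivity (psum (fun e => \sum_(j <- divisors e) T j (e %/ j)%N) D).
  apply: eq_psum => e /andP[e0 _]; rewrite mulr_suml; apply: eq_dsum => // j je.
  by rewrite /T [(j * _)%N]mulnC divnK.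
by rewrite /psum dsum_hyperbola; apply: eq_psum => j _; rewrite -mulr_sumr.
Qed.

Lemma divn_le_r D j : (0 < j)%N -> (D %/ j)%:R <= D%:R / j%:R :> R.
Proof.
move=> j0; rewrite ler_pdivlMr ?ltr0n// -natrM ler_nat; exact: leq_trunc_div.
Qed.

Lemma psum_theta_bound (k : nat -> R) (K : R) D : 0 <= K ->
  (forall j, (0 < j)%N -> psum (fun m => k (j * m)%N) (D %/ j) <= K / j%:R) ->
  psum (fun e => theta e * k e) D <= 5 * K.
Proof.
move=> K0 h; rewrite psum_theta; apply: le_trans (_ : _ <= psum (fun j => K * z R j) D) _.
  apply: ler_psum => j /andP[j0 _]; rewrite /z invfM [leRHS]mulrA mulrC.
  by apply: ler_wpM2r; [rewrite invr_ge0 r4_ge0|exact: h].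
by rewrite psumZ mulrC; apply: ler_wpM2r => //; exact: psum_z.
Qed.

Lemma theta_mean D : psum theta D <= 5 * D%:R.
Proof.
have := @psum_theta_bound (fun=> 1) D%:R D (ler0n _ _).
have -> : psum (fun e => theta e * 1) D = psum theta D by apply: eq_psum => e _; rewrite mulr1.
by apply => j j0; rewrite psum_const mulr1; exact: divn_le_r.
Qed.

Lemma theta_sqrt D : psum (fun e => theta e * (Num.sqrt (e%:R : R))^-1) D <= 10 * Num.sqrt D%:R.
Proof.
have -> : 10 * Num.sqrt D%:R = 5 * (2 * Num.sqrt D%:R) :> R by ring.
apply: psum_theta_bound => [|j j0]; first by rewrite mulr_ge0 ?sqrtr_ge0.
have jr : 0 < j%:R :> R by rewrite ltr0n.
have sj : 0 < Num.sqrt j%:R :> R by rewrite sqrtr_gt0.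
have -> : psum (fun m => (Num.sqrt ((j * m)%:R : R))^-1) (D %/ j) =
    (Num.sqrt (j%:R : R))^-1 * psum (fun m => (Num.sqrt (m%:R : R))^-1) (D %/ j).
  by rewrite -psumZ; apply: eq_psum => m _; rewrite natrM sqrtrM// invfM.
apply: le_trans (_ : _ <= (Num.sqrt (j%:R : R))^-1 * (2 * Num.sqrt (D%:R / j%:R))) _.
  apply: ler_wpM2l; first by rewrite invr_ge0 ltW.
  apply: le_trans (psum_rsqrt _ _) _; apply: ler_wpM2l => //.
  by apply: ler_wsqrtr; exact: divn_le_r.
rewrite sqrtrM// sqrtrV//.
have -> : (j%:R : R)^-1 = (Num.sqrt j%:R ^+ 2)^-1 by rewrite sqr_sqrtr.
by apply: eq_ler; field; rewrite gt_eqF.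
Qed.

Lemma tail_sq u m : 0 < u ->
  psum (fun i => if u < i%:R then ((i%:R : R) ^+ 2)^-1 else 0) m <= 2 / u.
Proof.
move=> u0; suff : psum (fun i => if u < i%:R then ((i%:R : R) ^+ 2)^-1 else 0) m <=
    if u < m%:R then 2 / u - m%:R^-1 else 0.
  move=> h; apply: le_trans h _; case: ifP => _; first by rewrite gerBl invr_ge0.
  by rewrite divr_ge0// ltW.
elim: m => [|m IH]; first by rewrite psum0 ltNge (ltW u0).
rewrite psumS; have m1 : 0 < m.+1%:R :> R by rewrite ltr0n.
case: (ltrP u m.+1%:R) => hm; last first.
  have : m%:R <= u by apply: le_trans hm; rewrite ler_nat.
  by move: IH; rewrite ltNge addr0 => IH h; rewrite h in IH.
have i1 : 0 <= (m.+1%:R^-1 : R) ^+ 2 <= m.+1%:R^-1.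
  by rewrite sqr_ge0 expr2 ler_piMl ?invr_ge0 ?(ltW m1)// invf_le1// ler1n.
have i2 : m.+1%:R^-1 <= u^-1 by rewrite lef_pV2 ?posrE// ltW.
rewrite -(exprVn (m.+1%:R : R)); case: (ltrP u m%:R) IH => hm' IH; last first.
  move: i1 i2 IH; move: (m.+1%:R^-1 : R) => v /andP[i0 i1] i2 IH.
  by move: (psum _ _) IH => P; lra.
have m0 : 0 < m%:R :> R by lra.
suff : (m.+1%:R^-1 : R) ^+ 2 <= m%:R^-1 - m.+1%:R^-1.
  by move: IH; move: (psum _ _) (m%:R^-1) (m.+1%:R^-1) => P a c; lra.
move: m1; rewrite -[m.+1%:R]natr1; move: (m%:R : R) m0 => M m0 m1.
rewrite -subr_ge0 (_ : _ - _ = (M * (M + 1) ^+ 2)^-1); last by field; rewrite !gt_eqF.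
by rewrite invr_ge0 mulr_ge0 ?sqr_ge0// ltW.
Qed.

Lemma theta_tail n X : (0 < n)%N ->
  psum (fun e => theta e * (if (n < e)%N then ((e%:R : R) ^+ 2)^-1 else 0)) X <= 10 / n%:R.
Proof.
move=> n0; have nr : 0 < n%:R :> R by rewrite ltr0n.
have -> : 10 / n%:R = 5 * (2 / n%:R) :> R by ring.
apply: psum_theta_bound => [|j j0]; first by rewrite divr_ge0// ltW.
have jr : 0 < j%:R :> R by rewrite ltr0n.
have -> : psum (fun m => if (n < j * m)%N then (((j * m)%:R : R) ^+ 2)^-1 else 0) (X %/ j) =
   ((j%:R : R) ^+ 2)^-1 * psum (fun m => if n%:R / j%:R < m%:R :> R then ((m%:R : R) ^+ 2)^-1 else 0) (X %/ j).
  rewrite -psumZ; apply: eq_psum => m _; rewrite ltr_pdivrMr// -natrM ltr_nat mulnC.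
  by case: ifP => _; rewrite ?mulr0// natrM exprMn invfM mulrC.
apply: le_trans (_ : _ <= ((j%:R : R) ^+ 2)^-1 * (2 / (n%:R / j%:R))) _.
  by apply: ler_wpM2l; [rewrite invr_ge0 sqr_ge0|apply: tail_sq; exact: divr_gt0].
by apply: eq_ler; field; rewrite !gt_eqF.
Qed.

Lemma theta_ge0 e : 0 <= theta e.
Proof. by apply: sumr_ge0 => j _; rewrite invr_ge0 r4_ge0. Qed.

(** With s = p^(-1/4) at most 1/10, the local factor on the left is at most (1 + s^2)^2, hence at
    most 1 + s, the local factor of [theta]. For smaller primes it is at most 2^3 * 2 = 16. *)
Lemma theta_dom : exists2 C : R, 0 <= C & forall e, sqf e -> (e%:R / phi R e) ^+ 3 * Pf R e <= C * theta e.
Proof.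
have r0 p : prime p -> 1 <= r4 (p%:R : R) by move=> pp; rewrite r4_ge1// prime_gt0.
have [p0 _ hp0] := @r4_big R 10^-1 ltac:(lra).
exists (16 ^+ p0) => [|e se]; first by rewrite exprn_ge0.
have -> : theta e = mf (fun p => (r4 (p%:R : R))^-1 + 1) e.
  rewrite -dsum_mf// /theta; apply: eq_dsum => [|d de]; first exact: sqf_gt0.
  by have [sd _] := sqf_dvdm se de; rewrite mfV r4_mf.
have -> : (e%:R / phi R e) ^+ 3 * Pf R e =
    mf (fun p => (p%:R / (p%:R - 1)) ^+ 3 * (1 + (Num.sqrt (p%:R : R))^-1)) e.
  rewrite mf_mul -/(Pf R e); congr (_ * _).
  rewrite !exprS expr0 mulr1 natr_mf// /phi -mfV -!mf_mul; apply: eq_mf => p _.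
  by rewrite !exprS expr0 mulr1.
apply: mf_comparison; first lra.
- move=> p pp; have h := prime_m1_gt0 R pp.
  by rewrite mulr_ge0 ?exprn_ge0 ?divr_ge0 ?(ltW h)// addr_ge0// invr_ge0 sqrtr_ge0.
- by move=> p pp; rewrite addr_ge0// invr_ge0 r4_ge0.
- move=> p pp.
  have h1 := inv_m1_le R pp; have /andP[s0 s1] := @inv_sqrt_le1 R p pp; have h := prime_m1_gt0 R pp.
  have b0 : 0 <= (r4 (p%:R : R))^-1 by rewrite invr_ge0 r4_ge0.
  apply: le_trans (_ : _ <= 2 ^+ 3 * 2) _; last lra.
  have x0 : 0 <= p%:R / (p%:R - 1) :> R by rewrite divr_ge0// ltW.
  apply: ler_pM; [exact: exprn_ge0|exact: addr_ge0| |lra].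
  by rewrite lerXn2r ?nnegrE.
move=> p pp pge; have hs := hp0 p pge; have h := prime_m1_gt0 R pp; have h2 := prime_ge2r R pp.
have pr : 0 < p%:R :> R by lra.
have r_gt0 := r4_gt0 pr.
have s0 : 0 < (r4 (p%:R : R))^-1 by rewrite invr_gt0.
rewrite -r4X2 -exprVn.
have hx : p%:R / (p%:R - 1) <= 1 + 2 * (r4 (p%:R : R))^-1 ^+ 4 :> R.
  rewrite exprVn r4X ?(ltW pr)// ler_pdivrMr//.
  by rewrite -subr_ge0 (_ : _ - _ = (p%:R - 2) / p%:R); [rewrite divr_ge0//; lra|field; rewrite gt_eqF].
have x0 : 0 <= p%:R / (p%:R - 1) :> R by rewrite divr_ge0// ltW.
move: (p%:R / (p%:R - 1)) x0 hx; move: (r4 p%:R)^-1 s0 hs => s s0 hs x x0 hx.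
have t0 : 0 <= s ^+ 2 <= s / 10.
  by rewrite sqr_ge0 expr2 ler_wpM2l ?(ltW s0).
have /andP[t1 t2] := t0.
have hx' : x <= 1 + s ^+ 2 / 50.
  apply: le_trans hx _; rewrite lerD2l (exprM s 2 2).
  have : s ^+ 2 * s ^+ 2 <= s ^+ 2 * 100^-1 by apply: ler_wpM2l => //; lra.
  rewrite [s ^+ 2 ^+ 2]expr2; lra.
move: (s ^+ 2) t1 t2 hx' {t0 hx} => t t1 t2 hx'.
have inv_phi3 : t <= 100^-1 by lra.
have : x ^+ 3 <= 1 + t.
  apply: le_trans (_ : _ <= (1 + t / 50) ^+ 3) _; first by rewrite lerXn2r ?nnegrE//; lra.
  have [u tE] : exists u, t = 50 * u by exists (t / 50); field.
  rewrite tE mulrAC divff// mul1r.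
  have u0 : 0 <= u by lra.
  have u2 : u ^+ 2 <= u by rewrite expr2 ler_piMl//; lra.
  have u3 : u ^+ 3 <= u ^+ 2 by rewrite exprS ler_piMl ?sqr_ge0//; lra.
  have -> : (1 + u) ^+ 3 = 1 + 3 * u + 3 * u ^+ 2 + u ^+ 3 by ring.
  lra.
have t10 : 0 <= 1 + t by clear -t1; lra.
move=> /(ler_wpM2r t10) /le_trans; apply.
have : t * t <= t / 100 by rewrite ler_wpM2l.
lra.
Qed.

(** The size d w(d), roughly 1/d, is shared by the coefficients [sing_coef R 1] of the full series
    and, uniformly in the cutoff, by those of the truncated one. *)
Definition bdom (b : nat -> R) (C : R) :=
  forall d, (0 < d)%N -> `|b d| <= if sqf d then C * (d%:R * w R d) else 0.

Lemma bdom_ge0 b C : bdom b C -> 0 <= C.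
Proof.
move=> /(_ 1%N isT) /=; rewrite mul1r /w /phi mf1 expr1n invr1 mulr1; exact: le_trans.
Qed.

Lemma bdom_sqrt : exists2 K : R, 0 <= K & forall b C D, bdom b C ->
  psum (fun d => `|b d| * (d%:R / phi R d * Pf R d) * Num.sqrt d%:R) D <= K * C * Num.sqrt D%:R.
Proof.
have [K K0 hK] := theta_dom; exists (10 * K) => [|b C D bC]; first by rewrite mulr_ge0.
have C0 := bdom_ge0 bC.
rewrite [leRHS](_ : _ = K * C * (10 * Num.sqrt D%:R)); last by ring.
apply: le_trans (_ : _ <= psum (fun e => K * C * (theta e * (Num.sqrt (e%:R : R))^-1)) D) _; last first.
  by rewrite psumZ; apply: ler_wpM2l; [rewrite mulr_ge0|exact: theta_sqrt].
apply: ler_psum => d /andP[d0 _]; have dr : 0 < d%:R :> R by rewrite ltr0n.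
have sd0 : 0 < Num.sqrt d%:R :> R by rewrite sqrtr_gt0.
have := bC d d0; case: ifP => [sd h|_]; last first.
  rewrite normr_le0 => /eqP ->; rewrite normr0 !mul0r.
  by rewrite !mulr_ge0 ?theta_ge0 ?invr_ge0 ?(ltW sd0).
have pd := phi_gt0 R d; have P0 : 0 <= Pf R d by apply: le_trans (Pf_ge1 R d).
apply: le_trans (_ : _ <= C * (d%:R * w R d) * (d%:R / phi R d * Pf R d) * Num.sqrt d%:R) _.
  apply: ler_wpM2r; first exact: ltW.
  by apply: ler_wpM2r => //; rewrite mulr_ge0// divr_ge0// ltW.
have := hK d sd => h3.
have -> : C * (d%:R * w R d) * (d%:R / phi R d * Pf R d) * Num.sqrt d%:R =
   C * ((d%:R / phi R d) ^+ 3 * Pf R d) * (Num.sqrt d%:R)^-1.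
  rewrite /w -[X in (X / phi R d) ^+ 3](@sqr_sqrtr R d%:R)// -[X in X * (phi R d ^+ 2)^-1](@sqr_sqrtr R d%:R)// -[X in X / phi R d * Pf R d](@sqr_sqrtr R d%:R)//.
  by field; rewrite !gt_eqF.
have -> : K * C * (theta d / Num.sqrt d%:R) = C * (K * theta d) / Num.sqrt d%:R by ring.
apply: ler_wpM2r; first by rewrite invr_ge0 ltW.
exact: ler_wpM2l.
Qed.

Lemma bdom_sing_coef : exists2 C : R, 0 <= C & bdom (sing_coef R 1) C.
Proof.
have [C C0 hC] := w_zdom R; exists (5 * C) => [|d d0]; first by rewrite mulr_ge0.
rewrite /sing_coef /chi coprimen1 andbT; case: ifP => sd; last by rewrite normr0.
have -> : 1%:R / phi R 1 = 1 :> R by rewrite /phi mf1 divr1.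
have w0 := w_gt0 R d.
rewrite mul1r mul1n normrM ger0_norm ?mulr_ge0 ?(ltW w0)// mulrC.
by apply: ler_wpM2r; [rewrite mulr_ge0// ltW|exact: zdom_tot].
Qed.

End Theta.

(** * Linear forms in the moments and logarithmic averages *)

Section Linear.
Variable R : realType.
Implicit Types (x y u v t c : R) (n m q d D e j X Y f i k : nat).

Lemma moment_divisor_sum : exists2 K : R, 0 <= K & forall (b : nat -> R) (C N : R) D, bdom b C -> 1 <= N ->
  (D <= Num.truncn N)%N ->
  `|psum (fun d => b d * (d%:R ^+ 2 * sing_moment d (N / d%:R))) D
    - (N ^+ 3 / 3 * psum (fun d => b d / phi R d) D
       - N ^+ 2 / 2 * psum (fun d => b d * (ln (N / d%:R) + kap R + af (gp R) d)) D)|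
  <= K * C * N ^+ 2.
Proof.
have [C1 C10 hC1] := sing_moment_approx R; have [K K0 hK] := bdom_sqrt R.
exists (C1 * K) => [|b C N D bC N1 DN]; first by rewrite mulr_ge0.
have C0 := bdom_ge0 bC; have N0 : 0 < N by lra.
rewrite -!psumZ -psumB -psumB; apply: le_trans (ler_norm_psum _ _) _.
apply: le_trans (_ : _ <= psum (fun d => C1 * (N * Num.sqrt N) * (`|b d| * (d%:R / phi R d * Pf R d) * Num.sqrt d%:R)) D) _; last first.
  rewrite psumZ; apply: le_trans (ler_wpM2l _ (hK b C D bC)) _.
    by rewrite !mulr_ge0 ?sqrtr_ge0 ?(ltW N0).
  have sD : Num.sqrt D%:R <= Num.sqrt N.
    apply: ler_wsqrtr; apply: le_trans (_ : (Num.truncn N)%:R <= _); first by rewrite ler_nat.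
    by rewrite truncn_le// ltW.
  have -> : C1 * (N * Num.sqrt N) * (K * C * Num.sqrt D%:R) = C1 * K * C * N * (Num.sqrt N * Num.sqrt D%:R) by ring.
  have -> : C1 * K * C * N ^+ 2 = C1 * K * C * N * (Num.sqrt N * Num.sqrt N).
    by rewrite -[Num.sqrt N * _]expr2 sqr_sqrtr ?(ltW N0)//; ring.
  apply: ler_wpM2l; first by rewrite !mulr_ge0// ltW.
  by apply: ler_wpM2l => //; exact: sqrtr_ge0.
apply: ler_psum => d /andP[d0 dD]; have dr : 0 < d%:R :> R by rewrite ltr0n.
case: (boolP (sqf d)) => sd; last first.
  have := bC d d0; rewrite (negbTE sd) normr_le0 => /eqP ->.
  by rewrite !mul0r !mulr0 !subr0 normr0 !mul0r mulr0.
have x1 : 1 <= N / d%:R.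
  rewrite ler_pdivlMr// mul1r; apply: le_trans (_ : (Num.truncn N)%:R <= _).
    by rewrite ler_nat; exact: leq_trans DN.
  by rewrite truncn_le// ltW.
have pd := phi_gt0 R d; have sd0 : 0 < Num.sqrt d%:R :> R by rewrite sqrtr_gt0.
have := hC1 d _ sd x1; set w := sing_moment d _; set l := ln _ + _ + _ => h.
have -> : b d * (d%:R ^+ 2 * w) - (N ^+ 3 / 3 * (b d / phi R d) - N ^+ 2 / 2 * (b d * l)) =
  b d * d%:R ^+ 2 * (w - (d%:R / phi R d * (N / d%:R) ^+ 3 / 3 - (N / d%:R) ^+ 2 / 2 * l)).
  by field; rewrite !gt_eqF.
rewrite normrM (normrM (b d)) (ger0_norm (sqr_ge0 _)).
apply: le_trans (ler_wpM2l _ h) _; first by rewrite mulr_ge0 ?sqr_ge0.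
apply: eq_ler.
rewrite sqrtrM ?(ltW N0)// sqrtrV ?(ltW dr)//.
have E : d%:R = Num.sqrt d%:R ^+ 2 :> R by rewrite sqr_sqrtr.
rewrite [X in `|b d| * X ^+ 2]E [X in N / X]E.
move: (`|b d|) (d%:R / phi R d) (Pf R d) => B A P.
by field; rewrite gt_eqF.
Qed.

(** A second summation of ln n + c gives ln^2/2 + c ln, and the error n^(-1/2) is summable against
    1/n. *)
Lemma log_sum (a : nat -> R) (c C : R) :
  (forall n, (0 < n)%N -> `|psum a n - (ln n%:R + c)| <= C / Num.sqrt n%:R) ->
  exists2 K : R, 0 <= K & forall x, 1 <= x ->
  `|psum (fun q => a q * ln (x / q%:R)) (Num.truncn x) - (ln x ^+ 2 / 2 + c * ln x)| <= K.
Proof.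
move=> ha.
have C0 : 0 <= C by have := ha 1%N isT; rewrite sqrtr1 divr1; exact: le_trans.
have step n : (0 < n)%N -> 0 <= ln (n.+1%:R : R) - ln (n%:R : R) <= (n%:R : R)^-1.
  move=> n0; have nr : 0 < n%:R :> R by rewrite ltr0n.
  have n1 : 0 < n.+1%:R :> R by rewrite ltr0n.
  rewrite subr_ge0 ler_ln ?posrE// ler_nat leqnSn/=.
  apply: le_trans (ln_sub n1 nr) _; rewrite -[n.+1%:R]natr1.
  by rewrite (_ : n%:R + 1 - n%:R = 1) ?mul1r//; ring.
(* The difference to be bounded, at integers. It vanishes at 1 and its increments are dominated by
   [z]. *)
pose Phi n : R := psum (fun q => a q * (ln n%:R - ln q%:R)) n - (ln n%:R ^+ 2 / 2 + c * ln n%:R).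
have PhiS n : (0 < n)%N -> `|Phi n.+1 - Phi n| <= (C + 1) * z R n.
  move=> n0; have nr : 0 < n%:R :> R by rewrite ltr0n.
  have sn : 0 < Num.sqrt n%:R :> R by rewrite sqrtr_gt0.
  have n1 : 1 <= n%:R :> R by rewrite ler1n.
  have -> : Phi n.+1 - Phi n = (ln n.+1%:R - ln n%:R) *
     ((psum a n - (ln n%:R + c)) - (ln n.+1%:R - ln n%:R) / 2).
    rewrite /Phi psumS subrr mulr0 addr0.
    have -> : psum (fun q => a q * (ln n.+1%:R - ln q%:R)) n =
      psum (fun q => a q * (ln n%:R - ln q%:R)) n + psum a n * (ln n.+1%:R - ln n%:R).
      by rewrite -psumZr -psumD; apply: eq_psum => q _; ring.
    by field.
  have /andP[s0 s1] := step n n0; rewrite normrM (ger0_norm s0).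
  apply: le_trans (_ : _ <= n%:R^-1 * (C / Num.sqrt n%:R + n%:R^-1 / 2)) _.
    apply: ler_pM => //; apply: le_trans (ler_normB _ _) _; apply: lerD; first exact: ha.
    by rewrite ger0_norm ?divr_ge0// ler_wpM2r.
  have s1' : n%:R^-1 <= (Num.sqrt (n%:R : R))^-1.
    rewrite lef_pV2 ?posrE// -[leRHS](@sqr_sqrtr R n%:R) ?(ltW nr)// expr2 ler_peMl ?(ltW sn)//.
    exact: sqrt_ge1.
  apply: le_trans (_ : _ <= n%:R^-1 * ((C + 1) / Num.sqrt n%:R)) _.
    apply: ler_wpM2l; first by rewrite invr_ge0 ltW.
    rewrite [leRHS]mulrDl mul1r lerD2l; have : 0 <= (n%:R : R)^-1 by rewrite invr_ge0 ltW.
    lra.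
  have -> : n%:R^-1 * ((C + 1) / Num.sqrt n%:R) = (C + 1) * (n%:R * Num.sqrt n%:R)^-1.
    by rewrite invfM; ring.
  apply: ler_wpM2l; first lra.
  by rewrite -(sqrt_z R n0) ler_peMr ?r4_ge1// invr_ge0 mulr_ge0// ltW.
have Phib n : (0 < n)%N -> `|Phi n| <= 5 * (C + 1).
  case: n => // n _; apply: le_trans (_ : _ <= (C + 1) * psum (z R) n) _; last first.
    by rewrite [leRHS]mulrC; apply: ler_wpM2l; [lra|exact: psum_z].
  elim: n => [|n IH].
    have -> : Phi 1%N = 0 by rewrite /Phi psumS psum0 ln1 subrr; ring.
    by rewrite normr0 psum0 mulr0.
  rewrite psumS mulrDr.
  have -> : Phi n.+2 = Phi n.+1 + (Phi n.+2 - Phi n.+1) by ring.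
  by apply: le_trans (ler_normD _ _) _; apply: lerD => //; exact: PhiS.
exists (6 * (C + 1)) => [|x x1]; first lra.
have x0 : 0 < x by lra.
set X := Num.truncn x; have X0 : (0 < X)%N by rewrite truncn_gt0.
have Xr : 0 < X%:R :> R by rewrite ltr0n.
have X1 : 1 <= X%:R :> R by rewrite ler1n.
have /andP[Xx] := truncn_itv (ltW x0); rewrite -/X -[X.+1%:R]natr1 => xX.
have e0 : 0 <= ln x - ln X%:R <= 1.
  rewrite subr_ge0 ler_ln ?posrE// Xx/=; apply: le_trans (ln_sub x0 Xr) _.
  by rewrite ler_pdivrMr//; lra.
have -> : psum (fun q => a q * ln (x / q%:R)) X =
    psum (fun q => a q * (ln X%:R - ln q%:R)) X + psum a X * (ln x - ln X%:R).
  rewrite -psumZr -psumD; apply: eq_psum => q /andP[q0 _].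
  by rewrite lnM ?posrE ?invr_gt0 ?ltr0n// lnV ?posrE ?ltr0n//; ring.
have -> : psum (fun q => a q * (ln X%:R - ln q%:R)) X + psum a X * (ln x - ln X%:R) - (ln x ^+ 2 / 2 + c * ln x) =
   Phi X + (ln x - ln X%:R) * ((psum a X - (ln X%:R + c)) - (ln x - ln X%:R) / 2).
  by rewrite /Phi; field.
have -> : 6 * (C + 1) = 5 * (C + 1) + 1 * (C + 1) by ring.
apply: le_trans (ler_normD _ _) _; apply: lerD; first exact: Phib.
have /andP[e1 e2] := e0.
rewrite normrM (ger0_norm e1); apply: ler_pM => //.
apply: le_trans (ler_normB _ _) _; apply: lerD; last by rewrite ger0_norm ?divr_ge0//; lra.
apply: le_trans (ha X X0) _; rewrite ler_pdivrMr; last by rewrite sqrtr_gt0.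
by rewrite ler_peMr// sqrt_ge1.
Qed.

End Linear.

(** * Averages over primes *)

Section PrimeAverages.
Variable R : realType.
Implicit Types (x y u v t c : R) (n m q d D e j X Y f i k p : nat).

Lemma r4_2_le n x : (0 < n)%N -> 0 <= x -> x <= 2 * n%:R -> r4 x <= 2 * r4 n%:R.
Proof.
move=> n0 x0 xn; apply: le_trans (_ : _ <= r4 (2 ^+ 4 * n%:R)) _.
  apply: ler_r4; apply: le_trans xn _; apply: ler_wpM2r => //; lra.
rewrite r4M ?exprn_ge0// ler_wpM2r ?r4_ge0//.
by rewrite /r4 (exprM _ 2 2) sqrtr_sqr ger0_norm ?sqr_ge0// sqrtr_sqr ger0_norm.
Qed.

Lemma truncn_le2 x : 1 <= x -> x <= 2 * (Num.truncn x)%:R.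
Proof.
move=> x1; have X0 : (0 < Num.truncn x)%N by rewrite truncn_gt0.
have X1 : 1 <= (Num.truncn x)%:R :> R by rewrite ler1n.
have /andP[_] := truncn_itv (le_trans ler01 x1); rewrite -[(_.+1)%:R]natr1; lra.
Qed.

(** Sums up to x/p only give [Q p] as ln x up to O(ln p + 1). The weights absorb the loss, since
    even [h p * ln p] is dominated by [z]; the tail of the weights beyond x beats the factor ln
    x. *)
Lemma prime_avg (h : nat -> R) (C C' : R) : 0 <= C -> 0 <= C' ->
  (forall p, prime p -> 0 <= h p <= C * ln p%:R / p%:R ^+ 2) ->
  exists2 K : R, 0 <= K & forall x (Q : nat -> R), 1 <= x ->
    (forall p, prime p -> (p <= Num.truncn x)%N -> `|Q p - ln x| <= ln p%:R + C') ->
  `|psum (fun p => if prime p then h p * Q p else 0) (Num.truncn x)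
    - tot (fun p => if prime p then h p else 0) * ln x| <= K.
Proof.
move=> C0 C'0 hh; set hS : nat -> R := fun p => if prime p then h p else 0.
have lnp p : prime p -> 0 <= ln (p%:R : R) <= 4 * r4 p%:R.
  move=> pp; have p1 := prime_ge2r R pp; rewrite ln_ge0/=; last lra.
  apply: ln_le_r4; lra.
have hz p : prime p -> h p <= 4 * C * z R p.
  move=> pp; have /andP[h0 h1] := hh p pp; apply: le_trans h1 _.
  have [p0 /andP[l0 l1]] := (prime_gt0 pp, lnp p pp).
  have i0 : 0 <= ((p%:R : R) ^+ 2)^-1 by rewrite invr_ge0 sqr_ge0.
  apply: le_trans (_ : _ <= C * (4 * r4 p%:R) / p%:R ^+ 2) _.
    by apply: ler_wpM2r => //; exact: ler_wpM2l.
  have -> : C * (4 * r4 p%:R) / p%:R ^+ 2 = 4 * C * (r4 p%:R / p%:R ^+ 2) by ring.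
  by apply: ler_wpM2l; [rewrite mulr_ge0|exact: r4_sq_le].
have hlz p : prime p -> h p * ln p%:R <= 16 * C * z R p.
  move=> pp; have /andP[h0 h1] := hh p pp.
  have [p0 /andP[l0 l1]] := (prime_gt0 pp, lnp p pp).
  have pr : 0 < p%:R :> R by rewrite ltr0n.
  have sp : 0 < Num.sqrt p%:R :> R by rewrite sqrtr_gt0.
  have i0 : 0 <= ((p%:R : R) ^+ 2)^-1 by rewrite invr_ge0 sqr_ge0.
  apply: le_trans (ler_wpM2r l0 h1) _.
  have -> : C * ln p%:R / p%:R ^+ 2 * ln p%:R = C / p%:R ^+ 2 * (ln p%:R * ln p%:R) by ring.
  apply: le_trans (_ : _ <= C / p%:R ^+ 2 * (4 * r4 p%:R * (4 * r4 p%:R))) _.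
    by apply: ler_wpM2l; [exact: mulr_ge0|exact: ler_pM].
  have -> : C / p%:R ^+ 2 * (4 * r4 p%:R * (4 * r4 p%:R)) = 16 * C * (Num.sqrt p%:R / p%:R ^+ 2).
    by rewrite -r4X2; ring.
  apply: ler_wpM2l; first by rewrite mulr_ge0.
  exact: sqrt_div_sq.
have hSz : zdom hS (4 * C).
  move=> p p0; rewrite /hS; case: ifP => pp; last by rewrite normr0 !mulr_ge0 ?z_ge0.
  by have /andP[h0 h1] := hh p pp; rewrite ger0_norm// hz.
exists (5 * (16 * C + 4 * C * C') + 128 * C) => [|x Q x1 hQ]; first by rewrite ?addr_ge0 ?mulr_ge0 ?addr_ge0 ?mulr_ge0.
have x0 : 0 < x by lra.
set n := Num.truncn x in hQ *; have n0 : (0 < n)%N by rewrite truncn_gt0.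
have -> : psum (fun p => if prime p then h p * Q p else 0) n - tot hS * ln x =
  psum (fun p => if prime p then h p * (Q p - ln x) else 0) n + (psum hS n - tot hS) * ln x.
  rewrite mulrBl -psumZr addrA -psumD; congr (_ - _); apply: eq_psum => p _.
  by rewrite /hS; case: ifP => _; ring.
apply: le_trans (ler_normD _ _) _; apply: lerD.
  apply: le_trans (ler_norm_psum _ _) _.
  apply: le_trans (_ : _ <= psum (fun p => (16 * C + 4 * C * C') * z R p) n) _; last first.
    rewrite psumZ [leRHS]mulrC; apply: ler_wpM2l; last exact: psum_z.
    by rewrite addr_ge0 ?mulr_ge0.
  apply: ler_psum => p /andP[p0 pn]; case: ifP => pp; last first.
    by rewrite normr0 mulr_ge0 ?z_ge0// addr_ge0 ?mulr_ge0.
  have /andP[h0 _] := hh p pp; rewrite normrM (ger0_norm h0).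
  apply: le_trans (ler_wpM2l h0 (hQ p pp pn)) _.
  rewrite mulrDr mulrDl; apply: lerD; first exact: hlz.
  rewrite [4 * C * C' * _]mulrAC; apply: ler_wpM2r => //; exact: hz.
rewrite normrM; have l0 : 0 <= ln x by exact: ln_ge0.
have l1 : ln x <= 8 * r4 n%:R.
  apply: le_trans (ln_le_r4 x0) _.
  have := @r4_2_le n x n0 (ltW x0) (truncn_le2 x1); lra.
rewrite (ger0_norm l0); apply: le_trans (ler_pM _ l0 (tot_tail hSz n0) l1) _ => //.
have rn : 0 < r4 n%:R :> R by rewrite r4_gt0// ltr0n.
by apply: eq_ler; field; rewrite gt_eqF.
Qed.

Lemma floor_ln x p : (0 < p)%N -> (p <= Num.truncn x)%N -> 1 <= x ->
  `|ln (Num.truncn x %/ p)%:R - ln x| <= ln p%:R + 1.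
Proof.
move=> p0 px x1; have x0 : 0 < x by lra.
have pr : 0 < p%:R :> R by rewrite ltr0n.
rewrite -truncn_div ?(ltW x0)//.
have u0 : 0 < x / p%:R by exact: divr_gt0.
have u1 : 1 <= x / p%:R.
  rewrite ler_pdivlMr// mul1r; apply: le_trans (_ : (Num.truncn x)%:R <= _); first by rewrite ler_nat.
  by rewrite truncn_le// ltW.
have -> : ln x = ln (x / p%:R) + ln p%:R by rewrite -lnM ?posrE// divfK// gt_eqF.
have lp : 0 <= ln (p%:R : R) by rewrite ln_ge0// ler1n.
move: (x / p%:R) u0 u1 => u u0 u1.
have M0 : (0 < Num.truncn u)%N by rewrite truncn_gt0.
have Mr : 0 < (Num.truncn u)%:R :> R by rewrite ltr0n.
have M1 : 1 <= (Num.truncn u)%:R :> R by rewrite ler1n.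
have /andP[Mu] := truncn_itv (ltW u0); rewrite -[(_.+1)%:R]natr1 => uM.
have h1 := ln_sub u0 Mr.
have h2 : (u - (Num.truncn u)%:R) / (Num.truncn u)%:R <= 1 by rewrite ler_pdivrMr//; lra.
have h3 : ln (Num.truncn u)%:R <= ln u by rewrite ler_ln ?posrE.
rewrite ler0_norm; lra.
Qed.

Lemma psum_af (f : nat -> R) (a : nat -> R) n :
  psum (fun q => f q * af a q) n =
  psum (fun p => if prime p then a p * psum (fun k => f (p * k)%N) (n %/ p) else 0) n.
Proof.
transitivity (psum (fun q => psum (fun p => if prime p && (p %| q)%N then f q * a p else 0) n) n).
  apply: eq_psum => q /andP[q0 qn]; rewrite -(psum_primes_dvd a q0 qn) -psumZ.
  by apply: eq_psum => p _; case: ifP => _; rewrite ?mulr0.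
rewrite exchange_psum; apply: eq_psum => p /andP[p0 _].
case: (prime p) => /=; last by rewrite /psum big1.
rewrite -(psum_multiples f _ p0) -psumZ; apply: eq_psum => q _.
by case: ifP => _; rewrite ?mulr0// mulrC.
Qed.

Definition phi1_term p : R := if prime p then ln p%:R / (p%:R - 1) ^+ 2 else 0.
Definition phi2_term p : R := if prime p then ln p%:R / (p%:R * (p%:R - 1) ^+ 2) else 0.

Definition phi1 : R := tot phi1_term.
Definition phi2 : R := tot phi2_term.

Lemma Pf_prime_le p : prime p -> 1 <= Pf R p <= 2.
Proof.
move=> pp; rewrite /Pf mfp//; have /andP[s0 s1] := @inv_sqrt_le1 R p pp.
by apply/andP; split; lra.
Qed.

Lemma phi_prime p : prime p -> phi R p = p%:R - 1. Proof. exact: mfp. Qed.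

Lemma ler_norm4 (a b c d : R) : `|a + b + c + d| <= `|a| + `|b| + `|c| + `|d|.
Proof. by do !apply: le_trans (ler_normD _ _) (lerD _ _). Qed.

(** Pulling a prime out, [sing_coef R 1] at p k is [sing_coef R p k] divided by p - 1, so the weight
    of p becomes ln p/(p - 1)^2 and the partial sums of [sing_coef R p] enter. *)
Lemma sing_coef_avg : exists2 K : R, 0 <= K & forall x, 1 <= x ->
  `|psum (fun d => sing_coef R 1 d * af (gp R) d) (Num.truncn x) - phi1 * ln x| <= K.
Proof.
have [C C0 hC] := psum_sing_coef_approx R.
have hc : 0 <= 4 * C + `|gam R| + 9 by rewrite !addr_ge0 ?mulr_ge0.
have [p pp|K K0 hK] := @prime_avg (fun p => ln p%:R / (p%:R - 1) ^+ 2) 4 _ (ler0n _ 4) hc.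
  have h := prime_m1_gt0 R pp; have h2 := inv_m1_le R pp; have pr := prime_ge2r R pp.
  have p0 : 0 < p%:R :> R by lra.
  have l0 : 0 <= ln (p%:R : R) by rewrite ln_ge0//; lra.
  rewrite divr_ge0 ?sqr_ge0//= [4 * _]mulrC -mulrA; apply: ler_wpM2l => //.
  have -> : ((p%:R - 1) ^+ 2)^-1 = (p%:R / (p%:R - 1)) ^+ 2 / p%:R ^+ 2 :> R by field; rewrite !gt_eqF.
  apply: ler_wpM2r; first by rewrite invr_ge0 sqr_ge0.
  have : (p%:R / (p%:R - 1)) ^+ 2 <= 2 ^+ 2 :> R by rewrite lerXn2r ?nnegrE ?divr_ge0 ?(ltW h) ?(ltW p0).
  lra.
exists K => // x x1; set n := Num.truncn x.
have := hK x (fun p => psum (sing_coef R p) (n %/ p)) x1; rewrite -/n.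
have -> : psum (fun d => sing_coef R 1 d * af (gp R) d) n =
   psum (fun p => if prime p then ln p%:R / (p%:R - 1) ^+ 2 * psum (sing_coef R p) (n %/ p) else 0) n.
  rewrite psum_af; apply: eq_psum => p _; case: ifP => // pp; rewrite -!psumZ; apply: eq_psum => k /andP[k0 _].
  have h := prime_m1_gt0 R pp; have p0 := prime_gt0 pp; have pr : 0 < p%:R :> R by rewrite ltr0n.
  rewrite /sing_coef /chi sqfM (sqf_prime pp) coprimen1 andbT andTb [coprime k p]coprime_sym.
  case: ifP => [/andP[sk cpk]|_]; last by rewrite !mulr0.
  rewrite wM// natrM mul1n -(phi_prime pp) /gp /w (phi_prime pp) /phi mf1.
  have h2 := phi_gt0 R k; rewrite /phi in h2.
  by field; rewrite !gt_eqF.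
apply => p pp pn.
have p0 := prime_gt0 pp; have m0 : (0 < n %/ p)%N by rewrite divn_gt0.
have h1 := hC p _ (sqf_prime pp) m0; have h2 := floor_ln p0 pn x1; rewrite -/n in h2.
have /andP[P1 P2] := Pf_prime_le pp.
have h3 : C * (p%:R / phi R p * Pf R p) / Num.sqrt (n %/ p)%:R <= 4 * C.
  have s1 : 1 <= Num.sqrt (n %/ p)%:R :> R by rewrite sqrt_ge1// ler1n.
  rewrite ler_pdivrMr; last by lra.
  apply: le_trans (_ : _ <= 4 * C * 1) _; last by apply: ler_wpM2l => //; rewrite mulr_ge0.
  rewrite mulr1 [leRHS]mulrC; apply: ler_wpM2l => //.
  have -> : 4 = 2 * 2 :> R by ring.
  rewrite (phi_prime pp); apply: ler_pM => //; [|lra|exact: inv_m1_le].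
  by rewrite divr_ge0// ltW// prime_m1_gt0.
have /andP[g0 g1] := gp_le R pp; have /andP[s0 s1] := @inv_sqrt_le1 R p pp.
rewrite afp// in h1.
have -> : psum (sing_coef R p) (n %/ p) - ln x =
  (psum (sing_coef R p) (n %/ p) - (ln (n %/ p)%:R + gam R + gp R p)) + (ln (n %/ p)%:R - ln x) + gam R + gp R p by ring.
apply: le_trans (ler_norm4 _ _ _ _) _.
rewrite (ger0_norm g0); lra.
Qed.

Definition inv_phi q : R := if chi 1 q then (phi R q)^-1 else 0.

(** Pulling out p leaves 1/(p - 1) times a sum over k coprime to p, of density 1 - 1/p. Normalising
    that density moves a factor (p - 1)/p into the weight, which becomes ln p/(p (p - 1)^2). *)
Lemma Ls_avg : exists2 K : R, 0 <= K & forall x, 1 <= x ->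
  `|psum (fun q => inv_phi q * af (fun p => ln (p%:R : R) / (p%:R - 1) ^+ 2) q) (Num.truncn x) - phi2 * ln x| <= K.
Proof.
have [C C0 hC] := Ls_approx R.
have hc : 0 <= 4 * C + `|c1 R| + 5 by rewrite !addr_ge0 ?mulr_ge0.
have [p pp|K K0 hK] := @prime_avg (fun p => ln p%:R / (p%:R * (p%:R - 1) ^+ 2)) 4 _ (ler0n _ 4) hc.
  have h := prime_m1_gt0 R pp; have h2 := inv_m1_le R pp; have pr := prime_ge2r R pp.
  have p0 : 0 < p%:R :> R by lra.
  have l0 : 0 <= ln (p%:R : R) by rewrite ln_ge0//; lra.
  have q0 : 0 <= p%:R * (p%:R - 1) ^+ 2 :> R by rewrite mulr_ge0 ?sqr_ge0// ltW.
  rewrite divr_ge0//= [4 * _]mulrC -mulrA; apply: ler_wpM2l => //.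
  have -> : (p%:R * (p%:R - 1) ^+ 2)^-1 = (p%:R / (p%:R - 1)) ^+ 2 / p%:R ^+ 2 / p%:R :> R by field; rewrite !gt_eqF.
  rewrite ler_pdivrMr//.
  apply: le_trans (_ : _ <= 4 / p%:R ^+ 2) _.
    apply: ler_wpM2r; first by rewrite invr_ge0 sqr_ge0.
    have : (p%:R / (p%:R - 1)) ^+ 2 <= 2 ^+ 2 :> R by rewrite lerXn2r ?nnegrE ?divr_ge0 ?(ltW h) ?(ltW p0).
    lra.
  by rewrite ler_peMr ?divr_ge0 ?sqr_ge0//; lra.
exists K => // x x1; set n := Num.truncn x.
have := hK x (fun p => p%:R / (p%:R - 1) * Ls R p (n %/ p)) x1; rewrite -/n.
have -> : psum (fun q => inv_phi q * af (fun p => ln (p%:R : R) / (p%:R - 1) ^+ 2) q) n =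
   psum (fun p => if prime p then ln p%:R / (p%:R * (p%:R - 1) ^+ 2) * (p%:R / (p%:R - 1) * Ls R p (n %/ p)) else 0) n.
  rewrite psum_af; apply: eq_psum => p _; case: ifP => // pp; rewrite -!psumZ; apply: eq_psum => k /andP[k0 _].
  have h := prime_m1_gt0 R pp; have p0 := prime_gt0 pp; have pr : 0 < p%:R :> R by rewrite ltr0n.
  rewrite /inv_phi /chi sqfM (sqf_prime pp) coprimen1 andbT andTb [coprime k p]coprime_sym.
  case: ifP => [/andP[sk cpk]|_]; last by rewrite !mulr0.
  have -> : phi R (p * k) = (p%:R - 1) * phi R k by rewrite /phi mfpM// -prime_coprime.
  have h2 := phi_gt0 R k.
  by field; rewrite !gt_eqF.
apply => p pp pn.
have p0 := prime_gt0 pp; have m0 : (0 < n %/ p)%N by rewrite divn_gt0.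
have pr : 0 < p%:R :> R by rewrite ltr0n.
have mr : 0 < (n %/ p)%:R :> R by rewrite ltr0n.
have h1 := hC p _ (sqf_prime pp) mr; have h2 := floor_ln p0 pn x1; rewrite -/n in h2.
rewrite natrK in h1.
have /andP[P1 P2] := Pf_prime_le pp; have h := prime_m1_gt0 R pp; have h4 := inv_m1_le R pp.
have h3 : C * Pf R p / Num.sqrt (n %/ p)%:R <= 2 * C.
  have s1 : 1 <= Num.sqrt (n %/ p)%:R :> R by rewrite sqrt_ge1// ler1n.
  rewrite ler_pdivrMr; last by lra.
  apply: le_trans (_ : _ <= 2 * C * 1) _; last by apply: ler_wpM2l => //; rewrite mulr_ge0.
  by rewrite mulr1 [leRHS]mulrC; apply: ler_wpM2l.
have l0 : 0 <= lq R p <= 4.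
  rewrite /lq divr_ge0 ?(ltW pr) ?ln_ge0 ?ler1n//= ler_pdivrMr//.
  apply: le_trans (ln_le_r4 pr) _; have := r4_le R p0; lra.
rewrite afp// (phi_prime pp) in h1.
have -> : p%:R / (p%:R - 1) * Ls R p (n %/ p) - ln x =
  p%:R / (p%:R - 1) * (Ls R p (n %/ p) - (p%:R - 1) / p%:R * (ln (n %/ p)%:R + c1 R + lq R p)) + (ln (n %/ p)%:R - ln x) + c1 R + lq R p.
  by field; rewrite !gt_eqF.
apply: le_trans (ler_norm4 _ _ _ _) _.
have h5 : `|p%:R / (p%:R - 1) * (Ls R p (n %/ p) - (p%:R - 1) / p%:R * (ln (n %/ p)%:R + c1 R + lq R p))| <= 2 * (2 * C).
  rewrite normrM ger0_norm; last by rewrite divr_ge0// ltW.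
  by apply: ler_pM => //; [rewrite divr_ge0// ltW|exact: le_trans h1 h3].
have /andP[l1 l2] := l0; rewrite (ger0_norm l1); lra.
Qed.

End PrimeAverages.

(** * Coefficients of the truncated series *)

Section Truncated.
Variable R : realType.
Implicit Types (x y u v t c : R) (n m q d D e j X Y f i k p : nat).

Definition inv_phi3 q : R := if sqf q then (phi R q ^+ 3)^-1 else 0.
Definition T0 : R := tot inv_phi3.

Lemma inv_phi3_zdom : exists C : R, zdom inv_phi3 C.
Proof.
have [C C0 hC] := phi_bound R 3 0 0; exists C => n n0; rewrite /inv_phi3.
case: ifP => sn; last by rewrite normr0 mulr_ge0 ?z_ge0.
have nr : 0 < n%:R :> R by rewrite ltr0n.
have n1 : 1 <= n%:R :> R by rewrite ler1n.
have pn := phi_gt0 R n; rewrite ger0_norm ?invr_ge0 ?exprn_ge0 ?(ltW pn)//.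
have := hC n sn; rewrite !expr0 !mulr1 => h.
have -> : (phi R n ^+ 3)^-1 = (n%:R / phi R n) ^+ 3 / n%:R ^+ 3 by field; rewrite !gt_eqF.
apply: le_trans (_ : _ <= C * r4 n%:R / n%:R ^+ 3) _.
  by apply: ler_wpM2r => //; rewrite invr_ge0 exprn_ge0// ltW.
rewrite -mulrA; apply: ler_wpM2l => //; apply: le_trans (r4_sq_le R n0).
apply: ler_wpM2l; first exact: r4_ge0.
by rewrite lef_pV2 ?posrE ?exprn_gt0//; apply: ler_weXn2l.
Qed.

Lemma chi1 q : chi 1 q = sqf q. Proof. by rewrite /chi coprimen1 andbT. Qed.

(** Locally, p/(p - 1)^3 - 1/(p - 1)^2 = 1/(p - 1)^3. *)
Lemma inv_phi3_wmu X : psum inv_phi3 X =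
  psum (fun e => if sqf e then e%:R * (phi R e ^+ 3)^-1 * psum (wmu R e) (X %/ e) else 0) X.
Proof.
pose T j f : R := if sqf j then j%:R * (phi R j ^+ 3)^-1 * wmu R j f else 0.
transitivity (psum (fun q => \sum_(j <- divisors q) T j (q %/ j)%N) X); last first.
  rewrite /psum dsum_hyperbola; apply: eq_psum => j _; rewrite /T.
  by case: ifP => _; [rewrite -mulr_sumr|rewrite big1].
apply: eq_psum => q /andP[q0 _]; rewrite /inv_phi3; case: (boolP (sqf q)) => sq.
  transitivity (\sum_(j <- divisors q) mf (fun p => p%:R / (p%:R - 1) ^+ 3 : R) j * mf (fun p => - ((p%:R - 1 : R) ^+ 2)^-1) (q %/ j)).
    rewrite dsum_conv// /phi !exprS expr0 mulr1 -!mf_mul -mfV; apply: eq_mf => p pp.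
    by have h := prime_m1_gt0 R pp; field; rewrite gt_eqF.
  apply: eq_dsum => // j jq; have [sj sm] := sqf_dvdm sq jq; rewrite /T sj /wmu.
  have cjm : coprime (q %/ j) j by have := sq; rewrite -{1}(divnK jq) sqfM => /and3P[].
  rewrite /chi sm cjm /= muE// /w natr_mf// /phi; congr (_ * _).
    by rewrite !exprS expr0 mulr1 -!mf_mul -mfV -mf_mul; apply: eq_mf => p _; rewrite ?mulr1.
  by rewrite expr2 -mf_mul -mfV -mf_mul; apply: eq_mf => p _; rewrite mulN1r expr2.
rewrite big_seq big1// => j; rewrite -dvdn_divisors// => jq; rewrite /T /wmu.
case: ifP => // sj; case: ifP => [/andP[sm cm]|_]; last by rewrite mulr0.
by case/negP: sq; rewrite -(divnK jq) sqfM sj sm cm.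
Qed.

Lemma w_dom_theta : exists2 C : R, 0 <= C & forall e, sqf e -> w R e * e%:R / phi R e <= C * (theta R e / e%:R ^+ 2).
Proof.
have [C C0 hC] := theta_dom R; exists C => // e se.
have er : 0 < e%:R :> R by rewrite ltr0n sqf_gt0.
have pe := phi_gt0 R e; have P1 := Pf_ge1 R e.
have -> : w R e * e%:R / phi R e = (e%:R / phi R e) ^+ 3 / e%:R ^+ 2 by rewrite /w; field; rewrite !gt_eqF.
rewrite mulrA; apply: ler_wpM2r; first by rewrite invr_ge0 sqr_ge0.
by apply: le_trans (hC e se); rewrite ler_peMr// exprn_ge0// divr_ge0// ltW.
Qed.

Lemma sing_coef1E e : sing_coef R 1 e = if sqf e then e%:R * w R e * Mf R e else 0.
Proof. by rewrite /sing_coef chi1 /phi mf1 divr1 mul1r mul1n. Qed.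

Lemma sing_coef_ph_tail : exists2 C : R, 0 <= C & forall n X, (0 < n)%N -> (n <= X)%N ->
  `|psum (fun e => sing_coef R 1 e / phi R e) X - psum (fun e => sing_coef R 1 e / phi R e) n| <= C / n%:R.
Proof.
have [C C0 hC] := w_dom_theta; have [C' C'0 hC'] := w_zdom R.
exists (10 * (5 * C' * C)) => [|n X n0 nX]; first by rewrite !mulr_ge0.
rewrite (psum_widen _ nX) -psumB; apply: le_trans (ler_norm_psum _ _) _.
have -> : 10 * (5 * C' * C) / n%:R = 5 * C' * C * (10 / n%:R) by ring.
apply: le_trans (ler_wpM2l _ (theta_tail R X n0)); last by rewrite !mulr_ge0.
rewrite -psumZ; apply: ler_psum => e /andP[e0 _]; rewrite leqNgt.
case: ltnP => ne /=; last by rewrite subrr normr0 mulr0 mulr0.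
rewrite subr0 sing_coef1E; case: ifP => se; last first.
  by rewrite mul0r normr0 !mulr_ge0 ?theta_ge0 ?invr_ge0 ?sqr_ge0.
have w0 := w_gt0 R e; have pe := phi_gt0 R e.
have -> : e%:R * w R e * Mf R e / phi R e = Mf R e * (w R e * e%:R / phi R e) by ring.
rewrite normrM [X in _ * X]ger0_norm; last by rewrite divr_ge0 ?mulr_ge0 ?(ltW w0) ?(ltW pe).
rewrite -[5 * C' * C * _]mulrA; apply: ler_pM => //; last exact: hC.
  by rewrite divr_ge0 ?mulr_ge0 ?(ltW w0) ?(ltW pe).
exact: zdom_tot.
Qed.

(** The rate 1/n is required because the error is multiplied by N^3. It comes from
    [sing_coef_ph_tail]; the limit is identified separately, with a weak rate, through
    [inv_phi3_wmu]. *)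
Lemma psum_sing_coef_phi : exists2 C : R, 0 <= C & forall n, (0 < n)%N ->
  `|psum (fun e => sing_coef R 1 e / phi R e) n - T0| <= C / n%:R.
Proof.
have [C C0 hC] := sing_coef_ph_tail; exists C => // n n0.
have [C1 C10 hC1] := w_zdom R; have [C2 C20 hC2] := phi_bound R 3 0 0; have [C3 hC3] := inv_phi3_zdom.
have lim X : (0 < X)%N -> `|psum (fun e => sing_coef R 1 e / phi R e) X - T0| <= (40 * C1 * C2 + 4 * C3) / r4 X%:R.
  move=> X0; have := tot_tail hC3 X0; rewrite -/T0 => h.
  have -> : psum (fun e => sing_coef R 1 e / phi R e) X - T0 =
     (psum (fun e => sing_coef R 1 e / phi R e) X - psum inv_phi3 X) + (psum inv_phi3 X - T0) by ring.
  rewrite mulrDl; apply: le_trans (ler_normD _ _) _; apply: lerD => //.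
  rewrite inv_phi3_wmu -psumB; apply: le_trans (ler_norm_psum _ _) _.
  have -> : 40 * C1 * C2 / r4 X%:R = 8 * C1 * C2 / r4 X%:R * 5 by ring.
  have K0 : 0 <= 8 * C1 * C2 / r4 X%:R by apply: divr_ge0; [rewrite !mulr_ge0|exact: r4_ge0].
  apply: le_trans (ler_wpM2l K0 (psum_z R X)); rewrite -psumZ; apply: ler_psum => e /andP[e0 eX].
  rewrite sing_coef1E; case: ifP => se; last by rewrite mul0r subr0 normr0 mulr_ge0 ?z_ge0.
  have pe := phi_gt0 R e; have er : 0 < e%:R :> R by rewrite ltr0n.
  have -> : e%:R * w R e * Mf R e / phi R e - e%:R / phi R e ^+ 3 * psum (wmu R e) (X %/ e) =
     e%:R / phi R e ^+ 3 * (Mf R e - psum (wmu R e) (X %/ e)) by rewrite /w; field; rewrite gt_eqF.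
  rewrite normrM distrC ger0_norm; last by rewrite divr_ge0 ?exprn_ge0 ?(ltW pe).
  apply: le_trans (ler_wpM2l _ (tot_tail_div (hC1 e) e0 eX)) _.
    by rewrite divr_ge0 ?exprn_ge0 ?(ltW pe).
  have := hC2 e se; rewrite !expr0 !mulr1 => h2.
  have se0 : 0 < Num.sqrt e%:R :> R by rewrite sqrtr_gt0.
  have -> : e%:R / phi R e ^+ 3 * (4 * C1 * r4 (2 * e)%:R / r4 X%:R) =
     4 * C1 / r4 X%:R * ((e%:R / phi R e) ^+ 3 * (r4 (2 * e)%:R / e%:R ^+ 2)).
    by field; rewrite !gt_eqF// r4_gt0// ltr0n.
  have -> : 8 * C1 * C2 / r4 X%:R * z R e = 4 * C1 / r4 X%:R * (C2 * (2 * z R e)) by ring.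
  apply: ler_wpM2l; first by apply: divr_ge0; [rewrite mulr_ge0|exact: r4_ge0].
  have h3 : r4 (2 * e)%:R <= 2 * r4 (e%:R : R).
    by apply: r4_2_le => //; rewrite natrM.
  apply: le_trans (_ : _ <= C2 * r4 e%:R * (2 * r4 e%:R / e%:R ^+ 2)) _.
    apply: ler_pM => //; [by rewrite exprn_ge0// divr_ge0// ltW|by rewrite divr_ge0 ?r4_ge0 ?sqr_ge0|].
    by apply: ler_wpM2r => //; rewrite invr_ge0 sqr_ge0.
  have -> : C2 * r4 e%:R * (2 * r4 e%:R / e%:R ^+ 2) = C2 * (2 * (Num.sqrt e%:R / e%:R ^+ 2)).
    by rewrite -r4X2; ring.
  apply: ler_wpM2l => //; apply: ler_wpM2l => //.
  exact: sqrt_div_sq.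
apply: (@le_r4 _ _ _ (40 * C1 * C2 + 4 * C3) n) => X nX.
have X0 : (0 < X)%N by apply: leq_trans nX.
have h1 := lim X X0; have h2 := hC n X n0 nX.
rewrite [leRHS]addrC; set a := psum _ X in h1 h2; set b := psum _ n in h2 *.
have -> : b - T0 = (a - T0) - (a - b) by ring.
by apply: le_trans (ler_normB _ _) _; exact: lerD.
Qed.

(* Divisor coefficients of the truncation [q <= Y] of the singular series, see [psum_cq]. *)
Definition beta Y d : R := d%:R * psum (fun q => if sqf q && (d %| q)%N then w R q * mu R (q %/ d) else 0) Y.

Lemma beta_sum (u : nat -> R) Y : psum (fun d => beta Y d * u d) Y =
  psum (fun q => if sqf q then w R q * \sum_(d <- divisors q) d%:R * mu R (q %/ d) * u d else 0) Y.
Proof.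
transitivity (psum (fun d => psum (fun q => if sqf q && (d %| q)%N then w R q * (d%:R * mu R (q %/ d) * u d) else 0) Y) Y).
  apply: eq_psum => d _; rewrite /beta mulrAC -psumZ; apply: eq_psum => q _.
  by case: ifP => _; rewrite ?mulr0//; ring.
rewrite exchange_psum; apply: eq_psum => q /andP[q0 qY]; case: (sqf q) => /=; last by rewrite /psum big1.
rewrite (dsum_psum _ q0 qY) -psumZ; apply: eq_psum => d _.
by case: ifP => _; rewrite ?mulr0.
Qed.

Lemma dsum_beta (b : nat -> R) q : sqf q ->
  \sum_(d <- divisors q) d%:R * mu R (q %/ d) * mf b d = mf (fun p => p%:R * b p - 1) q.
Proof.
move=> sq; rewrite -(dsum_conv _ (fun=> -1))//; apply: eq_dsum => [|d dq]; first exact: sqf_gt0.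
have [sd sm] := sqf_dvdm sq dq; rewrite mf_mul natr_mf// muE//; ring.
Qed.

Lemma beta_phi Y : psum (fun d => beta Y d / phi R d) Y = psum inv_phi3 Y.
Proof.
rewrite (beta_sum (fun d => (phi R d)^-1)); apply: eq_psum => q _; rewrite /inv_phi3; case: ifP => // sq.
transitivity (w R q * \sum_(d <- divisors q) d%:R * mu R (q %/ d) * mf (fun p => (p%:R - 1 : R)^-1) d).
  by congr (_ * _); apply: eq_bigr => d _; rewrite mfV.
rewrite dsum_beta// /w /phi !exprS !expr0 !mulr1 -!mf_mul -!mfV -mf_mul; apply: eq_mf => p pp.
by have h := prime_m1_gt0 R pp; field; rewrite gt_eqF.
Qed.

Lemma w_phi q : w R q * phi R q = (phi R q)^-1.
Proof. by have h := phi_gt0 R q; rewrite /w; field; rewrite gt_eqF. Qed.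

Lemma beta_1 Y : psum (beta Y) Y = psum (inv_phi R) Y.
Proof.
have -> : psum (beta Y) Y = psum (fun d => beta Y d * 1) Y by apply: eq_psum => d _; rewrite mulr1.
rewrite beta_sum; apply: eq_psum => q _; rewrite /inv_phi chi1; case: ifP => // sq.
rewrite -w_phi; congr (_ * _).
transitivity (\sum_(d <- divisors q) d%:R * mu R (q %/ d) * mf (fun=> 1 : R) d).
  by apply: eq_bigr => d _; rewrite /mf big1.
by rewrite dsum_beta//; apply: eq_mf => p _; rewrite mulr1.
Qed.

Lemma beta_af a Y : psum (fun d => beta Y d * af a d) Y =
  psum (fun q => inv_phi R q * af (fun p => a p * p%:R / (p%:R - 1)) q) Y.
Proof.
rewrite beta_sum; apply: eq_psum => q _; rewrite /inv_phi chi1; case: ifP => sq; last by rewrite mul0r.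
transitivity (w R q * (phi R q * af (fun p => a p * p%:R / (p%:R - 1)) q)); last by rewrite mulrA w_phi.
congr (_ * _).
rewrite -(@dsum_conv_af R (fun p => p%:R) (fun=> -1) a q) => [|p pp|//]; last by rewrite gt_eqF// prime_m1_gt0.
apply: eq_dsum => [|d dq]; first exact: sqf_gt0.
by have [sd sm] := sqf_dvdm sq dq; rewrite natr_mf// muE.
Qed.

(** Moebius inversion: at each q = j m the inner sum is that of mu over the divisors of m, so only q
    = j contributes. These are the diagonal coordinates used in [beta_lcm]. *)
Lemma beta_multiples j Y : (0 < j <= Y)%N ->
  psum (fun d => beta Y d / d%:R * (j %| d)%:R) Y = if sqf j then w R j else 0.
Proof.
move=> /andP[j0 jY].
have -> : psum (fun d => beta Y d / d%:R * (j %| d)%:R) Y = psum (fun d => beta Y d * ((j %| d)%:R / d%:R)) Y.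
  by apply: eq_psum => d _; ring.
rewrite beta_sum.
transitivity (psum (fun q => if q == j then (if sqf j then w R j else 0) else 0) Y); last first.
  rewrite /psum -big_mkcond (@big_nat_pred1 _ _ j)//; by rewrite j0 ltnS.
apply: eq_psum => q /andP[q0 qY].
case: (boolP (sqf q)) => sq; last by case: eqP => // <-; rewrite (negbTE sq).
have -> : \sum_(d <- divisors q) d%:R * mu R (q %/ d) * ((j %| d)%:R / d%:R) =
   \sum_(d <- divisors q) (if (j %| d)%N then mu R (q %/ d) else 0).
  apply: eq_dsum => // d dq; have dr : 0 < d%:R :> R by rewrite ltr0n (dvdn_gt0 q0).
  by case: (j %| d)%N; [rewrite mul1r mulrAC divff ?mul1r// gt_eqF|rewrite mul0r mulr0].
case: (boolP (j %| q)%N) => jq; last first.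
  have -> : (q == j) = false by apply/eqP => qj; case/negP: jq; rewrite qj.
  rewrite big_seq big1 ?mulr0// => d; rewrite -dvdn_divisors// => dq.
  by case: ifP => // jd; case/negP: jq; exact: dvdn_trans dq.
have [m qE] : exists m, q = (j * m)%N by exists (q %/ j)%N; rewrite mulnC divnK.
have m0 : (0 < m)%N by move: q0; rewrite qE muln_gt0 => /andP[].
have sm : sqf m by apply: sqf_dvd sq; rewrite qE dvdn_mull.
rewrite (@dsum_psum _ _ q q)//.
transitivity (w R q * psum (fun d => if (j %| d)%N then (if (d %| q)%N then mu R (q %/ d) else 0) else 0) q).
  by congr (_ * _); apply: eq_psum => d _; case: (d %| q)%N; case: (j %| d)%N.
have qj : (q %/ j = m)%N by rewrite qE mulKn.
rewrite psum_multiples// qj.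
have -> : psum (fun k => if (j * k %| q)%N then mu R (q %/ (j * k)) else 0) m = \sum_(k <- divisors m) mu R (m %/ k).
  rewrite (dsum_psum _ m0 (leqnn _)); apply: eq_psum => k _; rewrite qE dvdn_pmul2l//.
  by case: ifP => _ //; rewrite divnMl.
rewrite -(dsum_rev (mu R) m0) dsum_mu//.
have -> : (q == j) = (m == 1%N) by rewrite qE -{2}[j]muln1 eqn_pmul2l.
case: eqP qE => [-> qE|_ _]; last by rewrite mulr0.
by move: sq; rewrite qE muln1 mulr1 => ->.
Qed.

(** Compared with [sing_coef1E], [beta] carries the series [Mf] cut off at [Y %/ d]. This gives both
    its uniform bound and its limit. *)
Lemma beta_wmu Y d : (0 < d)%N ->
  beta Y d = if sqf d then d%:R * w R d * psum (wmu R d) (Y %/ d) else 0.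
Proof.
move=> d0.
have -> : beta Y d = d%:R * psum (fun q => if (d %| q)%N then (if sqf q then w R q * mu R (q %/ d) else 0) else 0) Y.
  by congr (_ * _); apply: eq_psum => q _; case: (d %| q)%N; rewrite ?andbT ?andbF.
rewrite psum_multiples//.
have -> : psum (fun k => if sqf (d * k) then w R (d * k) * mu R (d * k %/ d) else 0) (Y %/ d) =
   (if sqf d then w R d else 0) * psum (wmu R d) (Y %/ d).
  rewrite -psumZ; apply: eq_psum => k /andP[k0 _]; rewrite mulKn// /wmu /chi sqfM [coprime d k]coprime_sym.
  case: (boolP (sqf d)) => /= sd; last by rewrite mul0r.
  by case: ifP => [/andP[sk ck]|_]; rewrite ?mulr0// wM// 1?coprime_sym//; ring.
by case: ifP => _; rewrite ?mul0r ?mulr0// mulrA.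
Qed.

Lemma beta_bdom : exists2 C : R, 0 <= C & forall Y, bdom (beta Y) C.
Proof.
have [C C0 hC] := w_zdom R; exists (5 * C) => [|Y d d0]; first by rewrite mulr_ge0.
rewrite beta_wmu//; case: ifP => sd; last by rewrite normr0.
have w0 := w_gt0 R d.
rewrite normrM ger0_norm ?mulr_ge0 ?(ltW w0)// mulrC.
apply: ler_wpM2r; first by rewrite mulr_ge0// ltW.
by apply: le_trans (ler_norm_psum _ _) _; exact: zdom_psum.
Qed.

End Truncated.

(** * The three second moments *)

Section Moments.
Variable R : realType.
Implicit Types (x y u v t c N : R) (n m q d D e j X Y f i k p : nat).

Definition sing_le Y k : R := psum (fun d => if (d %| k)%N then beta R Y d else 0) Y.

Lemma mixed_moment N (b : nat -> R) D : 0 <= N ->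
  psum (fun k => (N - k%:R) ^+ 2 * (sing R k * psum (fun d => if (d %| k)%N then b d else 0) D)) (Num.truncn N) =
  psum (fun d => b d * (d%:R ^+ 2 * sing_moment d (N / d%:R))) D.
Proof.
move=> N0.
transitivity (psum (fun k => psum (fun d => b d * (if (d %| k)%N then (N - k%:R) ^+ 2 * sing R k else 0)) D) (Num.truncn N)).
  apply: eq_psum => k _; rewrite -!psumZ; apply: eq_psum => d _.
  by case: ifP => _; rewrite ?mulr0//; ring.
rewrite exchange_psum; apply: eq_psum => d /andP[d0 _].
by rewrite psumZ sum_multiples_moment.
Qed.

Lemma truncn1_le N : 1 <= N -> N <= 2 * (Num.truncn N)%:R /\ (Num.truncn N)%:R <= N.
Proof. by move=> N1; split; [exact: truncn_le2|rewrite truncn_le//; lra]. Qed.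

Lemma sing_coef_psum_approx : exists2 C : R, 0 <= C & forall n, (0 < n)%N ->
  `|psum (sing_coef R 1) n - (ln n%:R + gam R)| <= C / Num.sqrt n%:R.
Proof.
have [C C0 hC] := psum_sing_coef_approx R; exists C => // n n0; have := hC 1%N n isT n0.
by rewrite af1 addr0 /phi /Pf !mf1 divr1 !mulr1.
Qed.

Lemma inv_phi_psum_approx : exists2 C : R, 0 <= C & forall n, (0 < n)%N ->
  `|psum (inv_phi R) n - (ln n%:R + c1 R)| <= C / Num.sqrt n%:R.
Proof.
have [C C0 hC] := Ls_approx R; exists C => // n n0.
have nr : 0 < n%:R :> R by rewrite ltr0n.
have := hC 1%N n%:R isT nr; rewrite natrK.
by rewrite af1 addr0 /phi /Pf !mf1 divr1 !mulr1 mul1r.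
Qed.

(** For k <= N the full series is itself a divisor sum with coefficients [sing_coef R 1] cut at N,
    so one factor is expanded and the moments along multiples evaluate the other. *)
Lemma moment_SS : exists2 C : R, 0 <= C & forall N, 1 <= N ->
  `|psum (fun k => (N - k%:R) ^+ 2 * (sing R k * sing R k)) (Num.truncn N)
   - (N ^+ 3 / 3 * T0 R - N ^+ 2 / 2 * (ln N ^+ 2 / 2 + (gam R + kap R + phi1 R) * ln N))| <= C * N ^+ 2.
Proof.
have [C1 C10 hC1] := moment_divisor_sum R; have [C2 C20 hC2] := bdom_sing_coef R.
have [C3 C30 hC3] := psum_sing_coef_phi R; have [C4 C40 hC4] := sing_coef_psum_approx.
have [C5 C50 hC5] := log_sum hC4; have [C6 C60 hC6] := sing_coef_avg R.
exists (C1 * C2 + 2 * C3 + (C5 + `|kap R| * (C4 + `|gam R| + 1) + C6)) => [|N N1].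
  by rewrite !addr_ge0 ?mulr_ge0 ?addr_ge0.
have N0 : 0 < N by lra.
set n := Num.truncn N; have n0 : (0 < n)%N by rewrite truncn_gt0.
have nr : 0 < n%:R :> R by rewrite ltr0n.
have -> : psum (fun k => (N - k%:R) ^+ 2 * (sing R k * sing R k)) n =
    psum (fun d => sing_coef R 1 d * (d%:R ^+ 2 * sing_moment d (N / d%:R))) n.
  rewrite -mixed_moment ?(ltW N0)//; apply: eq_psum => k /andP[k0 kn].
  by congr (_ * (_ * _)); rewrite -dsum_psum.
have h1 := hC1 _ _ N n hC2 N1 (leqnn _).
have h2 := hC3 n n0; have h3 := hC5 N N1; have h4 := hC6 N N1; rewrite -/n in h3 h4.
have h5 : `|psum (sing_coef R 1) n - ln N| <= C4 + `|gam R| + 1.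
  have a1 := hC4 n n0; have a2 := @floor_ln R N 1 isT n0 N1; rewrite divn1 ln1 add0r -/n in a2.
  have a3 : C4 / Num.sqrt n%:R <= C4.
    have s1 : 1 <= Num.sqrt n%:R :> R by rewrite sqrt_ge1// ler1n.
    by rewrite ler_pdivrMr ?ler_peMr//; lra.
  have -> : psum (sing_coef R 1) n - ln N = (psum (sing_coef R 1) n - (ln n%:R + gam R)) + gam R + (ln n%:R - ln N) by ring.
  apply: le_trans (ler_normD _ _) _; apply: lerD => //.
  by apply: le_trans (ler_normD _ _) _; rewrite lerD2r; exact: le_trans a3.
move: h1; set S := psum _ n.
have -> : psum (fun d => sing_coef R 1 d * (ln (N / d%:R) + kap R + af (gp R) d)) n =
   psum (fun q => sing_coef R 1 q * ln (N / q%:R)) n + psum (sing_coef R 1) n * kap R + psum (fun d => sing_coef R 1 d * af (gp R) d) n.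
  by rewrite -psumZr -!psumD; apply: eq_psum => d _; ring.
move: h2 h3 h4 h5.
set A := psum (fun e => sing_coef R 1 e / phi R e) n; set B := psum (fun q => sing_coef R 1 q * ln (N / q%:R)) n.
set D := psum (sing_coef R 1) n; set E := psum (fun d => _ * af _ d) n => h2 h3 h4 h5 h1.
have -> : S - (N ^+ 3 / 3 * T0 R - N ^+ 2 / 2 * (ln N ^+ 2 / 2 + (gam R + kap R + phi1 R) * ln N)) =
  (S - (N ^+ 3 / 3 * A - N ^+ 2 / 2 * (B + D * kap R + E))) + N ^+ 3 / 3 * (A - T0 R)
   - N ^+ 2 / 2 * ((B - (ln N ^+ 2 / 2 + gam R * ln N)) + kap R * (D - ln N) + (E - phi1 R * ln N)) by field.
apply: le_trans (ler_normB _ _) _; rewrite [leRHS]mulrDl; apply: lerD.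
  apply: le_trans (ler_normD _ _) _; rewrite mulrDl; apply: lerD => //.
  have N30 : 0 <= N ^+ 3 / 3 by rewrite divr_ge0// exprn_ge0// ltW.
  rewrite normrM (ger0_norm N30); apply: le_trans (ler_wpM2l N30 h2) _.
  have [N2 _] := truncn1_le N1; rewrite -/n in N2.
  have -> : N ^+ 3 / 3 * (C3 / n%:R) = C3 * N ^+ 2 / 3 * (N / n%:R) by field; rewrite gt_eqF.
  have h6 : N / n%:R <= 2 by rewrite ler_pdivrMr.
  have -> : 2 * C3 * N ^+ 2 = C3 * N ^+ 2 * 2 by ring.
  apply: ler_pM => //; [|by rewrite divr_ge0// ltW|].
    by rewrite divr_ge0// mulr_ge0// sqr_ge0.
  by rewrite ler_pdivrMr// ler_peMr ?mulr_ge0 ?sqr_ge0//; lra.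
have N20 : 0 <= N ^+ 2 / 2 by rewrite divr_ge0// sqr_ge0.
rewrite normrM (ger0_norm N20) [leRHS]mulrC; apply: ler_pM => //.
  by rewrite ler_pdivrMr// ler_peMr ?sqr_ge0//; lra.
apply: le_trans (ler_normD _ _) _; apply: lerD => //.
apply: le_trans (ler_normD _ _) _; apply: lerD => //.
by rewrite normrM; apply: ler_wpM2l.
Qed.

(** The sum of [inv_phi] is left unevaluated where it multiplies ln N, so that its error is paired
    with that of [moment_SYSY] before being estimated. *)
Definition U2 N y : R := psum (inv_phi R) (Num.truncn y) * (ln N + kap R - ln y)
  + ln y ^+ 2 / 2 + c1 R * ln y + phi2 R * ln y.

Lemma moment_SSY : exists2 C : R, 0 <= C & forall N y, 1 <= y -> y <= N ->
  `|psum (fun k => (N - k%:R) ^+ 2 * (sing R k * sing_le (Num.truncn y) k)) (Num.truncn N)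
   - (N ^+ 3 / 3 * psum (inv_phi3 R) (Num.truncn y) - N ^+ 2 / 2 * U2 N y)| <= C * N ^+ 2.
Proof.
have [C1 C10 hC1] := moment_divisor_sum R; have [C2 C20 hC2] := beta_bdom R.
have [C4 C40 hC4] := inv_phi_psum_approx.
have [C5 C50 hC5] := log_sum hC4; have [C6 C60 hC6] := Ls_avg R.
exists (C1 * C2 + (C5 + C6)) => [|N y y1 yN].
  by rewrite !addr_ge0 ?mulr_ge0 ?addr_ge0.
have N1 : 1 <= N by lra.
have N0 : 0 < N by lra.
set Y := Num.truncn y; have Y0 : (0 < Y)%N by rewrite truncn_gt0.
have Yn : (Y <= Num.truncn N)%N by rewrite le_truncn.
rewrite /sing_le mixed_moment ?(ltW N0)//.
have h1 := hC1 _ _ N Y (hC2 Y) N1 Yn; rewrite beta_phi in h1.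
have h3 := hC5 y y1; have h4 := hC6 y y1; rewrite -/Y in h3 h4.
move: h1.
have -> : psum (fun d => beta R Y d * (ln (N / d%:R) + kap R + af (gp R) d)) Y =
  psum (inv_phi R) Y * (ln N + kap R - ln y) + psum (fun q => inv_phi R q * ln (y / q%:R)) Y +
  psum (fun q => inv_phi R q * af (fun p => ln (p%:R : R) / (p%:R - 1) ^+ 2) q) Y.
  (* The part - ln d of ln(N/d) is merged with [gp] into one additive function. After [beta_af] its
     local value is ln p/(p - 1)^2 - ln p; the second part restores ln(y/q), the first is averaged
     by [Ls_avg]. *)
  transitivity (psum (beta R Y) Y * (ln N + kap R) + psum (fun d => beta R Y d * af (fun p => gp R p - ln p%:R) d) Y).
    rewrite -psumZr -psumD; apply: eq_psum => d /andP[d0 _].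
    case: (boolP (sqf d)) => sd; last first.
      by have := hC2 Y d d0; rewrite (negbTE sd) normr_le0 => /eqP ->; rewrite !mul0r addr0.
    have dr : 0 < d%:R :> R by rewrite ltr0n.
    have -> : af (fun p => gp R p - ln p%:R) d = af (gp R) d - ln d%:R.
      by rewrite ln_af// /af -sumrB.
    by rewrite lnM ?posrE ?invr_gt0// lnV ?posrE//; ring.
  rewrite beta_1 beta_af.
  have -> : psum (fun q => inv_phi R q * af (fun p => (gp R p - ln p%:R) * p%:R / (p%:R - 1)) q) Y =
     psum (fun q => inv_phi R q * ln (y / q%:R)) Y - psum (inv_phi R) Y * ln y +
     psum (fun q => inv_phi R q * af (fun p => ln (p%:R : R) / (p%:R - 1) ^+ 2) q) Y.
    rewrite -psumZr -psumB -psumD; apply: eq_psum => q /andP[q0 _].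
    rewrite /inv_phi chi1; case: (boolP (sqf q)) => sq; last by rewrite !mul0r subrr addr0.
    have qr : 0 < q%:R :> R by rewrite ltr0n.
    have y0 : 0 < y by lra.
    have -> : af (fun p => (gp R p - ln p%:R) * p%:R / (p%:R - 1)) q =
        af (fun p => ln (p%:R : R) / (p%:R - 1) ^+ 2) q - ln q%:R.
      rewrite ln_af// /af -sumrB !big_seq; apply: eq_bigr => p; rewrite mem_primes => /andP[pp _].
      by rewrite /gp; have h := prime_m1_gt0 R pp; field; rewrite gt_eqF.
    by rewrite lnM ?posrE ?invr_gt0// lnV ?posrE//; ring.
  by ring.
move: h3 h4; rewrite /U2 -/Y.
set A := psum (fun q => inv_phi R q * ln (y / q%:R)) Y; set B := psum (fun q => inv_phi R q * af _ q) Y.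
set S := psum (fun d => beta R Y d * _) Y; set L := psum (inv_phi R) Y => h3 h4 h1.
have -> : S - (N ^+ 3 / 3 * psum (inv_phi3 R) Y - N ^+ 2 / 2 * (L * (ln N + kap R - ln y) + ln y ^+ 2 / 2 + c1 R * ln y + phi2 R * ln y)) =
  (S - (N ^+ 3 / 3 * psum (inv_phi3 R) Y - N ^+ 2 / 2 * (L * (ln N + kap R - ln y) + A + B)))
  - N ^+ 2 / 2 * ((A - (ln y ^+ 2 / 2 + c1 R * ln y)) + (B - phi2 R * ln y)) by field.
apply: le_trans (ler_normB _ _) _; rewrite [leRHS]mulrDl; apply: lerD => //.
have N20 : 0 <= N ^+ 2 / 2 by rewrite divr_ge0// sqr_ge0.
rewrite normrM (ger0_norm N20) [leRHS]mulrC; apply: ler_pM => //.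
  by rewrite ler_pdivrMr// ler_peMr ?sqr_ge0//; lra.
by apply: le_trans (ler_normD _ _) _; exact: lerD.
Qed.


Lemma gcd_sum d e Y : sqf d -> (0 < d <= Y)%N ->
  (gcdn d e)%:R = psum (fun j => phi R j * ((j %| d)%:R * (j %| e)%:R)) Y.
Proof.
move=> sd /andP[d0 dY].
have sg : sqf (gcdn d e) by apply: sqf_dvd sd; exact: dvdn_gcdl.
have g0 := sqf_gt0 sg.
transitivity (\sum_(j <- divisors (gcdn d e)) phi R j).
  by rewrite /phi dsum_mf// natr_mf//; apply: eq_mf => p _; rewrite subrK.
rewrite (@dsum_psum _ _ _ Y g0) ?(leq_trans _ dY)//; last by rewrite dvdn_leq// dvdn_gcdl.
apply: eq_psum => j _; rewrite dvdn_gcd; case: (j %| d)%N; case: (j %| e)%N => /=; ring.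
Qed.

Lemma psum_mul (a b : nat -> R) n : psum a n * psum b n = psum (fun d => psum (fun e => a d * b e) n) n.
Proof. by rewrite -psumZr; apply: eq_psum => d _; rewrite psumZ. Qed.

(* [1 / lcm(d, e) = gcd(d, e) / (d e)] and [gcd = \sum_(j | gcd) phi j] diagonalise the form. *)
Lemma beta_lcm Y : psum (fun d => psum (fun e => beta R Y d * beta R Y e / (lcmn d e)%:R) Y) Y = psum (inv_phi3 R) Y.
Proof.
have [C C0 hC] := beta_bdom R.
transitivity (psum (fun d => psum (fun e => psum (fun j => phi R j *
    (beta R Y d / d%:R * (j %| d)%:R) * (beta R Y e / e%:R * (j %| e)%:R)) Y) Y) Y).
  apply: eq_psum => d /andP[d0 dY]; apply: eq_psum => e /andP[e0 eY].
  case: (boolP (sqf d)) => sd; last first.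
    have := hC Y d d0; rewrite (negbTE sd) normr_le0 => /eqP ->.
    by rewrite !mul0r /psum big1// => j _; rewrite !mul0r mulr0 mul0r.
  have dr : 0 < d%:R :> R by rewrite ltr0n.
  have er : 0 < e%:R :> R by rewrite ltr0n.
  have lr : 0 < (lcmn d e)%:R :> R by rewrite ltr0n lcmn_gt0 d0.
  have E : (lcmn d e)%:R * (gcdn d e)%:R = d%:R * e%:R :> R by rewrite -!natrM muln_lcm_gcd.
  have -> : beta R Y d * beta R Y e / (lcmn d e)%:R = beta R Y d / d%:R * (beta R Y e / e%:R) * (gcdn d e)%:R.
    have -> : (gcdn d e)%:R = d%:R * e%:R / (lcmn d e)%:R :> R by rewrite -E mulrAC divff ?mul1r// gt_eqF.
    by field; rewrite !gt_eqF.
  rewrite (@gcd_sum d e Y) ?d0// -psumZ; apply: eq_psum => j _; ring.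
have -> : psum (inv_phi3 R) Y = psum (fun j => phi R j * (psum (fun d => beta R Y d / d%:R * (j %| d)%:R) Y *
   psum (fun d => beta R Y d / d%:R * (j %| d)%:R) Y)) Y.
  apply: eq_psum => j jY; rewrite beta_multiples// /inv_phi3; case: ifP => _; last by rewrite !mulr0.
  by have h := phi_gt0 R j; rewrite /w; field; rewrite gt_eqF.
transitivity (psum (fun d => psum (fun j => psum (fun e => phi R j *
    (beta R Y d / d%:R * (j %| d)%:R) * (beta R Y e / e%:R * (j %| e)%:R)) Y) Y) Y).
  by apply: eq_psum => d _; exact: exchange_psum.
rewrite exchange_psum; apply: eq_psum => j _; rewrite psum_mul -psumZ; apply: eq_psum => d _.
by rewrite -psumZ; apply: eq_psum => e _; ring.
Qed.

Lemma psum_multiples_sq N m : (0 < m)%N -> 0 <= N ->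
  psum (fun k => if (m %| k)%N then (N - k%:R) ^+ 2 else 0) (Num.truncn N) = m%:R ^+ 2 * F (N / m%:R).
Proof.
move=> m0 N0; have mr : 0 < m%:R :> R by rewrite ltr0n.
rewrite psum_multiples// /F truncn_div// -psumZ; apply: eq_psum => k _.
by rewrite natrM; field; rewrite gt_eqF.
Qed.

(** The error of the quadratic form in [moment_SYSY] is at most N times the square of this sum,
    hence O(N y^2), which is O(N^2) since y^2 <= N. *)
Lemma beta_d_sum : exists2 C : R, 0 <= C & forall Y, psum (fun d => `|beta R Y d| * d%:R) Y <= C * Y%:R.
Proof.
have [C C0 hC] := beta_bdom R; have [K K0 hK] := theta_dom R.
exists (C * K * 5) => [|Y]; first by rewrite !mulr_ge0.
apply: le_trans (_ : _ <= psum (fun d => C * K * theta R d) Y) _; last first.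
  by rewrite psumZ -[leRHS]mulrA; apply: ler_wpM2l; [rewrite mulr_ge0|exact: theta_mean].
apply: ler_psum => d /andP[d0 _]; have := hC Y d d0; case: ifP => [sd h|_]; last first.
  by rewrite normr_le0 => /eqP ->; rewrite normr0 mul0r !mulr_ge0 ?theta_ge0.
apply: le_trans (ler_wpM2r (ler0n _ _) h) _; rewrite -!mulrA; apply: ler_wpM2l => //.
apply: le_trans (hK d sd); have P1 := Pf_ge1 R d; have B1 := dphi_ge1 R sd.
have -> : d%:R * (w R d * d%:R) = (d%:R / phi R d) ^+ 2.
  by have h2 := phi_gt0 R d; rewrite /w; field; rewrite gt_eqF.
have B0 : 0 <= d%:R / phi R d by lra.
apply: le_trans (_ : _ <= (d%:R / phi R d) ^+ 3) _; first by apply: ler_weXn2l.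
by rewrite ler_peMr// exprn_ge0.
Qed.

Lemma moment_SYSY : exists2 C : R, 0 <= C & forall N y, 1 <= y -> y ^+ 2 <= N ->
  `|psum (fun k => (N - k%:R) ^+ 2 * (sing_le (Num.truncn y) k * sing_le (Num.truncn y) k)) (Num.truncn N)
   - (N ^+ 3 / 3 * psum (inv_phi3 R) (Num.truncn y) - N ^+ 2 / 2 * psum (inv_phi R) (Num.truncn y) ^+ 2)| <= C * N ^+ 2.
Proof.
have [C C0 hC] := beta_d_sum; exists (C ^+ 2) => [|N y y1 yN]; first exact: sqr_ge0.
have N1 : 1 <= N by apply: le_trans yN; rewrite exprn_ege1.
have N0 : 0 < N by lra.
set Y := Num.truncn y; have Yy : Y%:R <= y by rewrite truncn_le//; lra.
have -> : psum (fun k => (N - k%:R) ^+ 2 * (sing_le Y k * sing_le Y k)) (Num.truncn N) =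
   psum (fun d => psum (fun e => beta R Y d * beta R Y e * ((lcmn d e)%:R ^+ 2 * F (N / (lcmn d e)%:R))) Y) Y.
  transitivity (psum (fun k => psum (fun d => psum (fun e => beta R Y d * beta R Y e *
      (if (lcmn d e %| k)%N then (N - k%:R) ^+ 2 else 0)) Y) Y) (Num.truncn N)).
    apply: eq_psum => k _; rewrite /sing_le psum_mul -psumZ; apply: eq_psum => d _; rewrite -psumZ.
    apply: eq_psum => e _; rewrite dvdn_lcm.
    by case: (d %| k)%N; case: (e %| k)%N; rewrite /= ?mul0r ?mulr0//; ring.
  rewrite exchange_psum; apply: eq_psum => d /andP[d0 _].
  rewrite exchange_psum; apply: eq_psum => e /andP[e0 _].
  by rewrite psumZ psum_multiples_sq ?lcmn_gt0 ?d0 ?e0// ltW.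
have -> : N ^+ 3 / 3 * psum (inv_phi3 R) Y - N ^+ 2 / 2 * psum (inv_phi R) Y ^+ 2 =
  psum (fun d => psum (fun e => N ^+ 3 / 3 * (beta R Y d * beta R Y e / (lcmn d e)%:R)
     - N ^+ 2 / 2 * (beta R Y d * beta R Y e)) Y) Y.
  rewrite -beta_lcm -beta_1 [psum (beta R Y) Y ^+ 2]expr2 psum_mul -!psumZ -psumB; apply: eq_psum => d _.
  by rewrite -!psumZ -psumB.
rewrite -psumB; apply: le_trans (ler_norm_psum _ _) _.
apply: le_trans (_ : _ <= psum (fun d => psum (fun e => N * (`|beta R Y d| * d%:R * (`|beta R Y e| * e%:R))) Y) Y) _; last first.
  have -> : psum (fun d => psum (fun e => N * (`|beta R Y d| * d%:R * (`|beta R Y e| * e%:R))) Y) Y =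
     N * (psum (fun d => `|beta R Y d| * d%:R) Y * psum (fun d => `|beta R Y d| * d%:R) Y).
    by rewrite psum_mul -psumZ; apply: eq_psum => d _; rewrite psumZ.
  have p0 : 0 <= psum (fun d => `|beta R Y d| * d%:R) Y by apply: psum_ge0 => d _; rewrite mulr_ge0.
  have -> : C ^+ 2 * N ^+ 2 = N * (C ^+ 2 * N) by ring.
  apply: ler_wpM2l; first exact: ltW.
  apply: le_trans (ler_pM p0 p0 (hC Y) (hC Y)) _.
  have -> : C * Y%:R * (C * Y%:R) = C ^+ 2 * Y%:R ^+ 2 by ring.
  apply: ler_wpM2l; first exact: sqr_ge0.
  by apply: le_trans yN; rewrite lerXn2r ?nnegrE//; lra.
apply: ler_psum => d /andP[d0 _]; rewrite -psumB; apply: le_trans (ler_norm_psum _ _) _.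
apply: ler_psum => e /andP[e0 _].
have m0 : (0 < lcmn d e)%N by rewrite lcmn_gt0 d0.
have mr : 0 < (lcmn d e)%:R :> R by rewrite ltr0n.
have := @F_approx R (N / (lcmn d e)%:R) (divr_ge0 (ltW N0) (ltW mr)).
have mde : (lcmn d e)%:R <= d%:R * e%:R :> R.
  rewrite -natrM ler_nat dvdn_leq ?muln_gt0 ?d0//.
  by rewrite dvdn_lcm dvdn_mulr// dvdn_mull.
move: (lcmn d e)%:R mr mde => m mr mde h.
have -> : beta R Y d * beta R Y e * (m ^+ 2 * F (N / m)) - (N ^+ 3 / 3 * (beta R Y d * beta R Y e / m) - N ^+ 2 / 2 * (beta R Y d * beta R Y e)) =
  beta R Y d * beta R Y e * (m ^+ 2 * (F (N / m) - (N / m) ^+ 3 / 3 + (N / m) ^+ 2 / 2)).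
  by field; rewrite gt_eqF.
rewrite normrM (normrM (m ^+ 2)) (ger0_norm (sqr_ge0 m)) (normrM (beta R Y d)).
have -> : N * (`|beta R Y d| * d%:R * (`|beta R Y e| * e%:R)) = `|beta R Y d| * `|beta R Y e| * (N * (d%:R * e%:R)) by ring.
apply: ler_wpM2l; first exact: mulr_ge0.
apply: le_trans (ler_wpM2l (sqr_ge0 m) h) _.
have -> : m ^+ 2 * (N / m / 3) = N * (m / 3) by field; rewrite gt_eqF.
by apply: ler_wpM2l; [exact: ltW|lra].
Qed.

End Moments.

(** * Ramanujan sums *)

Section Link.
Variable R : realType.
Implicit Types (x y u v t c N : R) (n m q d D e j X Y f i k p : nat).

Lemma big_oo_tot (P : pred nat) (a : nat -> R) :
  \big[+%R/0]_(1 <= q <oo | P q) a q = tot (fun q => if P q then a q else 0).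
Proof. by congr (limn _); apply/funext => n; exact: big_mkcond. Qed.

Lemma cos_2piD x n : cos (x + 2 * pi * n%:R) = cos x.
Proof.
have := expi_int R n%:Z; rewrite /expi -pmulrn => -[cn sn].
by rewrite cosD cn sn mulr1 mulr0 subr0.
Qed.

Lemma sin_2piD x n : sin (x + 2 * pi * n%:R) = sin x.
Proof.
have := expi_int R n%:Z; rewrite /expi -pmulrn => -[cn sn].
by rewrite sinD cn sn mulr1 mulr0 addr0.
Qed.

Lemma cos_telescope x n :
  2 * sin x * psum (fun b => cos (2 * b%:R * x)) n = sin ((2 * n%:R + 1) * x) - sin x.
Proof.
elim: n => [|n IH]; first by rewrite psum0 !mulr0 add0r mul1r subrr.
rewrite psumS mulrDr IH -[n.+1%:R]natr1.
have -> : (2 * (n%:R + 1) + 1) * x = 2 * (n%:R + 1) * x + x by ring.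
have -> : (2 * n%:R + 1) * x = 2 * (n%:R + 1) * x - x by ring.
rewrite [sin (2 * (n%:R + 1) * x + x)]sinD [sin (2 * (n%:R + 1) * x - x)]sinB; ring.
Qed.

(* Multiplied by [2 sin (pi k / m)] the sum telescopes. *)
Lemma sum_cos m k : (0 < m)%N ->
  psum (fun b => cos (2 * pi * b%:R * (- k%:Z)%:~R / m%:R)) m = if (m %| k)%N then m%:R else 0 :> R.
Proof.
move=> m0; have mr : 0 < m%:R :> R by rewrite ltr0n.
(* Reducing [k] modulo [m] puts [x] in [0, pi), where sin x vanishes only if [m] divides [k]. *)
pose x : R := pi * (k %% m)%:R / m%:R.
have -> : psum (fun b => cos (2 * pi * b%:R * (- k%:Z)%:~R / m%:R)) m =
    psum (fun b => cos (2 * b%:R * x)) m.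
  apply: eq_psum => b _; rewrite rmorphN /= -pmulrn mulrN mulNr cosN.
  rewrite -[RHS](cos_2piD _ (b * (k %/ m))); congr cos.
  by rewrite {1}(divn_eq k m) natrD !natrM /x; field; rewrite gt_eqF.
case: ifP => [|mk].
  rewrite /dvdn => /eqP km; rewrite /x km mulr0 mul0r.
  have -> : psum (fun b => cos (2 * b%:R * 0)) m = psum (fun=> 1 : R) m.
    by apply: eq_psum => b _; rewrite mulr0 cos0.
  by rewrite psum_const mulr1.
have r0 : (0 < k %% m)%N by rewrite lt0n; move/negbT: mk.
have sx : 0 < sin x.
  apply: sin_gt0_pi; have p0 := pi_gt0 R.
  rewrite /x divr_gt0 ?mulr_gt0 ?ltr0n//= ltr_pdivrMr// ltr_pM2l// ltr_nat.
  exact: ltn_pmod.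
have := cos_telescope x m.
have -> : (2 * m%:R + 1) * x = x + 2 * pi * (k %% m)%:R by rewrite /x; field; rewrite gt_eqF.
rewrite sin_2piD subrr => /eqP; rewrite !mulf_eq0 pnatr_eq0 (gt_eqF sx) /=.
by move/eqP.
Qed.

(** Coprimality of a and q is detected by Moebius over the common divisors d; the multiples of d
    then run over a full period modulo q/d, to which [sum_cos] applies. *)
Lemma ramanujan_re q k : sqf q -> complex.Re (ramanujan_sum R q (- k%:Z)) =
  \sum_(d <- divisors q) d%:R * mu R (q %/ d) * (d %| k)%:R.
Proof.
move=> sq; have q0 := sqf_gt0 sq.
rewrite /ramanujan_sum raddf_sum big_mkcond /=.
transitivity (psum (fun a => psum (fun d => if (d %| a)%N then
    (if (d %| q)%N then mu R d * cos (2 * pi * a%:R * (- k%:Z)%:~R / q%:R) else 0) else 0) q) q).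
  apply: eq_psum => a /andP[a0 _].
  have sg : sqf (gcdn a q) by apply: sqf_dvd sq; exact: dvdn_gcdr.
  transitivity ((coprime a q)%:R * cos (2 * pi * a%:R * (- k%:Z)%:~R / q%:R : R)).
    by case: (coprime a q); rewrite ?mul1r ?mul0r.
  rewrite /coprime -dsum_mu// (@dsum_psum _ _ _ q) ?sqf_gt0//; last by rewrite dvdn_leq// dvdn_gcdr.
  rewrite -psumZr; apply: eq_psum => d _; rewrite dvdn_gcd.
  by case: (d %| a)%N; case: (d %| q)%N; rewrite /= ?mul0r.
rewrite exchange_psum dsum_rev// (dsum_psum _ q0 (leqnn _)); apply: eq_psum => d /andP[d0 _].
rewrite psum_multiples//; case: (boolP (d %| q)%N) => dq; last by rewrite /psum big1.
have dr : 0 < d%:R :> R by rewrite ltr0n.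
have m0 : (0 < q %/ d)%N by apply: divn_pos.
have mr : 0 < (q %/ d)%:R :> R by rewrite ltr0n.
have -> : (q %/ (q %/ d) = d)%N by rewrite divnA// mulKn.
rewrite psumZ.
have -> : psum (fun b => cos (2 * pi * (d * b)%:R * (- k%:Z)%:~R / q%:R)) (q %/ d) =
   psum (fun b => cos (2 * pi * b%:R * (- k%:Z)%:~R / (q %/ d)%:R : R)) (q %/ d).
  apply: eq_psum => b _; congr cos.
  by rewrite -{1}(divnK dq) !natrM; field; rewrite !gt_eqF.
by rewrite sum_cos//; case: ifP => _; rewrite ?mulr0 ?mulr1// mulrC.
Qed.

Definition cq q k : R := if sqf q then w R q * \sum_(d <- divisors q) d%:R * mu R (q %/ d) * (d %| k)%:R else 0.

Lemma psum_cq Y k : psum (fun q => cq q k) Y = sing_le R Y k.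
Proof.
rewrite -(beta_sum (fun d => (d %| k)%:R)) /sing_le; apply: eq_psum => d _.
by case: (d %| k)%N; rewrite ?mulr1 ?mulr0.
Qed.

Lemma sing_le_lim k : (0 < k)%N -> exists K : R, forall X, (k <= X)%N -> `|sing_le R X k - sing R k| <= K / r4 X%:R.
Proof.
move=> k0; have [C C0 hC] := w_zdom R.
exists (psum (fun d => d%:R * w R d * (4 * C * r4 (2 * d)%:R)) k) => X kX.
rewrite /sing_le /sing (dsum_psum _ k0 kX) -psumB.
have -> : psum (fun d => (if (d %| k)%N then beta R X d else 0) - (if (d %| k)%N then sing_coef R 1 d else 0)) X =
   psum (fun d => (if (d %| k)%N then beta R X d else 0) - (if (d %| k)%N then sing_coef R 1 d else 0)) k.
  rewrite (psum_widen _ kX); apply: eq_psum => d _; case: leqP => // kd.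
  by case: ifP => [/(dvdn_leq k0)|_]; [rewrite leqNgt kd|rewrite subrr].
apply: le_trans (ler_norm_psum _ _) _; rewrite -psumZr; apply: ler_psum => d /andP[d0 dk].
have w0 := w_gt0 R d.
have p0 : 0 <= d%:R * w R d * (4 * C * r4 (2 * d)%:R) / r4 X%:R.
  by rewrite divr_ge0 ?r4_ge0// !mulr_ge0 ?r4_ge0// ltW.
case: ifP => _; last by rewrite subrr normr0.
rewrite beta_wmu// sing_coef1E; case: ifP => sd; last by rewrite subrr normr0.
rewrite -mulrBr normrM ger0_norm ?mulr_ge0 ?(ltW w0)// -[leRHS]mulrA.
apply: ler_wpM2l; first by rewrite mulr_ge0// ltW.
by apply: tot_tail_div => //; exact: leq_trans kX.
Qed.

Lemma psum_gt (a : nat -> R) y X : 0 <= y -> (Num.truncn y <= X)%N ->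
  psum (fun q => if y < q%:R then a q else 0) X = psum a X - psum a (Num.truncn y).
Proof.
move=> y0 yX; rewrite (psum_widen a yX) -psumB; apply: eq_psum => q _.
by rewrite -truncn_lt_nat// ltnNge; case: (q <= _)%N; rewrite ?subrr ?subr0.
Qed.

Lemma singular_tailE y k : 1 <= y -> (0 < k)%N -> singular_tail y k = sing R k - sing_le R (Num.truncn y) k.
Proof.
move=> y1 k0; have y0 : 0 <= y by lra.
have [K hK] := sing_le_lim k0.
rewrite /singular_tail (big_oo_tot (fun q => y < q%:R)).
apply: (@tot_lim R _ _ K (k + Num.truncn y)) => X kX.
have kX' : (k <= X)%N by apply: leq_trans kX; rewrite leq_addr.
have yX : (Num.truncn y <= X)%N by apply: leq_trans kX; rewrite leq_addl.
rewrite psum_gt//.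
have E Z : psum (fun q => (moebius q ^+ 2)%:~R / (totient q)%:R ^+ 2 * complex.Re (ramanujan_sum R q (- k%:Z))) Z = sing_le R Z k.
  rewrite -psum_cq; apply: eq_psum => q _; rewrite moebius_sqr /cq.
  case: (boolP (sqf q)) => sq; last by rewrite !mul0r.
  by rewrite ramanujan_re// totient_mf// mul1r.
rewrite !E; have -> : sing_le R X k - sing_le R (Num.truncn y) k - (sing R k - sing_le R (Num.truncn y) k) = sing_le R X k - sing R k by ring.
exact: hK.
Qed.

Lemma T_tailE y : 0 <= y -> T_tail y = T0 R - psum (inv_phi3 R) (Num.truncn y).
Proof.
move=> y0; have [C hC] := inv_phi3_zdom R.
rewrite /T_tail (big_oo_tot (fun q => y < q%:R)).
apply: (@tot_lim R _ _ (4 * C) (Num.truncn y).+1) => X yX.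
rewrite psum_gt ?(ltnW yX)//.
have E Z : psum (fun q => (moebius q ^+ 2)%:~R / (totient q)%:R ^+ 3) Z = psum (inv_phi3 R) Z.
  apply: eq_psum => q _; rewrite moebius_sqr /inv_phi3.
  by case: (boolP (sqf q)) => sq; rewrite ?mul0r// mul1r totient_mf.
rewrite !E; have -> (a b c : R) : a - b - (c - b) = a - c by ring.
by apply: tot_tail => //; exact: leq_trans yX.
Qed.

Lemma phi2_zdom : exists C : R, zdom (phi2_term R) C.
Proof.
have hb p : prime p -> 0 <= (p%:R * (p%:R - 1) ^+ 2 : R)^-1 <= 2 / p%:R ^+ 2.
  move=> pp; have h := prime_m1_gt0 R pp; have h2 := prime_ge2r R pp.
  have p0 : 0 < p%:R :> R by lra.
  rewrite invr_ge0 mulr_ge0 ?sqr_ge0 ?(ltW p0)//=.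
  have /andP[_ h3] := lam_bound R pp; apply: le_trans h3.
  rewrite lef_pV2 ?posrE ?mulr_gt0 ?exprn_gt0//; apply: ler_wpM2l; first exact: ltW.
  by rewrite expr2 ler_peMr ?(ltW h)//; lra.
by have h := lnp_zdom (ler0n R 2) hb; exists (4 * 2).
Qed.

(** Termwise, 1/(p - 1)^2 = 1/(p (p - 1)^2) + 1/(p (p - 1)). This relation makes ln N and ln y
    combine into ln(N/y^2). *)
Lemma phi1E : phi1 R = phi2 R + Lam R.
Proof.
have [C hC] := phi2_zdom; have hL := @lamS_zdom R.
apply: (@tot_lim R _ _ (4 * C + 4 * 8) 1) => n n0.
have -> : psum (phi1_term R) n = psum (phi2_term R) n + psum (lamS R) n.
  rewrite -psumD; apply: eq_psum => p _; rewrite /phi1_term /phi2_term /lamS /lam.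
  case: ifP => pp; last by rewrite addr0.
  have h := prime_m1_gt0 R pp; have p0 : 0 < p%:R :> R by lra.
  by field; rewrite !gt_eqF.
have -> (a b c d : R) : a + b - (c + d) = (a - c) + (b - d) by ring.
by rewrite [leRHS]mulrDl; apply: le_trans (ler_normD _ _) _; apply: lerD; exact: tot_tail.
Qed.

(** Termwise, p - 2 = (p - 1) - 1 splits the prime sum of the statement. *)
Lemma c_constE : c_const R = 3 / 4 - ln (2 * pi) / 2 + (Lam R - phi2 R) / 2.
Proof.
rewrite /c_const; congr (_ + _); rewrite mulrC mul1r; congr (_ / _).
have [C hC] := phi2_zdom; have hL := @lamS_zdom R.
transitivity (tot (fun p => if prime p then (p%:R - 2) * ln p%:R / (p%:R * (p%:R - 1) ^+ 2) else 0 : R)).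
  (* The sum of the statement starts at 0 and [tot] at 1; the extra term is void because 0 is not
     prime. *)
  congr (limn _); apply/funext => -[|n]; first by rewrite !big_geq.
  by rewrite big_mkcond big_ltn//= add0r.
apply: (@tot_lim R _ _ (4 * 8 + 4 * C) 1) => n n0.
have -> : psum (fun p => if prime p then (p%:R - 2) * ln p%:R / (p%:R * (p%:R - 1) ^+ 2) else 0) n =
   psum (lamS R) n - psum (phi2_term R) n.
  rewrite -psumB; apply: eq_psum => p _; rewrite /phi2_term /lamS /lam.
  case: ifP => pp; last by rewrite subr0.
  have h := prime_m1_gt0 R pp; have p0 : 0 < p%:R :> R by lra.
  by field; rewrite !gt_eqF.
have -> (a b c d : R) : a - b - (c - d) = (a - c) - (b - d) by ring.
by rewrite [leRHS]mulrDl; apply: le_trans (ler_normB _ _) _; apply: lerD; exact: tot_tail.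
Qed.

Lemma inv_phi_approx : exists2 C : R, 0 <= C & forall y, 1 <= y ->
  `|psum (inv_phi R) (Num.truncn y) - (ln y + c1 R)| <= C / Num.sqrt y.
Proof.
have [C C0 hC] := Ls_approx R; exists C => // y y1.
have := hC 1%N y isT ltac:(lra).
by rewrite af1 addr0 /phi /Pf !mf1 divr1 !mulr1 mul1r.
Qed.

(* Used with [l = ln N], [v = ln y], [L = \sum_(q <= y) mu(q)^2 / phi(q)], [lpi = ln (2 pi)]. *)
Lemma combine_moments (M1 M2 M3 T t N l v L l2 c kp q2 La lpi C1 C2 C3 C s : R) :
  lpi = kp - c + La + 3 / 2 ->
  `|M1 - (N ^+ 3 / 3 * T - N ^+ 2 / 2 * (l ^+ 2 / 2 + (c - La + kp + (q2 + La)) * l))| <= C1 * N ^+ 2 ->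
  `|M2 - (N ^+ 3 / 3 * t - N ^+ 2 / 2 * (L * (l + kp - v) + v ^+ 2 / 2 + c * v + q2 * v))| <= C2 * N ^+ 2 ->
  `|M3 - (N ^+ 3 / 3 * t - N ^+ 2 / 2 * L ^+ 2)| <= C3 * N ^+ 2 ->
  `|L - (v + c)| <= C / s -> 1 <= s -> 0 <= C -> 0 <= v -> 2 * v <= l -> l <= l2 ->
  `|M1 - 2 * M2 + M3 - ((T - t) * (N ^+ 3 / 3) - 1 / 4 * N ^+ 2 * (l - 2 * v) ^+ 2
      + (3 / 4 - lpi / 2 + (La - q2) / 2) * N ^+ 2 * (l - 2 * v))|
  <= (C1 + 2 * C2 + C3 + (`|c ^+ 2 - 2 * c * kp| + 2 * C * `|c - kp| + C ^+ 2)) * N ^+ 2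
     + C * (N ^+ 2 / s * l2).
Proof.
move=> lpiE; set e1 := M1 - _; set e2 := M2 - _; set e3 := M3 - _; set dl := L - _ => h1 h2 h3 h4 s1 C0 v0 vl l2l.
have s0 : 0 < s by lra.
have dlC : `|dl| <= C by apply: le_trans h4 _; rewrite ler_pdivrMr// ler_peMr.
(* With [L = v + c + dl], the terms in [l] and [v] free of [dl] match the main term. A constant and
   terms in [dl] are left over, and among these only [dl * (l - 2 * v)] is not bounded by a
   constant. *)
have -> : M1 - 2 * M2 + M3 - ((T - t) * (N ^+ 3 / 3) - 1 / 4 * N ^+ 2 * (l - 2 * v) ^+ 2
      + (3 / 4 - lpi / 2 + (La - q2) / 2) * N ^+ 2 * (l - 2 * v)) =
  (e1 - 2 * e2 + e3) - N ^+ 2 * ((c ^+ 2 - 2 * c * kp) / 2 + dl * (c - kp) + dl * dl / 2 - dl * (l - 2 * v)).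
  by rewrite lpiE /e1 /e2 /e3 /dl; field.
have N20 : 0 <= N ^+ 2 by exact: sqr_ge0.
have b1 : `|e1 - 2 * e2 + e3| <= (C1 + 2 * C2 + C3) * N ^+ 2.
  rewrite [leRHS](_ : _ = C1 * N ^+ 2 + 2 * (C2 * N ^+ 2) + C3 * N ^+ 2); last by ring.
  apply: le_trans (ler_normD _ _) _; apply: lerD => //.
  apply: le_trans (ler_normB _ _) _; apply: lerD => //.
  by rewrite normrM ger0_norm// ler_wpM2l.
have b2 : `|dl * (l - 2 * v)| <= C / s * l2.
  rewrite normrM; apply: ler_pM => //; rewrite ger0_norm; lra.
have b3 : `|dl * (c - kp)| <= C * `|c - kp| by rewrite normrM ler_wpM2r.
have b4 : `|dl * dl / 2| <= C ^+ 2.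
  rewrite normrM [X in _ * X]ger0_norm ?invr_ge0// normrM.
  have := ler_pM (normr_ge0 dl) (normr_ge0 dl) dlC dlC; rewrite -[C * C]expr2.
  have : 0 <= `|dl| * `|dl| by rewrite mulr_ge0.
  lra.
have b5 : `|(c ^+ 2 - 2 * c * kp) / 2| <= `|c ^+ 2 - 2 * c * kp|.
  rewrite normrM [X in _ * X]ger0_norm ?invr_ge0//.
  have := normr_ge0 (c ^+ 2 - 2 * c * kp); lra.
have b6 : 0 <= C * `|c - kp| by rewrite mulr_ge0.
apply: le_trans (ler_normB _ _) _.
rewrite [X in _ <= X + _]mulrDl -[leRHS]addrA; apply: lerD => //.
rewrite normrM (ger0_norm N20) [leRHS](_ : _ = N ^+ 2 * (`|c ^+ 2 - 2 * c * kp| + 2 * C * `|c - kp| + C ^+ 2 + C / s * l2)); last by ring.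
apply: ler_wpM2l => //; apply: le_trans (ler_normB _ _) _; apply: lerD => //.
apply: le_trans (ler_normD _ _) _; apply: lerD => //.
apply: le_trans (ler_normD _ _) _; apply: lerD => //; lra.
Qed.

End Link.

Theorem theorem2 (R : realType) :
  exists C1 C2 : R, forall N y : R, 1 <= y -> y <= Num.sqrt N ->
    `| \sum_(1 <= k < (Num.truncn N).+1) (N - k%:R) ^+ 2 * singular_tail y k ^+ 2
       - (T_tail y * (N ^+ 3 / 3)
          - 1 / 4 * N ^+ 2 * (ln (N / y ^+ 2)) ^+ 2
          + c_const R * N ^+ 2 * ln (N / y ^+ 2)) |
    <= C1 * N ^+ 2 + C2 * (N ^+ 2 / Num.sqrt y * ln (2 * N)).
Proof.
have [C1 C10 h1] := moment_SS R; have [C2 C20 h2] := moment_SSY R; have [C3 C30 h3] := moment_SYSY R.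
have [C C0 h4] := inv_phi_approx R.
exists (C1 + 2 * C2 + C3 + (`|c1 R ^+ 2 - 2 * c1 R * kap R| + 2 * C * `|c1 R - kap R| + C ^+ 2)), C => N y y1 yN.
have N0 : 0 < N by rewrite -sqrtr_gt0; lra.
have yN2 : y ^+ 2 <= N by rewrite -[leRHS](@sqr_sqrtr _ N) ?(ltW N0)// lerXn2r ?nnegrE ?sqrtr_ge0//; lra.
have y2 : y <= y ^+ 2 by rewrite expr2 ler_peMr//; lra.
have yN1 : y <= N by lra.
have N1 : 1 <= N by lra.
have y0 : 0 < y by lra.
have {h1} h1 := h1 N N1; have {h2} h2 := h2 N y y1 yN1; have {h3} h3 := h3 N y y1 yN2.
have {h4} h4 := h4 y y1.
have sy := sqrt_ge1 y1.
have -> : \sum_(1 <= k < (Num.truncn N).+1) (N - k%:R) ^+ 2 * singular_tail y k ^+ 2 =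
  psum (fun k => (N - k%:R) ^+ 2 * (sing R k * sing R k)) (Num.truncn N)
  - 2 * psum (fun k => (N - k%:R) ^+ 2 * (sing R k * sing_le R (Num.truncn y) k)) (Num.truncn N)
  + psum (fun k => (N - k%:R) ^+ 2 * (sing_le R (Num.truncn y) k * sing_le R (Num.truncn y) k)) (Num.truncn N).
  rewrite -psumZ -psumB -psumD; apply: eq_psum => k /andP[k0' _].
  by rewrite singular_tailE//; ring.
rewrite T_tailE ?(ltW y0)// c_constE.
have -> : ln (N / y ^+ 2) = ln N - 2 * ln y.
  rewrite lnM ?posrE ?invr_gt0 ?exprn_gt0// lnV ?posrE ?exprn_gt0// lnXn//.
  by rewrite mulr_natl.
have l0 : 0 <= ln y by exact: ln_ge0.
have lyN : 2 * ln y <= ln N.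
  have : ln (y ^+ 2) <= ln N by rewrite ler_ln ?posrE ?exprn_gt0.
  by rewrite lnXn// mulr_natl.
have lN2 : ln N <= ln (2 * N) by rewrite ler_ln ?posrE ?mulr_gt0//; lra.
(* Euler's constant is expressed through [c1 R], the form in which [combine_moments] cancels it. *)
have gE : gam R = c1 R - Lam R by rewrite /c1; ring.
rewrite phi1E gE in h1; rewrite /U2 in h2.
apply: combine_moments h1 h2 h3 h4 sy C0 l0 lyN lN2.
by rewrite /kap gE; field.
Qed.
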